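(* Let $\Gamma$ be the $1$-skeleton of a polyhedron $\mathcal P$ (a planar trivalent graph with blackboard framing), let $c:E\to\frac12\mathbb N$ be an admissible coloring of its edges, and let $D$ be a face of $\mathcal P$ with boundary edges $e_0,\dots,e_{p-1}$, $e_p=e_0$, numbered in (clockwise) cyclic order. Let $a_i=c(e_i)$ and let $b_i$ be the color of the third edge at the vertex shared by $e_i$ and $e_{i+1}$ (indices mod $p$). For a pair $(\delta(e_0),\delta(e_{p-1}))\in\{\pm\frac12\}^2$ and a map $\delta:\{e_0,\dots,e_{p-1}\}\to\{\pm\frac12\}$ extending it, write $a_i'=a_i+\delta(e_i)$ and $$\mathbb V(j)=\frac{\tau\big(a_j,a_{j+1},b_j;\,a'_{j+1},a'_j,\tfrac12\big)}{\tau\big(a'_j,a'_{j+1},b_j;\,a'_{j+1},a'_j,0\big)}\qquad(j \bmod p),$$ $$k(c,\delta)=\prod_{i=0}^{p-2}\mathbb V(i),\qquad Z(c,\delta(e_0),\delta(e_{p-1}))=\mathbb V(p-1).$$ Then for any pair $(\delta(e_0),\delta(e_{p-1}))\in\{\pm\frac12\}^2$ (for which $Z$ is defined, i.e. $(a_0',a_{p-1}',b_{p-1})$ is an admissible triple), $$\sum_\delta k(c,\delta)\,\langle\Gamma,c+\delta\rangle^{\mathrm U}=Z(c,\delta(e_0),\delta(e_{p-1}))\,\langle\Gamma,c\rangle^{\mathrm U},$$ where $\delta$ ranges over all admissible perturbations of $c$ around $D$ whose values on $e_0$ and $e_{p-1}$ are the prescribed $\delta(e_0),\delta(e_{p-1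})$.
   Context: **Colorings.** $\frac12\mathbb N=\{0,\frac12,1,\dots\}$. A triple $(x,y,z)$ in $\frac12\mathbb N$ is admissible if $x+y\ge z$, $y+z\ge x$, $z+x\ge y$ and $x+y+z\in\mathbb N$; a coloring of a trivalent graph is admissible if the three colors at each vertex form an admissible triple. An admissible perturbation of $c$ around $D$ is a map $\delta:\{e_0,\dots,e_{p-1}\}\to\{\pm\frac12\}$ such that the coloring $c+\delta$ (equal to $c$ off $\partial D$ and to $a_i+\delta(e_i)$ on $e_i$) is admissible. **Quantum notation.** Let $\mathbb D$ be the open unit disc, $\mathbf i=\sqrt{-1}$, $A\in\mathbb D\setminus\{0\}$, $\{n\}=A^{2n}-A^{-2n}$, $[n]=\{n\}/\{1\}$, $[n]!=\prod_{j=1}^n[j]$, $[0]!=1$. The function $[k]$ has no zero in $\mathbb D\setminus\{0\}$ and $\sqrt{[k]}$ denotes its holomorphic square root there that is positive on $(0,1)$ (so it tends to $\sqrt k$ as $A\to1$); $\sqrt{[n]!}=\prod_j\sqrt{[j]}$, extended multiplicatively to products and quotients. Put $$\Delta(a,b,c)=\sqrt{\frac{[a+b-c]!\,[b+c-a]!\,[c+a-b]!}{[a+b+c+1]!}}.$$ For $(a,b,c),(a,e,f),(d,b,f),(d,e,c)$ admissible, the unitary tetrahedron symbol is $$\tau(a,b,c;d,e,f)=\mathbf i^{2(a+b+c+d+e+f)}\Delta(a,b,c)\Delta(a,e,f)\Delta(d,b,f)\Delta(d,e,c)\sum_{k=\max T_i}^{\min Q_j}\frac{(-1)^k[k+1]!}{\prod_{i=1}^4[k-T_i]!\prod_{j=1}^3[Q_j-k]!},$$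 with $T_1=a+b+c$, $T_2=a+e+f$, $T_3=d+b+f$, $T_4=d+e+c$, $Q_1=a+b+d+e$, $Q_2=a+c+d+f$, $Q_3=b+c+e+f$. (E.g. $\tau(a,b,c;b,a,0)=\mathbf i^{2a+2b}/(\sqrt{[2a+1]}\sqrt{[2b+1]})$.) **Unitary Kauffman bracket.** Let $\Gamma\subset S^2$ be the $1$-skeleton of a polyhedron (planar, blackboard framing) with admissible coloring $c$. Fix a region $r_0$ of $S^2\setminus\Gamma$. A shadow-state is a map $s$ from regions to $\frac12\mathbb N$ with $s(r_0)=0$ such that for each edge $e$ with adjacent regions $r,r'$ the triple $(s(r),s(r'),c(e))$ is admissible. Then $$\langle\Gamma,c\rangle^{\mathrm U}=\sum_s\ \prod_{r}(-1)^{2s(r)}[2s(r)+1]\ \prod_{v}\tau(x_1,x_2,x_3;s_1,s_2,s_3),$$ where the sum is over the (finitely many) shadow-states, $r$ runs over regions, $v$ over vertices, $x_1,x_2,x_3$ are the colors of the edges at $v$ and $s_i$ is the state of the region at $v$ lying between the two edges other than the $i$-th. This is independent of the choice of $r_0$ (known invariance of the Kauffman bracket). *)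

(* Defs.v *)
From HB Require Import structures.
From mathcomp Require Import all_boot all_order all_algebra all_fingroup.
From mathcomp Require Import boolp classical_sets fsbigop reals.
From mathcomp Require Import topology normedtype derive.
From mathcomp Require Import ring.
From mathcomp.real_closed Require Import complex.

Set Implicit Arguments.
Unset Strict Implicit.
Unset Printing Implicit Defensive.

Import Order.TTheory GRing.Theory Num.Theory.
Import numFieldNormedType.Exports.

(* Colors, states and perturbations are stored doubled: the natural number n  *)
(* stands for the half-integer n/2.                                           *)

Section Colors.
Local Open Scope nat_scope.

Definition adm (x y z : nat) : bool :=
  [&& z <= x + y, x <= y + z, y <= z + x & ~~ odd (x + y + z)].

(* Adding +1/2 (true) or -1/2 (false); the latter is legal only if 0 < n.     *)
Definition shift_color (u : bool) (n : nat) : nat := if u then n.+1 else n.-1.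
Definition shift_ok (u : bool) (n : nat) : bool := u || (0 < n).

End Colors.

Section Quantum.
Local Open Scope ring_scope.
Local Open Scope complex_scope.
Variable R : realType.
Notation C := R[i].

Definition qint (n : nat) (A : C) : C :=
  (A ^+ (2 * n) - A ^- (2 * n)) / (A ^+ 2 - A ^- 2).

Definition qint_root (k : nat) (f : C -> C) : Prop :=
  [/\ forall z : C, z != 0 -> `|z| < 1 -> derivable (f : C^o -> C^o) z 1,
      forall z : C, z != 0 -> `|z| < 1 -> f z ^+ 2 = qint k z
    & forall t : R, 0 < t -> t < 1 -> 0 < f t%:C].

Variables (rt : nat -> C -> C) (A : C).

Definition qfact (n : nat) : C := \prod_(1 <= j < n.+1) qint j A.
Definition qfact_root (n : nat) : C := \prod_(1 <= j < n.+1) rt j A.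

Definition Delta (a b c : nat) : C :=
  qfact_root (a + b - c)./2 * qfact_root (b + c - a)./2 *
  qfact_root (c + a - b)./2 / qfact_root ((a + b + c)./2).+1.

(* Meaningful when (a,b,c), (a,e,f), (d,b,f), (d,e,c) are admissible.         *)
Definition tau (a b c d e f : nat) : C :=
  let T1 := (a + b + c)./2 in let T2 := (a + e + f)./2 in
  let T3 := (d + b + f)./2 in let T4 := (d + e + c)./2 in
  let Q1 := (a + b + d + e)./2 in let Q2 := (a + c + d + f)./2 in
  let Q3 := (b + c + e + f)./2 in
  'i ^+ (a + b + c + d + e + f) *
  Delta a b c * Delta a e f * Delta d b f * Delta d e c *
  \sum_(maxn (maxn T1 T2) (maxn T3 T4) <= k < (minn Q1 (minn Q2 Q3)).+1)
    ((-1) ^+ k * qfact k.+1 /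
     (qfact (k - T1) * qfact (k - T2) * qfact (k - T3) * qfact (k - T4) *
      (qfact (Q1 - k) * qfact (Q2 - k) * qfact (Q3 - k)))).

(* The ratio V(j), for a = a_j, a1 = a_{j+1}, b = b_j, a' = a'_j and          *)
(* a1' = a'_{j+1}.                                                            *)
Definition tau_ratio (a a1 b a' a1' : nat) : C :=
  tau a a1 b a1' a' 1 / tau a' a1' b a1' a' 0.

End Quantum.

(* The roots hypothesized in qint_root exist: the principal square root is      *)
(* holomorphic on Re > 0 and [k] = z^(-2(k-1)) (1 - z^(4k)) / (1 - z^4).       *)
Section RootExists.
Local Open Scope ring_scope.
Local Open Scope complex_scope.
Local Open Scope classical_set_scope.
Variable R : realType.
Notation C := R[i].
Implicit Types z w : C.

Lemma Re_sqrtc_ge0 z : 0 <= complex.Re (sqrtc z).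
Proof. by case: z => a b; apply: sqrtr_ge0. Qed.

Lemma Re_sqrtc_gt0 z : 0 < complex.Re z -> 0 < complex.Re (sqrtc z).
Proof.
case: z => a b /= a0; rewrite sqrtr_gt0 divr_gt0 ?ltr0n //.
by rewrite ltr_wpDl ?sqrtr_ge0.
Qed.

Lemma Re_complexD z w : complex.Re (z + w) = complex.Re z + complex.Re w.
Proof. by case: z w => a b [c d]. Qed.

Lemma Re_gt0_neq0 z : 0 < complex.Re z -> z != 0.
Proof. by apply: contraTneq => ->; rewrite ltxx. Qed.

Lemma sqrtc_sub z w : 0 < complex.Re z ->
  sqrtc w - sqrtc z = (w - z) / (sqrtc w + sqrtc z).
Proof.
move=> z0; have d0 : sqrtc w + sqrtc z != 0.
  by apply: Re_gt0_neq0; rewrite Re_complexD ltr_wpDl ?Re_sqrtc_ge0 ?Re_sqrtc_gt0.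
by apply: (mulIf d0); rewrite divfK // -subr_sqr !sqr_sqrtc.
Qed.

Lemma sqrtc_lip z w : 0 < complex.Re z ->
  `|sqrtc w - sqrtc z| <= `|w - z| / (complex.Re (sqrtc z))%:C.
Proof.
move=> z0; rewrite sqrtc_sub // normrM normfV ler_wpM2l // lef_pV2.
- apply: le_trans (normc_ge_Re _); rewrite lecR Re_complexD ger0_norm.
    by rewrite lerDr Re_sqrtc_ge0.
  by rewrite addr_ge0 ?Re_sqrtc_ge0.
- rewrite posrE normr_gt0; apply: Re_gt0_neq0.
  by rewrite Re_complexD ltr_wpDl ?Re_sqrtc_ge0 ?Re_sqrtc_gt0.
by rewrite posrE ltcR Re_sqrtc_gt0.
Qed.

Lemma continuous_sqrtc z : 0 < complex.Re z ->
  {for z, continuous (@sqrtc R : C^o -> C^o)}.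
Proof.
move=> z0; have s0 := Re_sqrtc_gt0 z0.
apply/(@cvgrPdist_le _ C^o C^o (nbhs (z : C^o)) (nbhs_filter (z : C^o))) => /= e e0.
have d0 : 0 < e * (complex.Re (sqrtc z))%:C by rewrite mulr_gt0 ?ltcR.
have H := @cvgr_dist_le _ C^o _ (nbhs (z : C^o)) (nbhs_filter _) id z (@cvg_id _ _) _ d0.
near=> w; rewrite distrC (le_trans (sqrtc_lip _ z0)) //.
rewrite ler_pdivrMr ?ltcR // distrC.
by near: w; exact: H.
Unshelve. all: by end_near. Qed.

Lemma derivable_sqrtc z : 0 < complex.Re z ->
  derivable (@sqrtc R : C^o -> C^o) z 1.
Proof.
move=> z0; apply/cvg_ex; exists ((sqrtc z + sqrtc z)^-1 : C^o) => /=.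
have d0 : sqrtc z + sqrtc z != 0.
  by apply: Re_gt0_neq0; rewrite Re_complexD addr_gt0 ?Re_sqrtc_gt0.
apply: (@cvg_trans _ (((fun h : C^o => (sqrtc (h + z) + sqrtc z)^-1 : C^o) @ 0^')%classic)).
  apply: near_eq_cvg; near=> h.
  have h0 : h != 0 by near: h; apply: (@nbhs_dnbhs_neq C^o 0).
  rewrite /= [h *: 1]mulr1 sqrtc_sub // addrK [in RHS]scalerA.
  by rewrite [RHS](_ : _ = h^-1 * h / (sqrtc (h + z) + sqrtc z)) // mulVf // mul1r.
apply: cvgV => //; apply: cvgD; last exact: cvg_cst.
apply: (@cvg_trans _ ((fun h : C^o => sqrtc (h + z) : C^o) @ nbhs 0)%classic).
  by apply: cvg_app; apply: cvg_within.
apply: (@cvg_comp _ _ _ (fun h : C^o => h + z : C^o) (sqrtc (R:=R) : C^o -> C^o) _ (nbhs (z : C^o))); last first.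
  exact: (continuous_sqrtc z0).
have H : ((fun h : C^o => h + z : C^o) @ nbhs (0 : C^o) --> (0 + z : C^o))%classic.
  by apply: cvgD; [exact: cvg_id|exact: cvg_cst].
by rewrite add0r in H.
Unshelve. all: by end_near. Qed.

Lemma Re_1subX_gt0 z n : `|z| < 1 -> (0 < n)%N -> 0 < complex.Re (1 - z ^+ n).
Proof.
move=> z1 n0.
have : `|z ^+ n| < 1 by rewrite normrX exprn_ilt1 -?lt0n.
move/(le_lt_trans (normc_ge_Re _)); rewrite (ltcR _ 1) => h.
by rewrite raddfB /= subr_gt0 (le_lt_trans (ler_norm _) h).
Qed.

Lemma qint_root_ex k : (0 < k)%N -> exists f : C -> C, qint_root k f.
Proof.
move=> k0.
pose g n z : C := sqrtc (1 - z ^+ n).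
exists (fun z => g (4 * k)%N z * (z ^+ k.-1)^-1 * (g 4%N z)^-1).
have gn0 n z : `|z| < 1 -> (0 < n)%N -> g n z != 0.
  by move=> z1 n0; apply/Re_gt0_neq0/Re_sqrtc_gt0/Re_1subX_gt0.
have dX n (z : C^o) : differentiable (fun z : C^o => z ^+ n : C^o) z.
  by apply/derivable1_diffP; exact: (@exprn_derivable C n z 1).
have dg n (z : C^o) : `|z| < 1 -> (0 < n)%N -> differentiable (g n : C^o -> C^o) z.
  move=> z1 n0.
  apply: (@differentiable_comp _ C^o C^o C^o (fun z : C^o => 1 - z ^+ n : C^o)).
    apply: differentiableB; first exact: differentiable_cst.
    exact: dX.
  by apply/derivable1_diffP/derivable_sqrtc/Re_1subX_gt0.
split.
- move=> z z0 z1; apply/derivable1_diffP.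
  apply: differentiableM; first apply: differentiableM.
  + by apply: dg; rewrite ?muln_gt0.
  + apply: differentiableV; last exact: expf_neq0.
    exact: dX.
  + by apply: differentiableV; [exact: dg|exact: gn0].
- move=> z z0 z1; rewrite !exprMn !exprVn !sqr_sqrtc /qint.
  have u0 : 1 - z ^+ 4 != 0 by apply/Re_gt0_neq0/Re_1subX_gt0.
  case: k k0 => // m _; have E n : z ^+ (n * m.+1) = (z ^+ m) ^+ n * z ^+ n.
    by rewrite -exprM -exprD mulnC mulSn addnC.
  rewrite !E succnK.
  have m0 : z ^+ m != 0 by rewrite expf_neq0.
  move: (z ^+ m) m0 => t m0; field.
  by rewrite z0 m0 u0 -oppr_eq0 opprB -expr2 -exprM u0.
- move=> t t0 t1.
  have tC n : (0 < n)%N -> 0 < g n t%:C.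
    move=> n0; have h : 0 < 1 - t%:C ^+ n.
      by rewrite subr_gt0 exprn_ilt1 -?lt0n // ?(ltcR t 1) // (lecR 0) ltW.
    rewrite /g sqrtc_sqrtr ?ltW // ltcR sqrtr_gt0 -ltcR RRe_real //.
    by rewrite gtr0_real.
  by rewrite !mulr_gt0 ?invr_gt0 ?exprn_gt0 ?tC ?muln_gt0 ?(ltcR 0).
Qed.
End RootExists.

(* A graph drawn on a closed oriented surface, as a combinatorial map: darts  *)
(* are oriented edges, edge reverses a dart, and node x is the next dart      *)
(* clockwise around the origin of x.                                          *)
Record cmap := CMap {
  dart : finType;
  edge : {perm dart};
  node : {perm dart};
  _ : forall x, edge x != x;
  _ : forall x, edge (edge x) = x
}.

Section Maps.
Local Open Scope nat_scope.
Variable G : cmap.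
Implicit Types x y : dart G.

(* face x is the dart following x clockwise along the boundary of the region  *)
(* on the right of x; near the origin of x this region is the sector between  *)
(* x and node x.                                                              *)
Definition face : {perm dart G} := (edge G * (node G)^-1)%g.

Definition orbit_t (s : {perm dart G}) := {A : {set dart G} | A \in porbits s}.

Definition vertex_t := orbit_t (node G).
Definition edge_t := orbit_t (edge G).
Definition region_t := orbit_t face.

Lemma mem_porbits (s : {perm dart G}) x : porbit s x \in porbits s.
Proof. by apply: imset_f; rewrite inE. Qed.

Definition orbit_of (s : {perm dart G}) x : orbit_t s :=
  exist (fun A : {set dart G} => A \in porbits s) _ (mem_porbits s x).

Definition vertex_of x : vertex_t := orbit_of (node G) x.
Definition edge_of x : edge_t := orbit_of (edge G) x.
Definition region_of x : region_t := orbit_of face x.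

Lemma vertex_dart_ex (v : vertex_t) : exists x, vertex_of x == v.
Proof. by case: v => v vP; have /imsetP[x _ def_v] := vP; exists x; apply/eqP/val_inj. Qed.

Definition vertex_dart (v : vertex_t) : dart G := xchoose (vertex_dart_ex v).

Definition trivalent : Prop := forall v : vertex_t, #|val v| = 3.

Definition adjacent : rel vertex_t :=
  [rel u v | [exists x, (vertex_of x == u) && (vertex_of (edge G x) == v)]].

Definition simple_graph : Prop :=
  (forall x, vertex_of (edge G x) != vertex_of x) /\
  (forall x y, vertex_of x = vertex_of y ->
     vertex_of (edge G x) = vertex_of (edge G y) -> x = y).

Definition three_connected : Prop :=
  3 < #|{: vertex_t}| /\
  forall S : {set vertex_t}, #|S| < 3 -> forall u v, u \notin S -> v \notin S ->
    connect [rel u v | [&& u \notin S, v \notin S & adjacent u v]] u v.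

(* Euler's formula; the surface is the sphere when the graph is connected.    *)
Definition euler_planar : Prop :=
  #|{: vertex_t}| + #|{: region_t}| = #|{: edge_t}| + 2.

Definition trivalent_polyhedron : Prop :=
  [/\ trivalent, simple_graph, three_connected & euler_planar].

Definition adm_coloring (c : edge_t -> nat) : Prop :=
  forall x, adm (c (edge_of x)) (c (edge_of (node G x)))
                (c (edge_of (node G (node G x)))).

Definition shadow_state (r0 : region_t) (c : edge_t -> nat)
    (s : {ffun region_t -> nat}) : Prop :=
  s r0 = 0 /\
  forall x, adm (s (region_of x)) (s (region_of (edge G x))) (c (edge_of x)).

(* A face D together with the numbering of its boundary is given by a dart    *)
(* x0 with D on its right: bdart x0 i traverses e_i and e_{i+1} shares its    *)
(* origin with the end of that traversal.                                     *)
Definition bdart x0 (i : nat) : dart G := iter i face x0.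
Definition blength x0 : nat := #|val (region_of x0)|.

Definition boundary_t x0 : Type :=
  {e : edge_t | [exists x in val (region_of x0), edge_of x == e]}.

Lemma boundary_subproof x0 i :
  [exists x in val (region_of x0), edge_of x == edge_of (bdart x0 i)].
Proof.
apply/existsP; exists (bdart x0 i); rewrite eqxx andbT.
by rewrite /bdart -permX mem_porbit.
Qed.

Definition bedge x0 (i : nat) : boundary_t x0 :=
  exist (fun e => [exists x in val (region_of x0), edge_of x == e] : Prop)
    (edge_of (bdart x0 i)) (boundary_subproof x0 i).

(* The third edge at the vertex shared by e_i and e_{i+1}, i.e. besides those *)
(* of bdart x0 i.+1 and of edge G (bdart x0 i) = node G (bdart x0 i.+1).      *)
Definition spoke x0 (i : nat) : edge_t :=
  edge_of (node G (node G (bdart x0 i.+1))).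

Definition perturb x0 (c : edge_t -> nat) (delta : {ffun boundary_t x0 -> bool})
    (e : edge_t) : nat :=
  if insub e is Some e' then shift_color (delta e') (c e) else c e.

Definition adm_perturbation x0 (c : edge_t -> nat)
    (delta : {ffun boundary_t x0 -> bool}) : Prop :=
  (forall e, shift_ok (delta e) (c (val e))) /\ adm_coloring (perturb c delta).

End Maps.

Section Bracket.
Local Open Scope ring_scope.
Local Open Scope classical_set_scope.
Variables (R : realType) (rt : nat -> R[i] -> R[i]) (A : R[i]) (G : cmap).

(* The region of x (between x and node x) faces the third edge at the vertex, *)
(* that of node x (between the second and third edges) faces the first, etc.  *)
Definition vertex_weight (c : edge_t G -> nat) (s : {ffun region_t G -> nat})
    (x : dart G) : R[i] :=
  let y := node G x in let z := node G y in
  tau rt A (c (edge_of x)) (c (edge_of y)) (c (edge_of z))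
    (s (region_of y)) (s (region_of z)) (s (region_of x)).

(* The sum ranges over a finite set, G being connected in the intended use;   *)
(* vertex_weight does not depend on the dart chosen at each vertex, as tau is *)
(* invariant under permutations of its columns.                               *)
Definition bracket (r0 : region_t G) (c : edge_t G -> nat) : R[i] :=
  \sum_(s \in [set s | shadow_state r0 c s])
    ((\prod_(r : region_t G) ((-1) ^+ s r * qint (s r).+1 A)) *
     \prod_(v : vertex_t G) vertex_weight c s (vertex_dart v)).

Definition kcoef (x0 : dart G) (c : edge_t G -> nat)
    (delta : {ffun boundary_t x0 -> bool}) : R[i] :=
  let a i := c (edge_of (bdart x0 i)) in
  let a' i := perturb c delta (edge_of (bdart x0 i)) in
  \prod_(0 <= i < (blength x0).-1)
    tau_ratio rt A (a i) (a i.+1) (c (spoke x0 i)) (a' i) (a' i.+1).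

(* u0 and u1 are the signs prescribed on e_0 and e_{p-1}.                     *)
Definition Zcoef (x0 : dart G) (c : edge_t G -> nat) (u0 u1 : bool) : R[i] :=
  let p1 := (blength x0).-1 in
  let a0 := c (edge_of x0) in
  let ap := c (edge_of (bdart x0 p1)) in
  tau_ratio rt A ap a0 (c (spoke x0 p1)) (shift_color u1 ap) (shift_color u0 a0).

End Bracket.

(* Main.v *)
Require Import Defs.
From mathcomp Require Import all_boot all_order all_algebra all_fingroup.
From mathcomp Require Import boolp classical_sets fsbigop reals.
From mathcomp Require Import ring zify.
From mathcomp.real_closed Require Import complex.

(** The weight of a shadow-state is a product of tetrahedra, one per vertex,
    and of signed quantum dimensions, one per region.  The recursion expresses
    that a spin-1/2 strand running parallel to the boundary of D can be fused
    into that boundary.  Algebraically the strand is a product of tetrahedra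
    with one edge of spin 1/2 ([edge_tet]), one for each edge that it runs
    along or crosses, and it moves by the Biedenharn-Elliott identity with one
    such edge ([pentagon]).

    The pentagon identity.  With a spin-1/2 edge the sum has two terms.  Each
    triad that contains the summation color occurs in two of the tetrahedra,
    so the square roots hidden in Delta pair off, and the Racah sum of a
    tetrahedron with a spin-1/2 edge has a single term, so that such a
    tetrahedron reduces to one quantum integer.  What is left is a three-term
    contiguous relation between Racah sums, in three versions according to the
    signs of the two given shifts; each is proved by telescoping
    ([rac_rel_pp], [rac_rel_pm], [rac_rel_mm]).

    Base region other than D.  The ratio V(j) is the tetrahedron [edge_tet] of
    the strand at the spoke between e_j and e_(j+1), up to square roots of
    dimensions ([tau_ratioE]).  Fix the states of all regions but D.  The sum
    over the signs on e_1, ..., e_(p-2) is then a product of transfer matrices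
    ([chain_sum]).  At the first corner the pentagon introduces a second state
    t of D, the state before perturbation, next to the state t1 after it
    ([corner_open]); each further corner moves the strand across one edge
    ([corner_step]); at the last corner the pentagon removes t1 and leaves
    V(p-1) ([corner_close]).  The result is [face_transport], and summing over
    the states off D gives [recursion_off].  Inadmissible sign patterns drop
    out, since the tetrahedra are taken to vanish on inadmissible data.

    Base region D.  The state of D is then pinned, and the brackets are first
    moved to the base region on the other side of e_0 ([bracket_adjacent]).
    For an edge e of color k, basing the bracket at one side of e or at the
    other amounts to pinning the states of its two sides at (0, k) or at
    (k, 0), so it suffices to pass from (j, k - j) to (j + 1, k - j - 1).  Lay
    the spin-1/2 strand along a line that sweeps the sphere from one end of e
    to the other, with one state function ahead of the line and another one
    behind it.  By the pentagon identity the total does not change when the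
    line passes a vertex ([swept_step]), so the sums pinned at both pairs agree
    up to the same [edge_tet] of e, which is not zero ([pinned_sum_eq]).  The
    vertices are taken in an order in which each has a neighbor before it and
    a neighbor after it, except the ends of e ([st_numbering]); Euler's formula
    then forces each region other than the two sides of e to be entered once
    and left once ([extremal_count]), which is what makes each passage of a
    vertex a single pentagon. *)

Set Implicit Arguments.
Unset Strict Implicit.
Unset Printing Implicit Defensive.

Import Order.TTheory GRing.Theory Num.Theory.
Local Open Scope ring_scope.

(** * Contiguous relations of Racah sums *)

Section QuantumIntegers.
Variables (F : fieldType) (q : F).

Definition qi (z : int) : F := (q ^ z - (q ^ z)^-1) / (q - q^-1).

Lemma qi0 : qi 0 = 0.
Proof. by rewrite /qi expr0z invr1 subrr mul0r. Qed.

Definition fct (n : nat) : F := \prod_(1 <= j < n.+1) qi j%:Z.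

(** The value 0 at negative integers enforces the limits of the Racah sums:
    their terms vanish outside the range of summation. *)
Definition rfct (z : int) : F := if z is Posz n then (fct n)^-1 else 0.

Lemma fct0 : fct 0 = 1.
Proof. by rewrite /fct big_geq. Qed.

Lemma fctS n : fct n.+1 = qi n.+1%:Z * fct n.
Proof. by rewrite /fct big_nat_recr //= mulrC. Qed.

Lemma rfct_lt0 z : z < 0 -> rfct z = 0.
Proof. by case: z. Qed.

Definition rterm (T1 T2 T3 T4 Q1 Q2 Q3 : int) (k : nat) : F :=
  (-1) ^+ k * fct k.+1 *
  (rfct (k%:Z - T1) * rfct (k%:Z - T2) * rfct (k%:Z - T3) * rfct (k%:Z - T4)) *
  (rfct (Q1 - k%:Z) * rfct (Q2 - k%:Z) * rfct (Q3 - k%:Z)).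

(** The alternating sum of a tetrahedron, its seven bounds being free
    parameters; K is any cut-off beyond the range of summation. *)
Definition rac (K : nat) (T1 T2 T3 T4 Q1 Q2 Q3 : int) : F :=
  \sum_(k < K) rterm T1 T2 T3 T4 Q1 Q2 Q3 k.

Lemma rterm_out T1 T2 T3 T4 Q1 Q2 Q3 (k : nat) :
  [|| k%:Z < T1, k%:Z < T2, k%:Z < T3, k%:Z < T4,
      Q1 < k%:Z, Q2 < k%:Z | Q3 < k%:Z] ->
  rterm T1 T2 T3 T4 Q1 Q2 Q3 k = 0.
Proof.
by do 6?[case/orP]; rewrite -subr_lt0 => /rfct_lt0 e; rewrite /rterm e ?(mulr0, mul0r).
Qed.

Lemma rac_out K T1 T2 T3 T4 Q1 Q2 Q3 :
  [|| Q1 < T1, Q1 < T2, Q1 < T3, Q1 < T4,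
      Q2 < T1, Q2 < T2, Q2 < T3, Q2 < T4,
      Q3 < T1, Q3 < T2, Q3 < T3 | Q3 < T4] ->
  rac K T1 T2 T3 T4 Q1 Q2 Q3 = 0.
Proof. by move=> h; rewrite /rac big1 // => k _; rewrite rterm_out //; lia. Qed.

(** A lower bound that equals an upper bound leaves a single index. This is
    what reduces a tetrahedron with a spin-1/2 edge to a monomial. *)
Lemma rac_single K T1 T2 T3 T4 Q1 Q2 Q3 (k : nat) : (k < K)%N ->
  k%:Z \in [:: T1; T2; T3; T4] -> k%:Z \in [:: Q1; Q2; Q3] ->
  rac K T1 T2 T3 T4 Q1 Q2 Q3 = rterm T1 T2 T3 T4 Q1 Q2 Q3 k.
Proof.
rewrite !inE => ltK hT hQ; rewrite /rac (bigD1 (Ordinal ltK)) //= big1 ?addr0 //.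
by move=> j; rewrite -val_eqE /= => nejk; rewrite rterm_out //; lia.
Qed.

Lemma sum_shift K (f : nat -> F) : f 0%N = 0 -> f K = 0 ->
  \sum_(k < K) f k = \sum_(k < K) f k.+1.
Proof.
move=> f0 fK; rewrite -(big_mkord xpredT) -(big_mkord xpredT (fun k => f k.+1)).
transitivity (\sum_(0 <= k < K.+1) f k); first by rewrite big_nat_recr //= fK addr0.
by rewrite big_nat_recl // f0 add0r.
Qed.

Lemma telescope_eq0 K (f : 'I_K -> F) (g : nat -> F) : g 0%N = 0 -> g K = 0 ->
  (forall k : 'I_K, f k = g k - g k.+1) -> \sum_(k < K) f k = 0.
Proof.
move=> g0 gK e; rewrite (eq_bigr _ (fun k _ => e k)).
rewrite -(big_mkord xpredT (fun k => g k - g k.+1)).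
under eq_bigr do rewrite -opprB.
by rewrite sumrN telescope_sumr // g0 gK subrr oppr0.
Qed.

Hypothesis q_neq0 : q != 0.

(** Identities between products of quantum integers are identities between
    rational functions of the powers of q that occur in them. *)
Ltac qi_field :=
  rewrite /qi !(expfzDr, =^~ invr_expz) //;
  have xz n : q ^ n != 0 by [rewrite expfz_neq0 |];
  generalize (q - q^-1)^-1; intro;
  repeat match goal with |- context [q ^ ?n] =>
    is_var n; let u := fresh "u" in let hu := fresh "hu" in
    have hu := xz n; set u := q ^ n in hu *; clearbody u end;
  field; rewrite q_neq0 /=; repeat (apply/andP; split => //).

(** The certificates of the contiguous relations below. Divided by the
    factorials common to all the terms of index k, the left-hand side is the
    difference between two consecutive values of the telescoping function, and
    the right-hand side the combination of Racah terms. The letters p and m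
    stand for the signs of the two shifts in the case of the pentagon identity
    served by the relation. *)
Lemma bracket_identity_pp (k T1 T2 T3 T4 Q1 Q2 Q3 : int) :
  Q1 + Q2 + Q3 = T1 + T2 + T3 + T4 ->
  qi (k + 2) * qi (Q1 - k) * qi (Q2 - k) * qi (Q3 + 1 - k)
  + qi (k + 1 - T1) * qi (k - T2) * qi (k - T3) * qi (k - T4)
  = qi (Q1 + 1 - T1) * qi (Q2 + 1 - T1) * qi (k + 2) * qi (Q3 + 1 - k)
  + qi (Q3 + 1 - T3) * qi (Q3 + 1 - T4) * qi (k + 1 - T1) * qi (k - T2)
  - qi (T2 + 2) * qi (T3 + T4 + 1 - Q3) * qi (k + 1 - T1) * qi (Q3 + 1 - k).
Proof.
move=> e; have -> : Q1 = T1 + T2 + T3 + T4 - Q2 - Q3 by rewrite -e; ring.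
by qi_field.
Qed.

Lemma bracket_identity_pm (k T1 T2 T3 T4 Q1 Q2 Q3 : int) :
  Q1 + Q2 + Q3 = T1 + T2 + T3 + T4 ->
  qi (k + 2) * qi (Q1 + 1 - k) * qi (Q2 - k) * qi (Q3 - k)
  + qi (k - T1) * qi (k - T2) * qi (k + 1 - T3) * qi (k - T4)
  = qi (Q1 + 1 - T1) * qi (Q1 + 1 - T2) * qi (k - T4) * qi (k + 1 - T3)
  + qi (T3 + 1) * qi (Q3 + 1 - T3) * qi (Q2 - k) * qi (Q1 + 1 - k)
  - qi (Q2 - T4) * qi (T3 + T4 + 1 - Q3) * qi (Q1 + 1 - k) * qi (k + 1 - T3).
Proof.
move=> e; have -> : Q1 = T1 + T2 + T3 + T4 - Q2 - Q3 by rewrite -e; ring.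
by qi_field.
Qed.

Lemma bracket_identity_mm (k T1 T2 T3 T4 Q1 Q2 Q3 : int) :
  Q1 + Q2 + Q3 = T1 + T2 + T3 + T4 ->
  qi (k + 2) * qi (Q1 - k) * qi (Q2 - k) * qi (Q3 - k)
  + qi (k + 1 - T1) * qi (k + 1 - T2) * qi (k - T3) * qi (k - T4)
  = qi (Q1 + 1 - T2) * qi (Q2 + 1 - T2) * qi (k + 2) * qi (Q3 - k)
  + qi (T3 + 2) * qi (T4 + 2) * qi (k + 1 - T1) * qi (k + 1 - T2)
  - qi (Q3 + 1 - T1) * qi (T3 + T4 + 2 - Q3) * qi (k + 2) * qi (k + 1 - T2).
Proof.
move=> e; have -> : Q1 = T1 + T2 + T3 + T4 - Q2 - Q3 by rewrite -e; ring.
by qi_field.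
Qed.

Hypothesis qi_neq0 : forall n : nat, (0 < n)%N -> qi n%:Z != 0.

Lemma fct_neq0 n : fct n != 0.
Proof. by elim: n => [|n IHn]; rewrite ?fct0 ?oner_eq0 // fctS mulf_neq0 ?qi_neq0. Qed.

Lemma rfctB1 z : rfct (z - 1) = qi z * rfct z.
Proof.
case: z => [[|n]|n]; first by rewrite qi0 mul0r.
  have -> : Posz n.+1 - 1 = Posz n by lia.
  by rewrite /rfct fctS invfM mulVKf ?qi_neq0.
have -> : Negz n - 1 = Negz n.+1 by lia.
by rewrite /= mulr0.
Qed.

(** Telescoping sums: the terms of the three Racah sums combine into the
    difference of consecutive values of another Racah term, which vanishes at
    both ends of the range. *)
Lemma rac_rel_pp K T1 T2 T3 T4 Q1 Q2 Q3 :
  Q1 + Q2 + Q3 = T1 + T2 + T3 + T4 -> 0 <= T2 -> Q1 + 1 < K%:Z ->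
  qi (Q3 + 1 - T3) * qi (Q3 + 1 - T4) * rac K T1 (T2 + 1) T3 T4 Q1 Q2 (Q3 + 1)
  - qi (Q1 + 1 - T1) * qi (Q2 + 1 - T1) *
    rac K T1 (T2 + 1) (T3 + 1) (T4 + 1) (Q1 + 1) (Q2 + 1) (Q3 + 1)
  = qi (T2 + 2) * qi (T3 + T4 + 1 - Q3) * rac K T1 T2 T3 T4 Q1 Q2 Q3.
Proof.
move=> sumQ T2_ge0 KQ; apply/eqP; rewrite -subr_eq0; apply/eqP.
(* All the bounds of the second sum but T1 are raised by one, hence its reindexing. *)
rewrite {2}/rac sum_shift; try by rewrite rterm_out //; lia.
rewrite /rac !mulr_sumr -!sumrB.
apply: (@telescope_eq0 K _ (rterm T1 (T2 + 1) (T3 + 1) (T4 + 1) Q1 Q2 (Q3 + 1)));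
  try by rewrite rterm_out //; lia.
move=> k; move: (nat_of_ord k) => {}k; have D := bracket_identity_pp k%:Z sumQ.
rewrite /rterm !(fctS k.+1).
have -> : k.+2%:Z = k%:Z + 2 by lia.
have -> : k.+1%:Z = k%:Z + 1 by lia.
have -> : k%:Z - T1 = k%:Z + 1 - T1 - 1 by ring.
have -> : k%:Z + 1 - (T2 + 1) = k%:Z - T2 by ring.
have -> : k%:Z + 1 - (T3 + 1) = k%:Z - T3 by ring.
have -> : k%:Z + 1 - (T4 + 1) = k%:Z - T4 by ring.
have -> : k%:Z - (T2 + 1) = k%:Z - T2 - 1 by ring.
have -> : k%:Z - (T3 + 1) = k%:Z - T3 - 1 by ring.
have -> : k%:Z - (T4 + 1) = k%:Z - T4 - 1 by ring.
have -> : Q1 + 1 - (k%:Z + 1) = Q1 - k%:Z by ring.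
have -> : Q2 + 1 - (k%:Z + 1) = Q2 - k%:Z by ring.
have -> : Q3 + 1 - (k%:Z + 1) = Q3 + 1 - k%:Z - 1 by ring.
have -> : Q1 - (k%:Z + 1) = Q1 - k%:Z - 1 by ring.
have -> : Q2 - (k%:Z + 1) = Q2 - k%:Z - 1 by ring.
have -> : Q3 - k%:Z = Q3 + 1 - k%:Z - 1 by ring.
rewrite !rfctB1 exprS.
set s := (-1) ^+ k; set f := fct _.
set H := s * f * (rfct (k%:Z + 1 - T1) * rfct (k%:Z - T2) * rfct (k%:Z - T3) *
  rfct (k%:Z - T4) * (rfct (Q1 - k%:Z) * rfct (Q2 - k%:Z) * rfct (Q3 + 1 - k%:Z))).
transitivity (H * (qi (k%:Z + 2) * qi (Q1 - k%:Z) * qi (Q2 - k%:Z) * qi (Q3 + 1 - k%:Z)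
  + qi (k%:Z + 1 - T1) * qi (k%:Z - T2) * qi (k%:Z - T3) * qi (k%:Z - T4))).
  by rewrite D /H; ring.
by rewrite /H; ring.
Qed.

Lemma rac_rel_pm K T1 T2 T3 T4 Q1 Q2 Q3 :
  Q1 + Q2 + Q3 = T1 + T2 + T3 + T4 -> 0 <= T1 -> Q2 < K%:Z ->
  qi (Q1 + 1 - T1) * qi (Q1 + 1 - T2) * rac K T1 T2 T3 (T4 + 1) (Q1 + 1) Q2 Q3
  + qi (T3 + 1) * qi (Q3 + 1 - T3) * rac K T1 T2 (T3 - 1) T4 Q1 (Q2 - 1) Q3
  = qi (Q2 - T4) * qi (T3 + T4 + 1 - Q3) * rac K T1 T2 T3 T4 Q1 Q2 Q3.
Proof.
move=> sumQ T1_ge0 KQ; apply/eqP; rewrite -subr_eq0; apply/eqP.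
rewrite /rac !mulr_sumr -big_split -sumrB /=.
apply: (@telescope_eq0 K _ (rterm (T1 + 1) (T2 + 1) T3 (T4 + 1) (Q1 + 1) Q2 Q3));
  try by rewrite rterm_out //; lia.
move=> k; move: (nat_of_ord k) => {}k; have D := bracket_identity_pm k%:Z sumQ.
rewrite /rterm !(fctS k.+1).
have -> : k.+2%:Z = k%:Z + 2 by lia.
have -> : k.+1%:Z = k%:Z + 1 by lia.
have -> : k%:Z + 1 - (T1 + 1) = k%:Z - T1 by ring.
have -> : k%:Z + 1 - (T2 + 1) = k%:Z - T2 by ring.
have -> : k%:Z + 1 - (T4 + 1) = k%:Z - T4 by ring.
have -> : k%:Z - (T1 + 1) = k%:Z - T1 - 1 by ring.
have -> : k%:Z - (T2 + 1) = k%:Z - T2 - 1 by ring.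
have -> : k%:Z - (T4 + 1) = k%:Z - T4 - 1 by ring.
have -> : k%:Z - (T3 - 1) = k%:Z + 1 - T3 by ring.
have -> : k%:Z - T3 = k%:Z + 1 - T3 - 1 by ring.
have -> : Q1 + 1 - (k%:Z + 1) = Q1 + 1 - k%:Z - 1 by ring.
have -> : Q1 - k%:Z = Q1 + 1 - k%:Z - 1 by ring.
have -> : Q2 - 1 - k%:Z = Q2 - k%:Z - 1 by ring.
have -> : Q2 - (k%:Z + 1) = Q2 - k%:Z - 1 by ring.
have -> : Q3 - (k%:Z + 1) = Q3 - k%:Z - 1 by ring.
rewrite !rfctB1 exprS.
set s := (-1) ^+ k; set f := fct _.
set H := s * f * (rfct (k%:Z - T1) * rfct (k%:Z - T2) * rfct (k%:Z + 1 - T3) *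
  rfct (k%:Z - T4) * (rfct (Q1 + 1 - k%:Z) * rfct (Q2 - k%:Z) * rfct (Q3 - k%:Z))).
transitivity (H * (qi (k%:Z + 2) * qi (Q1 + 1 - k%:Z) * qi (Q2 - k%:Z) * qi (Q3 - k%:Z)
  + qi (k%:Z - T1) * qi (k%:Z - T2) * qi (k%:Z + 1 - T3) * qi (k%:Z - T4))).
  by rewrite D /H; ring.
by rewrite /H; ring.
Qed.

Lemma rac_rel_mm K T1 T2 T3 T4 Q1 Q2 Q3 :
  Q1 + Q2 + Q3 = T1 + T2 + T3 + T4 -> 0 <= T3 -> Q1 + 1 < K%:Z ->
  qi (Q1 + 1 - T2) * qi (Q2 + 1 - T2) *
    rac K T1 T2 (T3 + 1) (T4 + 1) (Q1 + 1) (Q2 + 1) Q3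
  = qi (T3 + 2) * qi (T4 + 2) * rac K T1 T2 T3 T4 Q1 Q2 Q3
  + qi (Q3 + 1 - T1) * qi (T3 + T4 + 2 - Q3) *
    rac K T1 (T2 + 1) (T3 + 1) (T4 + 1) (Q1 + 1) (Q2 + 1) (Q3 + 1).
Proof.
move=> sumQ T3_ge0 KQ; apply/eqP; rewrite eq_sym -subr_eq0; apply/eqP.
have shift U2 V3 : rac K T1 U2 (T3 + 1) (T4 + 1) (Q1 + 1) (Q2 + 1) V3 =
    \sum_(k < K) rterm T1 U2 (T3 + 1) (T4 + 1) (Q1 + 1) (Q2 + 1) V3 k.+1.
  by rewrite /rac sum_shift // rterm_out //; lia.
rewrite !shift.
rewrite /rac !mulr_sumr -big_split -sumrB /=.
apply: (@telescope_eq0 K _ (rterm T1 T2 (T3 + 1) (T4 + 1) Q1 Q2 Q3));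
  try by rewrite rterm_out //; lia.
move=> k; move: (nat_of_ord k) => {}k; have D := bracket_identity_mm k%:Z sumQ.
rewrite /rterm !(fctS k.+1).
have -> : k.+2%:Z = k%:Z + 2 by lia.
have -> : k.+1%:Z = k%:Z + 1 by lia.
have -> : k%:Z - T1 = k%:Z + 1 - T1 - 1 by ring.
have -> : k%:Z + 1 - (T2 + 1) = k%:Z + 1 - T2 - 1 by ring.
have -> : k%:Z - T2 = k%:Z + 1 - T2 - 1 by ring.
have -> : k%:Z + 1 - (T3 + 1) = k%:Z - T3 by ring.
have -> : k%:Z + 1 - (T4 + 1) = k%:Z - T4 by ring.
have -> : k%:Z - (T3 + 1) = k%:Z - T3 - 1 by ring.
have -> : k%:Z - (T4 + 1) = k%:Z - T4 - 1 by ring.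
have -> : Q1 + 1 - (k%:Z + 1) = Q1 - k%:Z by ring.
have -> : Q2 + 1 - (k%:Z + 1) = Q2 - k%:Z by ring.
have -> : Q3 + 1 - (k%:Z + 1) = Q3 - k%:Z by ring.
have -> : Q1 - (k%:Z + 1) = Q1 - k%:Z - 1 by ring.
have -> : Q2 - (k%:Z + 1) = Q2 - k%:Z - 1 by ring.
have -> : Q3 - (k%:Z + 1) = Q3 - k%:Z - 1 by ring.
rewrite !rfctB1 exprS.
set s := (-1) ^+ k; set f := fct _.
set H := s * f * (rfct (k%:Z + 1 - T1) * rfct (k%:Z + 1 - T2) * rfct (k%:Z - T3) *
  rfct (k%:Z - T4) * (rfct (Q1 - k%:Z) * rfct (Q2 - k%:Z) * rfct (Q3 - k%:Z))).
transitivity (H * (qi (k%:Z + 2) * qi (Q1 - k%:Z) * qi (Q2 - k%:Z) * qi (Q3 - k%:Z)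
  + qi (k%:Z + 1 - T1) * qi (k%:Z + 1 - T2) * qi (k%:Z - T3) * qi (k%:Z - T4))).
  by rewrite D /H; ring.
by rewrite /H; ring.
Qed.

End QuantumIntegers.

(** * Admissible triples *)

Lemma adm_half a b c : adm a b c ->
  exists T, [/\ a + b + c = T + T, a <= T, b <= T & c <= T]%N.
Proof. by rewrite /adm => h; exists (a + b + c)./2; split; lia. Qed.

Lemma half_adm a b c T : (a + b + c = T + T)%N -> (a <= T)%N -> (b <= T)%N ->
  (c <= T)%N -> adm a b c.
Proof. by move=> e; rewrite /adm e addnn odd_double; lia. Qed.

Lemma admC a b c : adm a b c = adm b a c.
Proof. by rewrite /adm; lia. Qed.

Lemma admS a b c : adm a b c = adm a c b.
Proof. by rewrite /adm; lia. Qed.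

Lemma adm1S n : adm 1 n n.+1. Proof. by rewrite /adm; lia. Qed.

Lemma admS1 n : adm 1 n.+1 n. Proof. by rewrite /adm; lia. Qed.

Lemma adm1P m n : adm 1 m n -> n = m.+1 \/ m = n.+1.
Proof. by rewrite /adm; lia. Qed.

Lemma adm1_leq m n : adm 1 m n -> (n <= m.+1)%N.
Proof. by case/adm1P => ->; rewrite ?leqnn // -addn2 leq_addr. Qed.

(** The numbers of strands that join the three pairs of edges at a vertex of
    the trivalent graph. *)
Lemma adm_splitP x s s' : adm x s s' ->
  exists u v w, [/\ x = u + v, s = u + w & s' = v + w]%N.
Proof.
by rewrite /adm => h; exists (x + s - s')./2, (x + s' - s)./2, (s + s' - x)./2; split; lia.
Qed.

(** * Numberings of a graph without cut vertex *)

Section StNumbering.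
Local Open Scope nat_scope.
Variables (V : finType) (adj : rel V) (v1 v2 : V).
Hypothesis adj_sym : symmetric adj.

Definition away (S : {set V}) : rel V :=
  [rel u v | [&& u \notin S, v \notin S & adj u v]].

Definition co_connected (S : {set V}) : Prop :=
  forall u v, u \notin S -> v \notin S -> connect (away S) u v.

Hypothesis connected0 : co_connected finset.set0.
Hypothesis connected1 : forall w, co_connected [set w].

Lemma connect_stable (e : rel V) (K : pred V) x y :
  (forall a b, K a -> e a b -> K b) -> K x -> connect e x y -> K y.
Proof.
move=> stK Kx /connectP[p + ->] {y}.
by elim: p x Kx => //= a p IHp x Kx /andP[/(stK _ _ Kx) Ka /(IHp _ Ka)].
Qed.

Lemma away_sym S : symmetric (away S).
Proof. by move=> u v; rewrite /away /= adj_sym andbCA. Qed.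

Lemma connect_away_sym S : connect_sym (away S).
Proof. exact/sym_connect_sym/away_sym. Qed.

Definition frontier (S : {set V}) (v : V) : bool :=
  [&& v \notin S, v != v2 & [exists u in S, adj v u]].

Lemma frontier_ex (S : {set V}) x : v1 \in S -> v2 \notin S -> x \notin S -> x != v2 ->
  exists v, frontier S v.
Proof.
move=> S1 S2 Sx x2; apply/existsP; apply: contraNT Sx => /existsPn none.
have n1 : v1 \notin [set v2] by rewrite inE; apply: contraTneq S1 => ->.
have nx : x \notin [set v2] by rewrite inE.
apply: (@connect_stable (away [set v2]) (fun y => y \in S) v1) (connected1 n1 nx) => // a b Sa.
rewrite /away /= !inE => /and3P[_ b2 ab]; apply: contraNT (none b) => Sb.
by rewrite /frontier Sb b2; apply/existsP; exists a; rewrite Sa adj_sym.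
Qed.

(** Take v on the frontier so that the component of v2 in the complement of S
    and v is as large as possible. If this complement had another component,
    that component would contain a frontier vertex y, because v alone
    separates nothing. Removing y instead of v would keep the whole component
    of v2 and join v to it, against maximality. *)
Lemma shelling_step (S : {set V}) x : v1 \in S -> v2 \notin S -> x \notin S -> x != v2 ->
  co_connected S -> exists2 v, frontier S v & co_connected (v |: S).
Proof.
move=> S1 S2 Sx x2 coS; have [v0 Fv0] := frontier_ex S1 S2 Sx x2.
pose m v := #|connect (away (v |: S)) v2|.
case: (@arg_maxnP _ v0 (frontier S) m Fv0) => v Fv maxv; exists v => //.
have /and3P[Sv vv2 _] := Fv.
have S2' : v2 \notin v |: S by rewrite !inE negb_or eq_sym vv2.
suff toC w : w \notin v |: S -> connect (away (v |: S)) v2 w.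
  move=> u w /toC v2u /toC v2w; apply: connect_trans v2w.
  by rewrite connect_away_sym.
move=> Sw; apply: contraT => nw.
pose C := connect (away (v |: S)) w.
have C2 : ~~ C v2 by rewrite /C connect_away_sym.
have CS y : C y -> y \notin v |: S.
  apply: (@connect_stable (away (v |: S)) (fun y => y \notin v |: S)) => //.
  by move=> a b _ /and3P[].
have [y /andP[Cy Fy]] : exists y, C y && frontier S y.
  apply/existsP; apply: contraNT (C2) => /existsPn none.
  have nw' : w \notin [set v] by move: Sw; rewrite !inE negb_or => /andP[].
  have n2 : v2 \notin [set v] by rewrite inE eq_sym.
  apply: connect_stable (connected1 nw' n2) => [a b Ca|]; last exact: connect0.
  rewrite /away /= !inE => /and3P[av bv ab].
  have Sb : b \notin S.
    apply: contraNN (none a) => Sb; rewrite Ca /=; move: (CS a Ca).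
    rewrite !inE negb_or => /andP[_ Sa]; rewrite /frontier Sa /=.
    apply/andP; split; last by apply/existsP; exists b; rewrite Sb.
    by apply: contraNneq C2 => <-.
  apply: connect_trans (Ca) (connect1 _); rewrite /away /= !inE !negb_or av bv Sb ab.
  by move: (CS a Ca); rewrite !inE negb_or => /andP[_ ->].
have /and3P[Sy y2 _] := Fy.
have : m y <= m v by exact: maxv.
rewrite leqNgt => /negP; case; rewrite /m.
have yv : y != v by move: (CS y Cy); rewrite !inE negb_or => /andP[].
pose K := connect (away (v |: S)) v2.
have Ky : ~~ K y.
  apply: contraNN C2 => Ky; apply: connect_trans (Cy) _.
  by rewrite connect_away_sym.
have KS a : K a -> a \notin v |: S.
  apply: (@connect_stable (away (v |: S)) (fun y => y \notin v |: S)) => //.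
  by move=> ? ? _ /and3P[].
have KK a : K a -> connect (away (y |: S)) v2 a.
  move=> Ka; suff /andP[] : K a && connect (away (y |: S)) v2 a by [].
  apply: (@connect_stable (away (v |: S))
    (fun a => K a && connect (away (y |: S)) v2 a) v2) Ka => [b d /andP[Kb cb] bd|];
    last by rewrite /K !connect0.
  have Kd : K d by apply: connect_trans (Kb) (connect1 bd).
  rewrite Kd /=; apply: connect_trans cb (connect1 _).
  have := KS b Kb; have := KS d Kd; rewrite /away /= !inE !negb_or => /andP[_ ->] /andP[_ ->].
  have -> : b != y by apply: contraNneq Ky => <-.
  have -> : d != y by apply: contraNneq Ky => <-.
  by case/and3P: bd.
have Kv : ~~ K v by apply/negP => /KS; rewrite !inE eqxx.
have [b Kb bv] : exists2 b, K b & adj b v.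
  apply/exists_inP; apply: contraNT Kv => /exists_inPn none.
  apply: connect_stable (coS v2 v S2 Sv) => [b d Kb /and3P[Sb Sd bd]|]; last exact: connect0.
  apply: connect_trans (Kb) (connect1 _); rewrite /away /= (KS b Kb) bd !inE negb_or Sd !andbT.
  by apply: contraNneq (none b Kb) => <-.
apply: (@leq_trans #|predU1 v K|).
  by rewrite cardU1 [v \in K](negbTE Kv) add1n.
apply: subset_leq_card; apply/fintype.subsetP => a; rewrite !inE => /predU1P[->|/KK //].
apply: connect_trans (KK b Kb) (connect1 _).
have := KS b Kb; rewrite /away /= !inE !negb_or bv Sv (eq_sym v) yv => /andP[_ ->].
by rewrite !andbT; apply: contraNneq Ky => <-.
Qed.

(** The vertices outside S are numbered in the order in which the shelling
    steps add them to S. The last one is v2; the complement stays connected on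
    the way, which gives each of them a neighbor with a greater number. *)
Lemma shelling (S : {set V}) : v1 \in S -> v2 \notin S -> co_connected S ->
  exists h : V -> nat, [/\ {in ~: S &, injective h},
    forall v, v \notin S -> #|S| <= h v < #|V|,
    h v2 = #|V|.-1,
    forall v, v \notin S -> exists2 u, adj v u & (u \in S) || (h u < h v)
  & forall v, v \notin S -> v != v2 -> exists2 u, adj v u & (u \notin S) && (h v < h u)].
Proof.
have [n] := ubnP #|~: S|; elim: n S => // n IHn S; rewrite ltnS => leSn S1 S2 coS.
have cS := cardsC S.
have [/existsP[x /andP[Sx x2]]|none] := boolP [exists x, (x \notin S) && (x != v2)].
  have [v Fv coS'] := shelling_step S1 S2 Sx x2 coS.
  have /and3P[Sv v2' /exists_inP[u0 Su0 vu0]] := Fv.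
  have cvS : #|v |: S| = #|S|.+1 by rewrite cardsU1 Sv.
  have cvSC : #|~: (v |: S)| < n.
    by apply: leq_trans leSn; have := cardsC (v |: S); clear -cS cvS; lia.
  have S2' : v2 \notin v |: S by rewrite !inE negb_or eq_sym v2'.
  have [h [injh rh h2 lo hi]] := IHn (v |: S) cvSC (finset.setU1r _ S1) S2' coS'.
  pose h' w := if w == v then #|S| else h w.
  have out w : w \notin S -> w != v -> w \notin v |: S by rewrite !inE negb_or => -> ->.
  have ltS : #|S| < #|V| by rewrite -cS -[X in X < _]addn0 ltn_add2l card_gt0;
    apply/finset.set0Pn; exists v; rewrite inE.
  have ltw w : w \notin S -> w != v -> #|S| < h w.
    by move=> Sw wv; have := rh w (out w Sw wv); rewrite cvS => /andP[].
  exists h'; split.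
  - move=> a b; rewrite !inE /h' => Sa Sb.
    case: eqVneq => [->|av]; case: eqVneq => [->|bv] //.
    + by move=> e; have := ltw b Sb bv; rewrite e ltnn.
    + by move=> e; have := ltw a Sa av; rewrite e ltnn.
    by apply: injh; rewrite inE out.
  - move=> w Sw; rewrite /h'; case: eqVneq => [_|wv]; first by rewrite leqnn.
    by have := rh w (out w Sw wv); rewrite cvS => /andP[/ltnW -> ->].
  - by rewrite /h' eq_sym (negbTE v2').
  - move=> w Sw; case: (eqVneq w v) => [->|wv].
      by exists u0; rewrite ?Su0.
    have [u wu] := lo w (out w Sw wv); rewrite !inE -orbA => h3; exists u => //.
    rewrite /h' (negbTE wv); case: eqVneq h3 => [_|_] /= h3; last exact: h3.
    by rewrite ltw ?orbT.
  move=> w Sw w2; case: (eqVneq w v) => [->|wv].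
    have /exists_inP[u uS vu] : [exists u in ~: (v |: S), adj v u].
      apply: contraNT (S2') => /exists_inPn no.
      suff : v2 == v by rewrite eq_sym (negbTE v2').
      apply: (@connect_stable (away S) (fun a => a == v) v) (coS v v2 Sv S2)
        => [a b /eqP -> /and3P[_ Sb vb]|]; last exact: eqxx.
      apply: contraTT vb => bv; apply: no; rewrite !inE negb_or bv; exact: Sb.
    move: uS; rewrite !inE negb_or => /andP[uv uS].
    by exists u; rewrite // uS /h' eqxx (negbTE uv) ltw.
  have [u wu /andP[uS lt]] := hi w (out w Sw wv) w2; exists u => //.
  move: uS; rewrite !inE negb_or => /andP[uv ->].
  by rewrite /h' (negbTE wv) (negbTE uv).
have only w : w \notin S -> w = v2.
  move=> Sw; move: none; rewrite negb_exists => /forallP/(_ w).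
  by rewrite Sw /= negbK => /eqP.
have card1 : #|S|.+1 = #|V|.
  have e : ~: S = [set v2].
    by apply/finset.setP => w; rewrite !inE; apply/idP/eqP => [/only|->].
  by rewrite -cS e cards1 addn1.
exists (fun _ => #|V|.-1); split => //.
- by move=> a b; rewrite !inE => /only -> /only ->.
- by move=> w _; rewrite -card1 /= leqnn ltnSn.
- move=> w /only ->; suff /exists_inP[u Su vu] : [exists u in S, adj v2 u] by exists u; rewrite ?Su.
  apply: contraNT S2 => /exists_inPn no.
  apply: (@connect_stable (away finset.set0) (fun a => a \in S) v1)
    (connected0 (u := v1) (v := v2) _ _) => [a b Sa /and3P[_ _ ab]|||]; rewrite ?inE //.
  apply: contraTT ab => Sb; rewrite adj_sym (only _ Sb); exact: no.
by move=> w /only ->; rewrite eqxx.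
Qed.

Lemma st_numbering : v1 != v2 -> exists h : V -> nat,
  [/\ injective h, forall v, h v < #|V|, h v1 = 0 /\ h v2 = #|V|.-1,
      forall v, v != v1 -> exists2 u, adj v u & h u < h v
    & forall v, v != v2 -> exists2 u, adj v u & h v < h u].
Proof.
move=> n12; have n2 : v2 \notin [set v1] by rewrite inE eq_sym.
have [h [injh rh h2 lo hi]] := shelling (set11 v1) n2 (@connected1 v1).
pose h' w := if w == v1 then 0 else h w.
have h_gt0 w : w != v1 -> 0 < h w.
  by move=> w1; have := rh w; rewrite inE cards1 => /(_ w1) /andP[].
have h'_gt0 w : w != v1 -> 0 < h' w by move=> w1; rewrite /h' (negbTE w1) h_gt0.
have V_gt0 : 0 < #|V| by apply/card_gt0P; exists v1.
exists h'; split.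
- move=> a b; rewrite /h'; case: eqVneq => [->|a1]; case: eqVneq => [->|b1] //.
  + by move=> e; have := h_gt0 b b1; rewrite -e.
  + by move=> e; have := h_gt0 a a1; rewrite e.
  by apply: injh; rewrite !inE.
- move=> w; rewrite /h'; case: eqVneq => // w1.
  by have := rh w; rewrite inE => /(_ w1) /andP[].
- by rewrite /h' eqxx eq_sym (negbTE n12).
- move=> w w1; have := lo w; rewrite inE => /(_ w1)[u wu]; rewrite inE => hu.
  exists u => //; rewrite /h' (negbTE w1); case: eqVneq hu => //= _ _; exact: h_gt0.
move=> w w2; case: (eqVneq w v1) => [->|w1].
  have /existsP[u vu] : [exists u, adj v1 u && (u != v1)].
    apply: contraNT n12 => /existsPn no; rewrite eq_sym.
    apply: (@connect_stable (away finset.set0) (fun a => a == v1) v1)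
      (connected0 (u := v1) (v := v2) _ _) => [a b /eqP -> /and3P[_ _ ab]|||];
      rewrite ?inE //.
    by have := no b; rewrite ab /= negbK.
  by case/andP: vu => vu u1; exists u => //; rewrite {1}/h' eqxx h'_gt0.
have := hi w; rewrite inE => /(_ w1 w2)[u wu]; rewrite inE => /andP[u1 hu].
by exists u => //; rewrite /h' (negbTE w1) (negbTE u1).
Qed.

End StNumbering.

(** * Sweeping a polyhedron *)

Section Maps.
Local Open Scope nat_scope.
Variable G : cmap.
Implicit Types x y z : dart G.

Lemma edge_neq x : edge G x != x.
Proof. by case: G x => D e n h1 h2 x; exact: h1. Qed.

Lemma edgeK x : edge G (edge G x) = x.
Proof. by case: G x => D e n h1 h2 x; exact: h2. Qed.

Lemma node_face x : node G (face G x) = edge G x.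
Proof. by rewrite /face permM permKV. Qed.

Lemma face_edge_node x : face G (edge G (node G x)) = x.
Proof. by rewrite /face permM edgeK permK. Qed.

Lemma orbit_ofP (s : {perm dart G}) x y :
  reflect (orbit_of s x = orbit_of s y) (y \in porbit s x).
Proof.
rewrite -eq_porbit_mem; apply: (iffP eqP) => [e|/(congr1 val)//].
exact: val_inj.
Qed.

Lemma orbit_of_perm (s : {perm dart G}) x : orbit_of s (s x) = orbit_of s x.
Proof. by apply/esym/orbit_ofP; exact: (mem_porbit s 1). Qed.

Lemma orbit_of_mem (s : {perm dart G}) x y :
  (y \in val (orbit_of s x)) = (orbit_of s y == orbit_of s x).
Proof. by apply/orbit_ofP/eqP => [->|/esym ->]. Qed.

Lemma vertex_of_node x : vertex_of (node G x) = vertex_of x.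
Proof. exact: orbit_of_perm. Qed.

Lemma region_of_face x : region_of (face G x) = region_of x.
Proof. exact: orbit_of_perm. Qed.

Lemma edge_of_edge x : edge_of (edge G x) = edge_of x.
Proof. exact: orbit_of_perm. Qed.

Lemma vertex_of_face x : vertex_of (face G x) = vertex_of (edge G x).
Proof. by rewrite -vertex_of_node node_face. Qed.

Lemma region_of_edge_node x : region_of (edge G (node G x)) = region_of x.
Proof. by rewrite -region_of_face face_edge_node. Qed.

Lemma edge_of_eq x y : edge_of y = edge_of x -> y = x \/ y = edge G x.
Proof.
move/esym/orbit_ofP/porbitP => [i ->]; rewrite permX.
by elim: i => [|i [] /= ->]; [left|right|left; rewrite edgeK].
Qed.

Lemma orbit_of_ex (s : {perm dart G}) (r : orbit_t s) : exists x, orbit_of s x = r.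
Proof. by case: r => r rP; have /imsetP[x _ def_r] := rP; exists x; apply: val_inj. Qed.

Lemma mem_region d (r : region_t G) : (d \in val r) = (region_of d == r).
Proof. by have [d' <-] := orbit_of_ex r; rewrite orbit_of_mem. Qed.

Section Trivalent.
Hypothesis triv : trivalent G.

Lemma porbit_node x : porbit (node G) x =i [:: x; node G x; node G (node G x)].
Proof. by move=> y; rewrite porbit_traject [#|_|](triv (vertex_of x)). Qed.

Lemma node_uniq x : uniq [:: x; node G x; node G (node G x)].
Proof. by have := uniq_traject_porbit (node G) x; rewrite [#|_|](triv (vertex_of x)). Qed.

Lemma node3 x : node G (node G (node G x)) = x.
Proof. by have := iter_porbit (node G) x; rewrite [#|_|](triv (vertex_of x)). Qed.

Lemma vertex_of_eq x y : vertex_of y = vertex_of x ->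
  [\/ y = x, y = node G x | y = node G (node G x)].
Proof.
move/esym/orbit_ofP; rewrite porbit_node !inE => /or3P[] /eqP ->.
- exact: Or31.
- exact: Or32.
exact: Or33.
Qed.

Lemma face_edge x : face G (edge G x) = node G (node G x).
Proof. by rewrite -[in RHS](face_edge_node (node G (node G x))) node3. Qed.

Lemma region_of_edge x : region_of (edge G x) = region_of (node G (node G x)).
Proof. by rewrite -region_of_face face_edge. Qed.

Lemma sum_vertex (F : dart G -> nat) x :
  \sum_(y | vertex_of y == vertex_of x) F y = F x + F (node G x) + F (node G (node G x)).
Proof.
rewrite -addnA; have /andP[] := node_uniq x; rewrite !inE negb_or => /andP[h1 h2] /andP[h3 _].
rewrite (bigD1 x) //=; congr (_ + _).
rewrite (bigD1 (node G x)) /=; last by rewrite vertex_of_node eqxx eq_sym.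
congr (_ + _); rewrite (big_pred1 (node G (node G x))) // => y /=.
apply/idP/eqP => [/andP[/andP[/eqP/vertex_of_eq[]-> ]]|->]; rewrite ?eqxx //.
by rewrite !vertex_of_node eqxx eq_sym h2 eq_sym h3.
Qed.

Lemma sum_edge (F : dart G -> nat) x :
  \sum_(y | edge_of y == edge_of x) F y = F x + F (edge G x).
Proof.
rewrite (bigD1 x) //=; congr (_ + _); rewrite (big_pred1 (edge G x)) // => y /=.
apply/idP/eqP => [/andP[/eqP/edge_of_eq[]-> ]|->]; rewrite ?eqxx //.
by rewrite edge_of_edge eqxx edge_neq.
Qed.

Lemma card_dart_vertex : #|dart G| = 3 * #|{: vertex_t G}|.
Proof.
rewrite -sum1_card (partition_big (@vertex_of G) predT) //=.
rewrite -sum1_card big_distrr /=; apply: eq_bigr => v _.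
by have [x <-] := orbit_of_ex v; rewrite sum_vertex muln1.
Qed.

Lemma card_dart_edge : #|dart G| = 2 * #|{: edge_t G}|.
Proof.
rewrite -sum1_card (partition_big (@edge_of G) predT) //=.
rewrite -sum1_card big_distrr /=; apply: eq_bigr => v _.
by have [x <-] := orbit_of_ex v; rewrite sum_edge muln1.
Qed.

End Trivalent.

(** The heights of the vertices for a line that sweeps the sphere from the
    origin of z0 to its end. The two last fields make the parts before and
    behind the line connected. *)
Record sweep_order (z0 : dart G) (h : dart G -> nat) : Prop := SweepOrder {
  sweep_node : forall x, h (node G x) = h x;
  sweep_inj : forall x y, h x = h y -> vertex_of x = vertex_of y;
  sweep_ltn : forall x, h x < #|{: vertex_t G}|;
  sweep_min : forall x, h z0 <= h x;
  sweep_max : forall x, h x <= h (edge G z0);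
  sweep_down : forall x, vertex_of x != vertex_of z0 ->
    exists2 y, vertex_of y = vertex_of x & h (edge G y) < h y;
  sweep_up : forall x, vertex_of x != vertex_of (edge G z0) ->
    exists2 y, vertex_of y = vertex_of x & h y < h (edge G y)
}.

Hypothesis poly : trivalent_polyhedron G.

Lemma polyhedron_trivalent : trivalent G. Proof. by case: poly. Qed.

Lemma no_loop x : vertex_of (edge G x) != vertex_of x.
Proof. by case: poly => _ [h _] _ _; exact: h. Qed.

Lemma adjacentP (u v : vertex_t G) :
  reflect (exists2 x, vertex_of x = u & vertex_of (edge G x) = v) (adjacent u v).
Proof.
by apply: (iffP existsP) => [[x /andP[/eqP hu /eqP hv]]|[x <- <-]]; exists x; rewrite ?eqxx.
Qed.

Lemma adjacent_sym : symmetric (@adjacent G).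
Proof.
move=> u v; apply/adjacentP/adjacentP => -[x hu hv];
  by exists (edge G x); rewrite ?edgeK.
Qed.

Lemma sweep_order_ex z0 : exists h, sweep_order z0 h.
Proof.
have [_ _ [cV conn] _] := poly.
have co (S : {set vertex_t G}) : #|S| < 3 -> co_connected (@adjacent G) S.
  by move=> S3 u v Su Sv; exact: conn.
have co0 : co_connected (@adjacent G) finset.set0 by apply: co; rewrite cards0.
have co1 w : co_connected (@adjacent G) [set w] by apply: co; rewrite cards1.
have n12 : vertex_of z0 != vertex_of (edge G z0) by rewrite eq_sym no_loop.
have [h [injh ltnh [h1 h2] lo hi]] := st_numbering adjacent_sym co0 co1 n12.
exists (h \o @vertex_of G); split => /= x.
- by rewrite vertex_of_node.
- by move=> y /injh.
- exact: ltnh.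
- by rewrite h1.
- by rewrite h2 -ltnS (ltn_predK cV).
- by move=> /lo[u /adjacentP[y <- <-] lt]; exists y.
by move=> /hi[u /adjacentP[y <- <-] lt]; exists y.
Qed.

Section Extremal.
Variables (z0 : dart G) (h : dart G -> nat).
Hypothesis ord : sweep_order z0 h.

Let triv := polyhedron_trivalent.

(** The base edge is drawn through infinity: it goes down from the origin of
    z0 and enters the end of z0 from above. Hence its direction is opposite to
    the one given by the heights. *)
Definition on_base x : bool := (x == z0) || (x == edge G z0).

Definition up x : bool := (h x < h (edge G x)) (+) on_base x.

(** The sector between x and node x lies above its vertex (source) or below it
    (sink): there the sweeping line enters or leaves the region of x. *)
Definition source x : bool := up x && up (node G x).
Definition sink x : bool := ~~ up x && ~~ up (node G x).

Lemma on_base_edge x : on_base (edge G x) = on_base x.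
Proof.
rewrite /on_base (inj_eq (@perm_inj _ _)) orbC; congr (_ || _).
by apply/eqP/eqP => [<-|->]; rewrite edgeK.
Qed.

Lemma sweep_edge_neq x : h (edge G x) != h x.
Proof. by apply: contraNneq (no_loop x) => /(sweep_inj ord) ->. Qed.

Lemma up_edge x : up (edge G x) = ~~ up x.
Proof.
rewrite /up on_base_edge edgeK -addNb; congr (_ (+) _).
by rewrite -leqNgt [RHS]leq_eqVlt (negbTE (sweep_edge_neq _)).
Qed.

Lemma on_base_vertex x : on_base x ->
  vertex_of x = vertex_of z0 \/ vertex_of x = vertex_of (edge G z0).
Proof. by case/orP => /eqP ->; [left|right]. Qed.

Lemma base_lt : h z0 < h (edge G z0).
Proof. by rewrite ltn_neqAle eq_sym sweep_edge_neq (sweep_min ord). Qed.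

Lemma sweep_vertex x y : vertex_of x = vertex_of y -> h x = h y.
Proof.
by case/(vertex_of_eq triv) => ->; rewrite ?(sweep_node ord).
Qed.

Lemma up_at x : exists2 y, vertex_of y = vertex_of x & up y.
Proof.
case: (eqVneq (vertex_of x) (vertex_of (edge G z0))) => [e|n2].
  exists (edge G z0); rewrite // up_edge /up /on_base eqxx base_lt //.
case: (eqVneq (vertex_of x) (vertex_of z0)) => [e|n1].
  exists (node G z0); first by rewrite vertex_of_node.
  have nb : ~~ on_base (node G z0).
    have := node_uniq triv z0; rewrite /= !inE negb_or eq_sym => /andP[/andP[n _] _].
    rewrite /on_base (negbTE n) /=; apply/eqP => /(congr1 (@vertex_of G)) /eqP.
    by rewrite vertex_of_node eq_sym (negbTE (no_loop _)).
  rewrite /up (negbTE nb) addbF ltn_neqAle eq_sym sweep_edge_neq (sweep_node ord).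
  exact: sweep_min ord _.
have [y ey lt] := sweep_up ord n2; exists y => //.
have nb : ~~ on_base y by apply/negP => /on_base_vertex[]; rewrite ey => /eqP; apply/negP.
by rewrite /up (negbTE nb) lt.
Qed.

Lemma down_at x : exists2 y, vertex_of y = vertex_of x & ~~ up y.
Proof.
case: (eqVneq (vertex_of x) (vertex_of z0)) => [e|n1].
  by exists z0; rewrite // /up /on_base eqxx base_lt.
case: (eqVneq (vertex_of x) (vertex_of (edge G z0))) => [e|n2].
  exists (node G (edge G z0)); first by rewrite vertex_of_node.
  have nb : ~~ on_base (node G (edge G z0)).
    have := node_uniq triv (edge G z0); rewrite /= !inE negb_or eq_sym => /andP[/andP[n _] _].
    rewrite /on_base (negbTE n) orbF; apply/eqP => /(congr1 (@vertex_of G)) /eqP.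
    by rewrite vertex_of_node (negbTE (no_loop _)).
  by rewrite /up (negbTE nb) addbF -leqNgt (sweep_node ord); exact: sweep_max ord _.
have [y ey lt] := sweep_down ord n1; exists y => //.
have nb : ~~ on_base y by apply/negP => /on_base_vertex[]; rewrite ey => /eqP; apply/negP.
by rewrite /up (negbTE nb) addbF -leqNgt ltnW.
Qed.

(** Of the three edges at a vertex at least one goes up and at least one goes
    down, so exactly one pair of neighboring edges goes the same way. *)
Lemma vertex_extremal x :
  \sum_(y | vertex_of y == vertex_of x) (source y + sink y) = 1.
Proof.
rewrite (sum_vertex triv) /source /sink (node3 triv).
have [y /(vertex_of_eq triv) ey uy] := up_at x.
have [z /(vertex_of_eq triv) ez dz] := down_at x.
have : [|| up x, up (node G x) | up (node G (node G x))].
  by case: ey uy => -> ->; rewrite ?orbT.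
have : ~~ [&& up x, up (node G x) & up (node G (node G x))].
  by case: ez dz => -> /negbTE ->; rewrite ?andbF.
by case: (up x); case: (up (node G x)); case: (up _).
Qed.

Lemma sum_extremal : \sum_x (source x + sink x) = #|{: vertex_t G}|.
Proof.
rewrite (partition_big (@vertex_of G) predT) //= -sum1_card; apply: eq_bigr => v _.
by have [x <-] := orbit_of_ex v; rewrite vertex_extremal.
Qed.

Definition base_region (r : region_t G) : bool :=
  (r == region_of z0) || (r == region_of (edge G z0)).

Lemma on_base_region x : on_base x -> base_region (region_of x).
Proof. by case/orP => /eqP ->; rewrite /base_region eqxx ?orbT. Qed.

Lemma region_prev x : region_of (edge G (node G x)) = region_of x /\
  vertex_of (edge G (edge G (node G x))) = vertex_of x.
Proof. by rewrite region_of_edge_node edgeK vertex_of_node. Qed.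

(** Both edges of a region at its lowest vertex go up. The base edge, whose
    direction is reversed, only bounds base regions. *)
Lemma lowest_source x : ~~ base_region (region_of x) ->
  (forall y, region_of y = region_of x -> h x <= h y) -> source x.
Proof.
move=> nb low; have nbx : ~~ on_base x by apply: contraNN nb => /on_base_region.
have [r1 v1] := region_prev x.
have nbn : ~~ on_base (node G x).
  by rewrite -on_base_edge; apply: contraNN nb => /on_base_region; rewrite r1.
rewrite /source /up (negbTE nbx) (negbTE nbn) !addbF !(ltn_neqAle _ (h (edge G _))).
rewrite !(eq_sym _ (h (edge G _))) !sweep_edge_neq (sweep_node ord) /=.
rewrite (low _ r1) andbT -(sweep_vertex (vertex_of_face x)).
by apply: low; rewrite region_of_face.
Qed.

Lemma highest_sink x : ~~ base_region (region_of x) ->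
  (forall y, region_of y = region_of x -> h y <= h x) -> sink x.
Proof.
move=> nb high; have nbx : ~~ on_base x by apply: contraNN nb => /on_base_region.
have [r1 v1] := region_prev x.
have nbn : ~~ on_base (node G x).
  by rewrite -on_base_edge; apply: contraNN nb => /on_base_region; rewrite r1.
rewrite /sink /up (negbTE nbx) (negbTE nbn) !addbF -!leqNgt (sweep_node ord).
rewrite (high _ r1) andbT -(sweep_vertex (vertex_of_face x)).
by apply: high; rewrite region_of_face.
Qed.

Lemma region_lowest (r : region_t G) : exists2 x, region_of x = r &
  forall y, region_of y = r -> h x <= h y.
Proof.
have [x0 e0] := orbit_of_ex r.
have P0 : region_of x0 == r by apply/eqP.
have [x /eqP ex low] := @arg_minnP _ x0 (fun y => region_of y == r) h P0.
by exists x => // y /eqP; exact: low.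
Qed.

Lemma region_highest (r : region_t G) : exists2 x, region_of x = r &
  forall y, region_of y = r -> h y <= h x.
Proof.
have [x0 e0] := orbit_of_ex r.
have P0 : region_of x0 == r by apply/eqP.
have [x /eqP ex high] := @arg_maxnP _ x0 (fun y => region_of y == r) h P0.
by exists x => // y /eqP; exact: high.
Qed.

Definition nb_source (r : region_t G) : nat := \sum_(x | region_of x == r) source x.
Definition nb_sink (r : region_t G) : nat := \sum_(x | region_of x == r) sink x.

Lemma nb_source_gt0 r : ~~ base_region r -> 0 < nb_source r.
Proof.
have [x ex low] := region_lowest r; rewrite -ex => nb.
rewrite /nb_source (bigD1 x) //= lowest_source // => y; rewrite ex; exact: low.
Qed.

Lemma nb_sink_gt0 r : ~~ base_region r -> 0 < nb_sink r.
Proof.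
have [x ex high] := region_highest r; rewrite -ex => nb.
rewrite /nb_sink (bigD1 x) //= highest_sink // => y; rewrite ex; exact: high.
Qed.

Lemma sum_nb_extremal : \sum_r (nb_source r + nb_sink r) = #|{: vertex_t G}|.
Proof.
rewrite -sum_extremal (partition_big (@region_of G) predT) //=.
by apply: eq_bigr => r _; rewrite big_split.
Qed.

Lemma card_region : 2 * #|{: region_t G}| = #|{: vertex_t G}| + 4.
Proof.
have [_ _ _ euler] := poly; have := card_dart_vertex triv; have := card_dart_edge.
by move: euler; rewrite /euler_planar; lia.
Qed.

Lemma card_base_region :
  #|[pred r | base_region r]| = (region_of z0 != region_of (edge G z0)).+1.
Proof. by rewrite -cards2; apply: eq_card => r; rewrite !inE. Qed.

(** Each vertex has one extremal sector, and each region other than the base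
    ones has at least two, at its lowest and its highest vertex. By Euler's
    formula V = 2 F - 4, so there is no room for more, nor for the two base
    regions to coincide. *)
Lemma extremal_count : region_of z0 != region_of (edge G z0) /\
  forall r, nb_source r = ~~ base_region r /\ nb_sink r = ~~ base_region r.
Proof.
pose b (r : region_t G) : nat := 2 * ~~ base_region r.
have leb r : b r <= nb_source r + nb_sink r.
  rewrite /b; case: (boolP (base_region r)) => //= nb.
  by have h1 := nb_source_gt0 nb; have h2 := nb_sink_gt0 nb; clear -h1 h2; lia.
have sumb : \sum_r b r + 2 * #|[pred r | base_region r]| = 2 * #|{: region_t G}|.
  rewrite -(cardC [pred r | base_region r]) mulnDr addnC; congr (_ + _).
  rewrite /b -big_distrr /= -sum1_card [in RHS]big_mkcond; congr (2 * _).
have le1 : \sum_r b r <= #|{: vertex_t G}|.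
  by rewrite -sum_nb_extremal; apply: leq_sum => r _; exact: leb.
have cb := card_base_region; have cR := card_region.
have neq : region_of z0 != region_of (edge G z0).
  apply: contraT => /negbTE eq; rewrite eq in cb; clear -sumb le1 cb cR; lia.
split=> // r.
have tot : \sum_r (nb_source r + nb_sink r) <= \sum_r b r.
  rewrite sum_nb_extremal; rewrite neq in cb; clear -sumb cb cR; lia.
have eqr : nb_source r + nb_sink r = b r.
  have le' : \sum_(i | i != r) b i <= \sum_(i | i != r) (nb_source i + nb_sink i).
    by apply: leq_sum.
  have e1 : \sum_r b r = b r + \sum_(i | i != r) b i by rewrite (bigD1 r).
  have e2 : \sum_r (nb_source r + nb_sink r) =
      nb_source r + nb_sink r + \sum_(i | i != r) (nb_source i + nb_sink i).
    by rewrite (bigD1 r).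
  apply/eqP; rewrite eqn_leq leb andbT; rewrite e1 e2 in tot.
  by rewrite -(leq_add2r (\sum_(i | i != r) b i)); apply: leq_trans tot; rewrite leq_add2l.
move: eqr; rewrite /b; case: (boolP (base_region r)) => /= [_|nb].
  by move/eqP; rewrite muln0 addn_eq0 => /andP[/eqP-> /eqP->].
have h1 := nb_source_gt0 nb; have h2 := nb_sink_gt0 nb.
by rewrite muln1 => e; split; clear -h1 h2 e; lia.
Qed.

Lemma sum_bool_uniq (T : finType) (P F : pred T) (x y : T) :
  \sum_(z | P z) F z <= 1 -> P x -> P y -> F x -> F y -> x = y.
Proof.
move=> le1 Px Py Fx Fy; apply/eqP; apply: contraTT le1 => nxy.
by rewrite (bigD1 x) //= (bigD1 y) /= ?Py 1?eq_sym ?nxy // Fx Fy.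
Qed.

Lemma source_region x : source x -> ~~ base_region (region_of x) /\
  forall y, region_of y = region_of x -> h x <= h y.
Proof.
move=> sx; have [_ /(_ (region_of x))[ns _]] := extremal_count.
have nb : ~~ base_region (region_of x).
  apply: contraTT sx => /negPn b; move: ns; rewrite b /= /nb_source (bigD1 x) //=.
  by case: (source x).
split=> // y ey; have [x' ex' low] := region_lowest (region_of x).
suff -> : x = x' by exact: low.
apply: (@sum_bool_uniq _ (fun z => region_of z == region_of x) source) => //.
- by rewrite -/(nb_source _) ns nb.
- exact/eqP.
by apply: lowest_source => [|z]; rewrite ex' //; exact: low.
Qed.

Lemma sink_region x : sink x -> ~~ base_region (region_of x) /\
  forall y, region_of y = region_of x -> h y <= h x.
Proof.
move=> sx; have [_ /(_ (region_of x))[_ ns]] := extremal_count.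
have nb : ~~ base_region (region_of x).
  apply: contraTT sx => /negPn b; move: ns; rewrite b /= /nb_sink (bigD1 x) //=.
  by case: (sink x).
split=> // y ey; have [x' ex' high] := region_highest (region_of x).
suff -> : x = x' by exact: high.
apply: (@sum_bool_uniq _ (fun z => region_of z == region_of x) sink) => //.
- by rewrite -/(nb_sink _) ns nb.
- exact/eqP.
by apply: highest_sink => [|z]; rewrite ex' //; exact: high.
Qed.

(** The sweeping line passes a vertex in one of two ways: a crossed edge
    splits in two at a source, or two crossed edges merge at a sink. *)
Lemma corner_ex x : exists2 y, vertex_of y = vertex_of x &
  (source y && ~~ up (node G (node G y))) || (sink y && up (node G (node G y))).
Proof.
have [y /(vertex_of_eq triv) ey uy] := up_at x.
have [z /(vertex_of_eq triv) ez dz] := down_at x.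
have u1 : [|| up x, up (node G x) | up (node G (node G x))].
  by case: ey uy => -> ->; rewrite ?orbT.
have d1 : ~~ [&& up x, up (node G x) & up (node G (node G x))].
  by case: ez dz => -> /negbTE ->; rewrite ?andbF.
case ux: (up x); case un: (up (node G x)); case unn: (up (node G (node G x)));
  move: u1 d1; rewrite ux un unn //= => _ _.
- by exists x; rewrite // /source /sink ux un unn.
- by exists (node G (node G x)); rewrite ?vertex_of_node // /source /sink (node3 triv) ux un unn.
- by exists (node G x); rewrite ?vertex_of_node // /source /sink (node3 triv) ux un unn.
- by exists (node G x); rewrite ?vertex_of_node // /source /sink (node3 triv) ux un unn.
- by exists (node G (node G x)); rewrite ?vertex_of_node // /source /sink (node3 triv) ux un unn.
by exists x; rewrite // /source /sink ux un unn.
Qed.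

End Extremal.

(** Any edge can serve as the base edge of a sweep, and the two base regions
    differ. *)
Lemma region_of_edge_neq x : region_of x != region_of (edge G x).
Proof. by have [h ord] := sweep_order_ex x; have [] := extremal_count ord. Qed.

End Maps.

(** * Sums over finite functions *)

Section Update.
Variables (I J : finType).
Implicit Types t : {ffun I -> J}.

Definition update t (i : I) (y : J) : {ffun I -> J} :=
  [ffun k => if k == i then y else t k].

Lemma update_same t i y : update t i y i = y.
Proof. by rewrite ffunE eqxx. Qed.

Lemma update_other t i y k : k != i -> update t i y k = t k.
Proof. by rewrite ffunE => /negbTE ->. Qed.

Lemma update_id t i : update t i (t i) = t.
Proof. by apply/ffunP => k; rewrite ffunE; case: eqVneq => // ->. Qed.

Lemma sum_update (V : nmodType) i j0 (P : pred {ffun I -> J}) (g : {ffun I -> J} -> V) :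
  (forall t y, P (update t i y) = P t) ->
  \sum_(t | P t) g t = \sum_(t | P t && (t i == j0)) \sum_(y : J) g (update t i y).
Proof.
move=> Pu; rewrite (partition_big (fun t => update t i j0) (fun t => P t && (t i == j0))) /=.
  apply: eq_bigr => t /andP[Pt /eqP ti].
  rewrite (reindex_onto (fun y => update t i y) (fun t' => t' i)) /=.
    apply: eq_bigl => y; rewrite update_same eqxx Pu Pt andbT /=.
    by apply/eqP/ffunP => k; rewrite !ffunE; case: eqVneq => // ->.
  move=> t' /andP[_ /eqP <-]; apply/ffunP => k; rewrite !ffunE.
  by case: eqVneq => // ->.
by move=> t Pt; rewrite Pu Pt update_same eqxx.
Qed.

End Update.

Section Chain.
Variables (V : comPzRingType) (I : finType) (beta : nat -> I) (m : nat).
Variable Phi : nat -> bool -> bool -> V.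
Hypothesis beta_inj : forall i j, (i <= m)%N -> (j <= m)%N -> beta i = beta j -> i = j.
Hypothesis beta_surj : forall k, exists2 i, (i <= m)%N & beta i = k.

Lemma beta_neq i j : (i <= m)%N -> (j <= m)%N -> i != j -> beta i != beta j.
Proof. by move=> im jm; apply: contraNneq => /beta_inj ->. Qed.

(** The (u0, e) entry of a product of k transfer matrices of size two. *)
Fixpoint chain (u0 : bool) (k : nat) (e : bool) : V :=
  if k is k'.+1 then \sum_(e' : bool) chain u0 k' e' * Phi k' e' e
  else (e == u0)%:R.

(** The signs are summed out one after the other from the left. A position
    that has been summed out is kept in the domain of the sign functions with
    the dummy value true. *)
Lemma chain_sum u0 u1 :
  \sum_(d : {ffun I -> bool} | (d (beta 0) == u0) && (d (beta m) == u1))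
     \prod_(0 <= j < m) Phi j (d (beta j)) (d (beta j.+1)) = chain u0 m u1.
Proof.
pose P k (d : {ffun I -> bool}) := (d (beta m) == u1) && all (fun i => d (beta i)) (iota 0 k).
have step k : (k <= m)%N ->
  \sum_(d : {ffun I -> bool} | (d (beta 0) == u0) && (d (beta m) == u1))
     \prod_(0 <= j < m) Phi j (d (beta j)) (d (beta j.+1)) =
  \sum_(d | P k d) chain u0 k (d (beta k)) *
     \prod_(k <= j < m) Phi j (d (beta j)) (d (beta j.+1)).
  elim: k => [_|k IHk ltkm].
    rewrite big_mkcond [RHS]big_mkcond; apply: eq_bigr => d _.
    rewrite /P /= andbT; case: (d (beta m) == u1); rewrite ?andbF ?andbT //.
    by case: (d (beta 0) == u0); rewrite ?mul1r ?mul0r.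
  rewrite (IHk (ltnW ltkm)) (sum_update (i := beta k) true); last first.
    move=> d y; rewrite /P update_other; last first.
      by rewrite beta_neq ?(ltnW ltkm) // gtn_eqF.
    congr (_ && _); apply: eq_in_all => i; rewrite mem_iota /= add0n => ik.
    by rewrite update_other // beta_neq ?(ltnW ltkm) ?ltn_eqF // ltnW // (ltn_trans ik).
  apply: eq_big => [d|d].
    by rewrite /P -addn1 iotaD all_cat /= add0n andbT -andbA eqb_id.
  move=> /andP[_ /eqP dk]; rewrite mulr_suml; apply: eq_bigr => y _.
  have other j : (j <= m)%N -> j != k -> update d (beta k) y (beta j) = d (beta j).
    by move=> jm jk; rewrite update_other // beta_neq // ltnW.
  rewrite update_same (big_ltn ltkm) update_same (other k.+1) // ?gtn_eqF // mulrA.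
  congr (_ * _); rewrite big_nat [RHS]big_nat; apply: eq_bigr => j /andP[kj jm].
  by rewrite (other j) ?(other j.+1) // ?(gtn_eqF kj) ?(ltnW jm) // gtn_eqF // ltnS ltnW.
rewrite (step m) //; pose d1 : {ffun I -> bool} := [ffun i => if i == beta m then u1 else true].
rewrite (big_pred1 d1) => [|d].
  by rewrite big_geq // mulr1 ffunE eqxx.
apply/andP/eqP => [[/eqP dm /allP all_d]|->].
  apply/ffunP => k; rewrite ffunE; have [i im <-] := beta_surj k.
  case: eqVneq => [->//|ni]; apply: all_d; rewrite mem_iota /= add0n.
  by rewrite ltn_neqAle im andbT; apply: contraNneq ni => ->.
split; first by rewrite ffunE eqxx.
apply/allP => i; rewrite mem_iota /= add0n ffunE => im; case: ifP => // /eqP.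
by move/eqP; rewrite (negbTE (beta_neq _ _ _)) ?ltn_eqF // ltnW.
Qed.

End Chain.

(** * Tetrahedra with one spin-1/2 edge *)

Section Invariant.
Variables (R : realType) (A : R[i]) (rt : nat -> R[i] -> R[i]).
Hypotheses (A_neq0 : A != 0) (A_lt1 : `|A| < 1).
Hypothesis rtP : forall k : nat, (0 < k)%N -> qint_root k (rt k).

Let q := A ^+ 2.

Lemma q_neq0 : q != 0. Proof. exact: expf_neq0. Qed.

Lemma qint_qi n : qint n A = qi q n%:Z.
Proof. by rewrite /qint /qi -exprnP /q -exprM. Qed.

Lemma qint_neq0 n : (0 < n)%N -> qint n A != 0.
Proof.
have sub_neq0 k : (0 < k)%N -> A ^+ (2 * k) - A ^- (2 * k) != 0.
  move=> k0; rewrite subr_eq0; apply/eqP => e.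
  have : A ^+ (2 * k) * A ^+ (2 * k) = 1 by rewrite {2}e divff ?expf_neq0.
  rewrite -exprD => /(congr1 Num.norm) /eqP; rewrite normrX normr1.
  by rewrite lt_eqF // exprn_ilt1 // -lt0n addn_gt0 muln_gt0 k0.
by move=> n0; rewrite mulf_neq0 ?invr_eq0 ?sub_neq0 // (sub_neq0 1%N).
Qed.

Lemma qi_neq0 n : (0 < n)%N -> qi q n%:Z != 0.
Proof. by rewrite -qint_qi; exact: qint_neq0. Qed.

Lemma rt_sqr k : (0 < k)%N -> rt k A ^+ 2 = qint k A.
Proof. by case/rtP => _ + _; apply. Qed.

Lemma rt_neq0 k : (0 < k)%N -> rt k A != 0.
Proof. by move=> k0; have := qint_neq0 k0; rewrite -(rt_sqr k0) expf_eq0. Qed.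

Lemma qfact_fct n : qfact A n = fct q n.
Proof. by apply: eq_bigr => j _; exact: qint_qi. Qed.

Lemma qfact_root_sqr n : qfact_root rt A n ^+ 2 = fct q n.
Proof.
rewrite -qfact_fct /qfact /qfact_root -prodrXl big_nat [RHS]big_nat.
by apply: eq_bigr => j /andP[j0 _]; exact: rt_sqr.
Qed.

Lemma rfct_qfact n : rfct q n%:Z = (qfact A n)^-1.
Proof. by rewrite qfact_fct. Qed.

Let Delta := Delta rt A.

Lemma DeltaC a b c : Delta a b c = Delta b a c.
Proof.
rewrite /Delta /Defs.Delta (addnC b a) (addnC a c) (addnC c b).
by congr (_ / _); rewrite mulrAC.
Qed.

Lemma DeltaR a b c : Delta a b c = Delta b c a.
Proof.
rewrite /Delta /Defs.Delta; have -> : (b + c + a = a + b + c)%N by lia.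
by congr (_ / _); ring.
Qed.

Lemma DeltaS a b c : Delta a b c = Delta a c b.
Proof. by rewrite DeltaR DeltaC -DeltaR. Qed.

Lemma Delta_sqr a b c : Delta a b c ^+ 2 =
  fct q (a + b - c)./2 * fct q (b + c - a)./2 * fct q (c + a - b)./2 *
  rfct q ((a + b + c)./2.+1)%:Z.
Proof. by rewrite /Delta /Defs.Delta !(exprMn, exprVn) !qfact_root_sqr. Qed.

Definition adm4 (a b c d e f : nat) : bool :=
  [&& adm a b c, adm a e f, adm d b f & adm d e c].

(** Set to 0 on inadmissible data, the symbol satisfies its symmetries and the
    pentagon identity without side conditions. *)
Definition tet (a b c d e f : nat) : R[i] :=
  if adm4 a b c d e f then tau rt A a b c d e f else 0.

Definition tet_rac K (a b c d e f : nat) : R[i] :=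
  rac q K (a + b + c)./2%:Z (a + e + f)./2%:Z (d + b + f)./2%:Z (d + e + c)./2%:Z
    (a + b + d + e)./2%:Z (a + c + d + f)./2%:Z (b + c + e + f)./2%:Z.

Lemma tauE K a b c d e f : ((a + b + d + e)./2 < K)%N ->
  tau rt A a b c d e f = 'i ^+ (a + b + c + d + e + f) *
    (Delta a b c * Delta a e f * Delta d b f * Delta d e c) * tet_rac K a b c d e f.
Proof.
rewrite /tau /tet_rac /rac.
move: (a + b + c)./2 (a + e + f)./2 (d + b + f)./2 (d + e + c)./2 => T1 T2 T3 T4.
move: (a + b + d + e)./2 (a + c + d + f)./2 (b + c + e + f)./2 => Q1 Q2 Q3 ltK.
rewrite !mulrA; congr (_ * _); rewrite -(big_mkord xpredT).
rewrite [LHS](big_nat_widen _ _ K); last by lia.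
rewrite [LHS](big_nat_widenl _ 0) // big_mkcond; apply: eq_bigr => k _.
case: ifPn => [/andP[/= h1 h2]|h]; last by rewrite rterm_out //; lia.
have sub (m n : nat) : (n <= m)%N -> m%:Z - n%:Z = (m - n)%N%:Z by lia.
rewrite /rterm !sub; try lia.
by rewrite !rfct_qfact !qfact_fct !invfM !mulrA.
Qed.

(** With tet_swap23 and tet_flip12 this generates the symmetries of the
    tetrahedron: permuting the columns, and turning two of them upside down. *)
Lemma tet_swap12 a b c d e f : tet a b c d e f = tet b a c e d f.
Proof.
rewrite /tet; have -> : adm4 b a c e d f = adm4 a b c d e f by rewrite /adm4 /adm; lia.
case: ifP => // _; pose K := (a + b + d + e)./2.+1.
rewrite !(@tauE K) /K; try lia.
rewrite (DeltaC b a c) (DeltaC e a f) (DeltaC e d c) (DeltaC d b f).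
congr ('i ^+ _ * _ * _); [by lia | by ring |].
rewrite /tet_rac /rac; apply: eq_bigr => k _; rewrite /rterm.
have -> : (b + a + c = a + b + c)%N by lia.
have -> : (e + a + f = a + e + f)%N by lia.
have -> : (e + d + c = d + e + c)%N by lia.
have -> : (b + d + f = d + b + f)%N by lia.
have -> : (b + a + e + d = a + b + d + e)%N by lia.
by ring.
Qed.

Lemma tet_rac_swap23 K a b c d e f : tet_rac K a b c d e f = tet_rac K a c b d f e.
Proof.
rewrite /tet_rac /rac; apply: eq_bigr => k _; rewrite /rterm.
have -> : (a + c + b = a + b + c)%N by lia.
have -> : (a + f + e = a + e + f)%N by lia.
have -> : (d + f + b = d + b + f)%N by lia.
have -> : (d + c + e = d + e + c)%N by lia.
have -> : (c + b + f + e = b + c + e + f)%N by lia.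
by ring.
Qed.

Lemma tet_swap23 a b c d e f : tet a b c d e f = tet a c b d f e.
Proof.
rewrite /tet; have -> : adm4 a c b d f e = adm4 a b c d e f by rewrite /adm4 /adm; lia.
case: ifP => // _; pose K := ((a + b + d + e)./2 + (a + c + d + f)./2).+1.
rewrite !(@tauE K) /K; try lia.
rewrite (DeltaS a c b) (DeltaS a f e) (DeltaS d f b) (DeltaS d c e).
congr ('i ^+ _ * _ * _); [by lia | by ring |].
exact: tet_rac_swap23.
Qed.

Lemma tet_flip12 a b c d e f : tet a b c d e f = tet d e c a b f.
Proof.
rewrite /tet; have -> : adm4 d e c a b f = adm4 a b c d e f by rewrite /adm4 /adm; lia.
case: ifP => // _; pose K := (a + b + d + e)./2.+1.
rewrite !(@tauE K) /K; try lia.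
congr ('i ^+ _ * _ * _); [by lia | by ring |].
rewrite /tet_rac /rac; apply: eq_bigr => k _; rewrite /rterm.
have -> : (d + e + a + b = a + b + d + e)%N by lia.
have -> : (d + c + a + f = a + c + d + f)%N by lia.
have -> : (e + c + b + f = b + c + e + f)%N by lia.
by ring.
Qed.

Lemma tet_adm a b c d e f : tet a b c d e f != 0 ->
  [/\ adm a b c, adm a e f, adm d b f & adm d e c].
Proof. by rewrite /tet; case: ifPn => [/and4P[]|]; rewrite ?eqxx. Qed.

(** A spin-1/2 strand crossing an edge of color x, the regions beside the edge
    having the states s, s' on one side of the strand and t, t' on the other. *)
Definition edge_tet (x s s' t t' : nat) : R[i] := tet x s s' 1 t' t.

Lemma fct1 : fct q 1 = 1.
Proof.
rewrite fctS fct0 mulr1 -qint_qi /qint divff //.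
have := qint_neq0 (ltn0Sn 0); rewrite /qint mulf_eq0 negb_or => /andP[h _].
exact: h.
Qed.

Lemma rfctE n : rfct q n%:Z = (fct q n)^-1. Proof. by []. Qed.

(** A single index survives in the Racah sum, and the square of Delta cancels
    its factorials up to one quantum integer. The two letters are the signs of
    t - s and t' - s'. *)
Lemma half_spin_pp K x s s' t t' : t = s.+1 -> t' = s'.+1 ->
  (x + s + s' + 2 < K)%N -> adm x s s' ->
  Delta x t t' ^+ 2 * tet_rac K x s s' 1 t' t =
  (-1) ^+ (x + s + s')./2.+1 * qi q ((s + s' - x)./2.+1)%:Z.
Proof.
move=> -> -> ltK /adm_splitP[u [v [w [ex es es']]]]; subst x s s'.
rewrite /tet_rac (rac_single _ (k := (u + v + w).+1));
  try by rewrite ?inE; lia.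
rewrite Delta_sqr /rterm.
have -> : (u + v + (u + w).+1 - (v + w).+1)./2 = u by lia.
have -> : ((u + w).+1 + (v + w).+1 - (u + v))./2 = w.+1 by lia.
have -> : ((v + w).+1 + (u + v) - (u + w).+1)./2 = v by lia.
have -> : ((u + v + (u + w).+1 + (v + w).+1)./2.+1 = (u + v + w).+2)%N by lia.
have -> : (u + v + w).+1%:Z - (u + v + (u + w) + (v + w))./2%:Z = 1%N by lia.
have -> : (u + v + w).+1%:Z - (u + v + (v + w).+1 + (u + w).+1)./2%:Z = 0%N by lia.
have -> : (u + v + w).+1%:Z - (1 + (u + w) + (u + w).+1)./2%:Z = v by lia.
have -> : (u + v + w).+1%:Z - (1 + (v + w).+1 + (v + w))./2%:Z = u by lia.
have -> : (u + v + (u + w) + 1 + (v + w).+1)./2%:Z - (u + v + w).+1%:Z = 0%N by lia.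
have -> : (u + v + (v + w) + 1 + (u + w).+1)./2%:Z - (u + v + w).+1%:Z = 0%N by lia.
have -> : (u + w + (v + w) + (v + w).+1 + (u + w).+1)./2%:Z - (u + v + w).+1%:Z = w by lia.
have -> : ((u + v + (u + w) + (v + w))./2.+1 = (u + v + w).+1)%N by lia.
have -> : ((u + w + (v + w) - (u + v))./2.+1 = w.+1)%N by lia.
rewrite !rfctE fct0 fct1 !(fctS q w) !(fctS q (u + v + w).+1).
by field; rewrite !fct_neq0 ?qi_neq0 //; exact: qi_neq0.
Qed.

Lemma half_spin_pm K x s s' t t' : t = s.+1 -> s' = t'.+1 ->
  (x + s + s' + 2 < K)%N -> adm x s s' -> adm x t t' ->
  Delta x t t' ^+ 2 * tet_rac K x s s' 1 t' t =
  (-1) ^+ (x + s + s')./2 * qi q ((x + s - s')./2.+1)%:Z.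
Proof.
move=> -> -> ltK /adm_splitP[u [v [w [ex es et]]]] adm2; subst x s.
have [v1 ev] : exists v1, v = v1.+1.
  by exists v.-1; move: adm2; rewrite /adm; lia.
subst v; have et' : t' = (v1 + w)%N by lia.
subst t'; move=> {et adm2}.
rewrite /tet_rac (rac_single _ (k := (u + v1 + w).+1));
  try by rewrite ?inE; lia.
rewrite Delta_sqr /rterm.
have -> : (u + v1.+1 + (u + w).+1 - (v1 + w))./2 = u.+1 by lia.
have -> : ((u + w).+1 + (v1 + w) - (u + v1.+1))./2 = w by lia.
have -> : ((v1 + w) + (u + v1.+1) - (u + w).+1)./2 = v1 by lia.
have -> : ((u + v1.+1 + (u + w).+1 + (v1 + w))./2.+1 = (u + v1 + w).+2)%N by lia.
have -> : (u + v1 + w).+1%:Z - (u + v1.+1 + (u + w) + (v1 + w).+1)./2%:Z = 0%N by lia.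
have -> : (u + v1 + w).+1%:Z - (u + v1.+1 + (v1 + w) + (u + w).+1)./2%:Z = 0%N by lia.
have -> : (u + v1 + w).+1%:Z - (1 + (u + w) + (u + w).+1)./2%:Z = v1 by lia.
have -> : (u + v1 + w).+1%:Z - (1 + (v1 + w) + (v1 + w).+1)./2%:Z = u by lia.
have -> : (u + v1.+1 + (u + w) + 1 + (v1 + w))./2%:Z - (u + v1 + w).+1%:Z = 0%N by lia.
have -> : (u + v1.+1 + (v1 + w).+1 + 1 + (u + w).+1)./2%:Z - (u + v1 + w).+1%:Z = 1%N by lia.
have -> : (u + w + (v1 + w).+1 + (v1 + w) + (u + w).+1)./2%:Z - (u + v1 + w).+1%:Z = w by lia.
have -> : ((u + v1.+1 + (u + w) + (v1 + w).+1)./2 = (u + v1 + w).+1)%N by lia.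
have -> : ((u + v1.+1 + (u + w) - (v1 + w).+1)./2.+1 = u.+1)%N by lia.
rewrite !rfctE fct0 fct1 !(fctS q u).
by field; rewrite !fct_neq0 ?qi_neq0 //; exact: qi_neq0.
Qed.

Lemma half_spin_mp K x s s' t t' : s = t.+1 -> t' = s'.+1 ->
  (x + s + s' + 2 < K)%N -> adm x s s' -> adm x t t' ->
  Delta x t t' ^+ 2 * tet_rac K x s s' 1 t' t =
  (-1) ^+ (x + s + s')./2 * qi q ((x + s' - s)./2.+1)%:Z.
Proof.
move=> es et' ltK h1 h2.
rewrite DeltaS tet_rac_swap23 (half_spin_pm et' es); first by rewrite addnAC.
- by rewrite (addnAC x).
- by rewrite admS.
by rewrite admS.
Qed.

Lemma half_spin_mm K x s s' t t' : s = t.+1 -> s' = t'.+1 ->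
  (x + s + s' + 2 < K)%N -> adm x t t' ->
  Delta x t t' ^+ 2 * tet_rac K x s s' 1 t' t =
  (-1) ^+ (x + s + s')./2 * qi q ((x + s + s')./2.+1)%:Z.
Proof.
move=> -> -> ltK /adm_splitP[u [v [w [ex es et]]]]; subst x t t'.
rewrite /tet_rac (rac_single _ (k := (u + v + w).+1));
  try by rewrite ?inE; lia.
rewrite Delta_sqr /rterm.
have -> : (u + v + (u + w) - (v + w))./2 = u by lia.
have -> : ((u + w) + (v + w) - (u + v))./2 = w by lia.
have -> : ((v + w) + (u + v) - (u + w))./2 = v by lia.
have -> : ((u + v + (u + w) + (v + w))./2.+1 = (u + v + w).+1)%N by lia.
have -> : (u + v + w).+1%:Z - (u + v + (u + w).+1 + (v + w).+1)./2%:Z = 0%N by lia.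
have -> : (u + v + w).+1%:Z - (u + v + (v + w) + (u + w))./2%:Z = 1%N by lia.
have -> : (u + v + w).+1%:Z - (1 + (u + w).+1 + (u + w))./2%:Z = v by lia.
have -> : (u + v + w).+1%:Z - (1 + (v + w) + (v + w).+1)./2%:Z = u by lia.
have -> : (u + v + (u + w).+1 + 1 + (v + w))./2%:Z - (u + v + w).+1%:Z = 0%N by lia.
have -> : (u + v + (v + w).+1 + 1 + (u + w))./2%:Z - (u + v + w).+1%:Z = 0%N by lia.
have -> : ((u + w).+1 + (v + w).+1 + (v + w) + (u + w))./2%:Z - (u + v + w).+1%:Z = w by lia.
have -> : ((u + v + (u + w).+1 + (v + w).+1)./2 = (u + v + w).+1)%N by lia.
rewrite !rfctE fct0 fct1 !(fctS q (u + v + w).+1).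
by field; rewrite !fct_neq0 ?qi_neq0 //; exact: qi_neq0.
Qed.

(** The Kauffman bracket of an unknot of that color. *)
Definition dim (n : nat) : R[i] := (-1) ^+ n * qint n.+1 A.

Lemma dim_Delta_p s : dim s.+1 * Delta 1 s s.+1 ^+ 2 = (-1) ^+ s.+1 / qi q s.+1%:Z.
Proof.
rewrite Delta_sqr /dim qint_qi.
have -> : ((1 + s - s.+1)./2 = 0)%N by lia.
have -> : ((s + s.+1 - 1)./2 = s)%N by lia.
have -> : ((s.+1 + 1 - s)./2 = 1)%N by lia.
have -> : ((1 + s + s.+1)./2.+1 = s.+2)%N by lia.
rewrite rfctE fct0 fct1 !fctS.
by field; rewrite !fct_neq0 ?qi_neq0 //; exact: qi_neq0.
Qed.

Lemma dim_Delta_m s t : s = t.+1 ->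
  dim t * Delta 1 s t ^+ 2 = (-1) ^+ t / qi q s.+1%:Z.
Proof.
move=> ->; move: t => {}s.
rewrite Delta_sqr /dim qint_qi.
have -> : ((1 + s.+1 - s)./2 = 1)%N by lia.
have -> : ((s.+1 + s - 1)./2 = s)%N by lia.
have -> : ((s + 1 - s.+1)./2 = 0)%N by lia.
have -> : ((1 + s.+1 + s)./2.+1 = s.+2)%N by lia.
rewrite rfctE fct0 fct1 !fctS.
by field; rewrite !fct_neq0 ?qi_neq0 //; exact: qi_neq0.
Qed.

Lemma tet_rac_flip23 K a b c d e f : tet_rac K a b c d e f = tet_rac K a e f d b c.
Proof.
rewrite /tet_rac /rac; apply: eq_bigr => k _; rewrite /rterm.
have -> : (a + e + d + b = a + b + d + e)%N by lia.
have -> : (a + f + d + c = a + c + d + f)%N by lia.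
have -> : (e + f + b + c = b + c + e + f)%N by lia.
by ring.
Qed.

Lemma sign_eq m n : odd m = odd n -> (-1) ^+ m = (-1) ^+ n :> R[i].
Proof. by move=> e; rewrite -signr_odd e signr_odd. Qed.

Lemma expi_sign m n j : (m + 2 * j = n %[mod 4])%N -> 'i ^+ m = 'i ^+ n * (-1) ^+ j :> R[i].
Proof.
have i4 : ('i : R[i]) ^+ 4 = 1 by rewrite (exprM _ 2 2) sqrCi sqrrN expr1n.
move=> e; rewrite -(expr_mod n i4) -e expr_mod // exprD exprM sqrCi -mulrA -exprD addnn.
by rewrite -mul2n exprM sqrrN !expr1n mulr1.
Qed.

Section Pentagon.
Variables (K x1 x2 x3 s1 s2 s3 t2 t3 : nat).
Hypothesis ltK : (2 * (x1 + x2 + x3 + s1 + s2 + s3 + t2 + t3) + 10 < K)%N.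

Let C := Delta x1 x2 x3 * Delta x1 t2 t3 * Delta x2 s1 s3 * Delta x3 s1 s2 *
  Delta 1 s3 t3 * Delta 1 s2 t2.

Let N0 := (x1 + s2 + s3 + 1 + t3 + t2 + (x1 + x2 + x3 + s1 + s2 + s3))%N.

Definition pentagon_summand y := dim y * tet x1 x2 x3 y t2 t3 *
  edge_tet x2 s1 s3 y t3 * edge_tet x3 s1 s2 y t2.

(** Each triad that contains y belongs to two of the three tetrahedra, so its
    Delta occurs squared; the square roots that are left do not depend on y
    and are collected in C. *)
Lemma pentagon_summandE y : (y <= s1.+1)%N ->
  adm x1 x2 x3 -> adm x1 t2 t3 -> adm x2 s1 s3 -> adm x3 s1 s2 ->
  adm 1 s2 t2 -> adm 1 s3 t3 -> adm 1 s1 y -> adm y x2 t3 -> adm y t2 x3 ->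
  pentagon_summand y =
  C * 'i ^+ (x1 + x2 + x3 + y + t2 + t3 + (x2 + s1 + s3 + 1 + t3 + y) +
             (x3 + s1 + s2 + 1 + t2 + y)) *
  (dim y * Delta 1 s1 y ^+ 2) *
  (Delta x2 y t3 ^+ 2 * tet_rac K x2 s1 s3 1 t3 y) *
  (Delta x3 y t2 ^+ 2 * tet_rac K x3 s1 s2 1 t2 y) * tet_rac K x1 x2 x3 y t2 t3.
Proof.
rewrite /pentagon_summand /edge_tet /tet /adm4 => ley -> -> -> -> a5 a6 -> b1 b2.
rewrite b1 b2 (admS x2) (admC x2) b1 (admC x3) (admS t2) (admC t2) b2.
rewrite !(admS 1 _ s2) !(admS 1 _ s3) a5 a6 {a5 a6 b1 b2} /=.
rewrite !(@tauE K); try lia.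
rewrite (DeltaC y x2) (DeltaS x2 t3) (DeltaS y t2) (DeltaC y x3) (DeltaS x3 t2).
rewrite (DeltaS 1 t3) (DeltaS 1 t2) !exprD /C.
by ring.
Qed.

Lemma pentagon_rhsE :
  adm x1 x2 x3 -> adm x1 t2 t3 -> adm x2 s1 s3 -> adm x3 s1 s2 ->
  adm 1 s2 t2 -> adm 1 s3 t3 -> adm x1 s2 s3 ->
  edge_tet x1 s2 s3 t2 t3 * tet x1 x2 x3 s1 s2 s3 =
  C * 'i ^+ N0 * (Delta x1 s2 s3 ^+ 2 * tet_rac K x1 t2 t3 1 s3 s2) *
  tet_rac K x1 x2 x3 s1 s2 s3.
Proof.
rewrite /edge_tet /tet /adm4 => a1 a2 a3 a4 a5 a6 a7.
rewrite a1 a7 (admS x1 t3) a2 a5 (admS 1 t3) a6 (admC s1 x2) a3.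
rewrite (admS s1) (admC s1) a4 {a1 a2 a3 a4 a5 a6 a7} /=.
rewrite !(@tauE K); try lia.
rewrite (tet_rac_flip23 _ x1 s2) (tet_rac_swap23 _ x1 t3) (DeltaC s1 x2).
rewrite (DeltaS x1 t3) (DeltaS 1 t3).
rewrite (DeltaS s1 s2) (DeltaC s1 x3) /N0 !exprD /C.
by ring.
Qed.

Lemma pentagon_rhs0 : ~~ adm x1 s2 s3 ->
  edge_tet x1 s2 s3 t2 t3 * tet x1 x2 x3 s1 s2 s3 = 0.
Proof. by rewrite /edge_tet /tet /adm4 => /negbTE->; rewrite mul0r. Qed.

Lemma pentagon_summand0 y :
  ~~ [&& adm 1 s1 y, adm y x2 t3 & adm y t2 x3] -> pentagon_summand y = 0.
Proof.
rewrite /pentagon_summand /edge_tet /tet /adm4.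
by do 3![case: (adm _ _ _) => //=]; rewrite ?andbF !(mulr0, mul0r).
Qed.

End Pentagon.

(** * The pentagon identity *)

Lemma adm1_pred n : adm 1 n n.-1 -> n = n.-1.+1.
Proof. by case: n. Qed.

Section Cases.
Variables (x1 x2 x3 s1 s2 s3 t2 t3 T1 T2 T3 T4 Q1 Q2 Q3 : nat).
Hypotheses (eT1 : (x1 + x2 + x3 = T1 + T1)%N) (eT2 : (x1 + s2 + s3 = T2 + T2)%N)
  (eT3 : (s1 + x2 + s3 = T3 + T3)%N) (eT4 : (s1 + s2 + x3 = T4 + T4)%N)
  (eQ1 : (x1 + x2 + s1 + s2 = Q1 + Q1)%N) (eQ2 : (x1 + x3 + s1 + s3 = Q2 + Q2)%N)
  (eQ3 : (x2 + x3 + s2 + s3 = Q3 + Q3)%N).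
Hypotheses (a1 : adm x1 x2 x3) (a2 : adm x1 t2 t3) (a3 : adm x2 s1 s3)
  (a4 : adm x3 s1 s2) (a5 : adm 1 s2 t2) (a6 : adm 1 s3 t3).

Let K := (2 * (x1 + x2 + x3 + s1 + s2 + s3 + t2 + t3) + 11)%N.
Let ltK : (2 * (x1 + x2 + x3 + s1 + s2 + s3 + t2 + t3) + 10 < K)%N.
Proof. by rewrite /K ltn_add2l. Qed.

Let N0 := (x1 + s2 + s3 + 1 + t3 + t2 + (x1 + x2 + x3 + s1 + s2 + s3))%N.
Let C := Delta x1 x2 x3 * Delta x1 t2 t3 * Delta x2 s1 s3 * Delta x3 s1 s2 *
  Delta 1 s3 t3 * Delta 1 s2 t2.

Let ineqs : [/\ x1 <= T1, x2 <= T1 & x3 <= T1]%N /\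
  [/\ s1 <= T3, x2 <= T3 & s3 <= T3]%N /\ [/\ s1 <= T4, s2 <= T4 & x3 <= T4]%N.
Proof.
have [T [e h1 h2 h3]] := adm_half a1; have [T' [e' h1' h2' h3']] := adm_half a3.
have [T'' [e'' h1'' h2'' h3'']] := adm_half a4.
by clear -e e' e'' h1 h2 h3 h1' h2' h3' h1'' h2'' h3'' eT1 eT3 eT4; do !split; lia.
Qed.

Let ineqs2 : exists T, [/\ x1 + t2 + t3 = T + T, x1 <= T, t2 <= T & t3 <= T]%N.
Proof. exact: adm_half a2. Qed.

(** Admissibility enters the arithmetic only through the linear inequalities
    of ineqs and ineqs2. *)
Ltac arith := rewrite ?/K ?/N0; move: (ineqs) (ineqs2); clear ineqs ineqs2 ltK;
  repeat match goal with H : is_true (adm _ _ _) |- _ => clear H end;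
  move=> [[? ? ?] [[? ? ?] [? ? ?]]] [? [? ? ? ?]]; lia.

(** The power of the imaginary unit and the three signs of the factors of a
    summand combine into one sign; j counts the factors -1 by which the power
    of the imaginary unit differs from the one on the right-hand side of the
    pentagon identity. *)
Lemma pentagon_termE y (j : nat) (e1 e2 e3 : nat) (sg : nat) d1 (c2 c3 : R[i]) :
  adm 1 s1 y -> adm y x2 t3 -> adm y t2 x3 ->
  dim y * Delta 1 s1 y ^+ 2 = (-1) ^+ e1 / d1 ->
  Delta x2 y t3 ^+ 2 * tet_rac K x2 s1 s3 1 t3 y = (-1) ^+ e2 * c2 ->
  Delta x3 y t2 ^+ 2 * tet_rac K x3 s1 s2 1 t2 y = (-1) ^+ e3 * c3 ->
  (x1 + x2 + x3 + y + t2 + t3 + (x2 + s1 + s3 + 1 + t3 + y) +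
             (x3 + s1 + s2 + 1 + t2 + y) + 2 * j = N0 %[mod 4])%N ->
  odd (j + e1 + e2 + e3) = odd sg ->
  pentagon_summand x1 x2 x3 s1 s2 s3 t2 t3 y =
  C * 'i ^+ N0 * ((-1) ^+ sg / d1) * (c2 * c3 * tet_rac K x1 x2 x3 y t2 t3).
Proof.
move=> b1 b2 b3 d w2' w3' eN es.
have ley := adm1_leq b1.
rewrite (pentagon_summandE ltK ley) // d w2' w3' (expi_sign eN) -(sign_eq es) !exprD /C.
by ring.
Qed.

(** The first two letters are the signs of t2 - s2 and t3 - s3, the last one
    is that of y - s1. If a triad that contains y is inadmissible, a lower
    bound of the Racah sum exceeds an upper one, so that both sides vanish. *)
Lemma term_pp_p : t2 = s2.+1 -> t3 = s3.+1 ->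
  pentagon_summand x1 x2 x3 s1 s2 s3 t2 t3 s1.+1 =
  C * 'i ^+ N0 * ((-1) ^+ T2 / qi q s1.+1%:Z) *
    (qi q (Q2%:Z + 1 - T1%:Z) * qi q (Q1%:Z + 1 - T1%:Z) *
     rac q K T1 (T2%:Z + 1) (T3%:Z + 1) (T4%:Z + 1) (Q1%:Z + 1) (Q2%:Z + 1) (Q3%:Z + 1)).
Proof.
move=> E2 E3.
have [/and3P[b1 b2 b3]|nb] := boolP [&& adm 1 s1 s1.+1, adm s1.+1 x2 t3 & adm s1.+1 t2 x3].
  have -> : rac q K T1 (T2%:Z + 1) (T3%:Z + 1) (T4%:Z + 1) (Q1%:Z + 1) (Q2%:Z + 1) (Q3%:Z + 1) =
      tet_rac K x1 x2 x3 s1.+1 t2 t3.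
    by rewrite /tet_rac; congr rac; arith.
  apply: (@pentagon_termE s1.+1 ((x1 + T1).+1) (s1.+1) (T3.+1) (T4.+1)).
  - exact: b1.
  - exact: b2.
  - exact: b3.
  - exact: dim_Delta_p.
  - rewrite (half_spin_pp erefl E3);
      [by congr ((-1) ^+ _ * qi q _); arith|by arith|exact: a3].
  - rewrite (half_spin_pp erefl E2);
      [by congr ((-1) ^+ _ * qi q _); arith|by arith|exact: a4].
  - by arith.
  - by arith.
rewrite pentagon_summand0; last exact: nb.
rewrite rac_out ?mulr0 //; apply: contraNT nb => nout.
apply/and3P; split.
- exact: adm1S.
- by apply: (@half_adm _ _ _ (T3.+1)); arith.
- by apply: (@half_adm _ _ _ (T4.+1)); arith.
Qed.

Lemma term_pp_m : t2 = s2.+1 -> t3 = s3.+1 ->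
  pentagon_summand x1 x2 x3 s1 s2 s3 t2 t3 s1.-1 =
  C * 'i ^+ N0 * ((-1) ^+ T2.+1 / qi q s1.+1%:Z) *
    (qi q (Q3%:Z + 1 - T4%:Z) * qi q (Q3%:Z + 1 - T3%:Z) *
     rac q K T1 (T2%:Z + 1) T3 T4 Q1 Q2 (Q3%:Z + 1)).
Proof.
move=> E2 E3.
have [/and3P[b1 b2 b3]|nb] := boolP [&& adm 1 s1 s1.-1, adm s1.-1 x2 t3 & adm s1.-1 t2 x3].
  have -> : rac q K T1 (T2%:Z + 1) T3 T4 Q1 Q2 (Q3%:Z + 1) =
      tet_rac K x1 x2 x3 s1.-1 t2 t3.
    by have E1 := adm1_pred b1; rewrite /tet_rac; congr rac; arith.
  have E1 := adm1_pred b1.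
  apply: (@pentagon_termE s1.-1 (x1 + T1) (s1.-1) (T3) (T4)).
  - exact: b1.
  - exact: b2.
  - exact: b3.
  - exact: dim_Delta_m E1.
  - rewrite (half_spin_mp E1 E3);
      [by congr ((-1) ^+ _ * qi q _); arith|by arith|exact: a3|by rewrite admC; exact: b2].
  - rewrite (half_spin_mp E1 E2);
      [by congr ((-1) ^+ _ * qi q _); arith|by arith|exact: a4|by rewrite admC admS; exact: b3].
  - by arith.
  - by arith.
rewrite pentagon_summand0; last exact: nb.
rewrite rac_out ?mulr0 //; apply: contraNT nb => nout.
have E1 : (s1 = s1.-1.+1)%N by arith.
apply/and3P; split.
- by rewrite {1}E1 admS1.
- by apply: (@half_adm _ _ _ (T3)); arith.
- by apply: (@half_adm _ _ _ (T4)); arith.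
Qed.

Lemma term_pm_p : t2 = s2.+1 -> s3 = t3.+1 ->
  pentagon_summand x1 x2 x3 s1 s2 s3 t2 t3 s1.+1 =
  C * 'i ^+ N0 * ((-1) ^+ T2 / qi q s1.+1%:Z) *
    (qi q (Q1%:Z + 1 - T2%:Z) * qi q (Q1%:Z + 1 - T1%:Z) *
     rac q K T1 T2 T3 (T4%:Z + 1) (Q1%:Z + 1) Q2 Q3).
Proof.
move=> E2 E3.
have [/and3P[b1 b2 b3]|nb] := boolP [&& adm 1 s1 s1.+1, adm s1.+1 x2 t3 & adm s1.+1 t2 x3].
  have -> : rac q K T1 T2 T3 (T4%:Z + 1) (Q1%:Z + 1) Q2 Q3 =
      tet_rac K x1 x2 x3 s1.+1 t2 t3.
    by rewrite /tet_rac; congr rac; arith.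
  apply: (@pentagon_termE s1.+1 (x1 + T1) (s1.+1) (T3) (T4.+1)).
  - exact: b1.
  - exact: b2.
  - exact: b3.
  - exact: dim_Delta_p.
  - rewrite (half_spin_pm erefl E3);
      [by congr ((-1) ^+ _ * qi q _); arith|by arith|exact: a3|by rewrite admC; exact: b2].
  - rewrite (half_spin_pp erefl E2);
      [by congr ((-1) ^+ _ * qi q _); arith|by arith|exact: a4].
  - by arith.
  - by arith.
rewrite pentagon_summand0; last exact: nb.
rewrite rac_out ?mulr0 //; apply: contraNT nb => nout.
apply/and3P; split.
- exact: adm1S.
- by apply: (@half_adm _ _ _ (T3)); arith.
- by apply: (@half_adm _ _ _ (T4.+1)); arith.
Qed.

Lemma term_pm_m : t2 = s2.+1 -> s3 = t3.+1 ->
  pentagon_summand x1 x2 x3 s1 s2 s3 t2 t3 s1.-1 =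
  C * 'i ^+ N0 * ((-1) ^+ T2 / qi q s1.+1%:Z) *
    (qi q (T3%:Z + 1) * qi q (Q3%:Z + 1 - T3%:Z) *
     rac q K T1 T2 (T3%:Z - 1) T4 Q1 (Q2%:Z - 1) Q3).
Proof.
move=> E2 E3.
have [/and3P[b1 b2 b3]|nb] := boolP [&& adm 1 s1 s1.-1, adm s1.-1 x2 t3 & adm s1.-1 t2 x3].
  have -> : rac q K T1 T2 (T3%:Z - 1) T4 Q1 (Q2%:Z - 1) Q3 =
      tet_rac K x1 x2 x3 s1.-1 t2 t3.
    by have E1 := adm1_pred b1; rewrite /tet_rac; congr rac; arith.
  have E1 := adm1_pred b1.
  apply: (@pentagon_termE s1.-1 ((x1 + T1).+1) (s1.-1) (T3) (T4)).
  - exact: b1.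
  - exact: b2.
  - exact: b3.
  - exact: dim_Delta_m E1.
  - rewrite (half_spin_mm E1 E3);
      [by congr ((-1) ^+ _ * qi q _); arith|by arith|by rewrite admC; exact: b2].
  - rewrite (half_spin_mp E1 E2);
      [by congr ((-1) ^+ _ * qi q _); arith|by arith|exact: a4|by rewrite admC admS; exact: b3].
  - by arith.
  - by arith.
rewrite pentagon_summand0; last exact: nb.
rewrite rac_out ?mulr0 //; apply: contraNT nb => nout.
have E1 : (s1 = s1.-1.+1)%N by arith.
apply/and3P; split.
- by rewrite {1}E1 admS1.
- by apply: (@half_adm _ _ _ (T3.-1)); arith.
- by apply: (@half_adm _ _ _ (T4)); arith.
Qed.

Lemma term_mm_p : s2 = t2.+1 -> s3 = t3.+1 ->
  pentagon_summand x1 x2 x3 s1 s2 s3 t2 t3 s1.+1 =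
  C * 'i ^+ N0 * ((-1) ^+ T2 / qi q s1.+1%:Z) *
    (qi q (Q1%:Z + 1 - T2%:Z) * qi q (Q2%:Z + 1 - T2%:Z) *
     rac q K T1 (T2%:Z - 1) T3 T4 Q1 Q2 (Q3%:Z - 1)).
Proof.
move=> E2 E3.
have [/and3P[b1 b2 b3]|nb] := boolP [&& adm 1 s1 s1.+1, adm s1.+1 x2 t3 & adm s1.+1 t2 x3].
  have -> : rac q K T1 (T2%:Z - 1) T3 T4 Q1 Q2 (Q3%:Z - 1) =
      tet_rac K x1 x2 x3 s1.+1 t2 t3.
    by rewrite /tet_rac; congr rac; arith.
  apply: (@pentagon_termE s1.+1 ((x1 + T1).+1) (s1.+1) (T3) (T4)).
  - exact: b1.
  - exact: b2.
  - exact: b3.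
  - exact: dim_Delta_p.
  - rewrite (half_spin_pm erefl E3);
      [by congr ((-1) ^+ _ * qi q _); arith|by arith|exact: a3|by rewrite admC; exact: b2].
  - rewrite (half_spin_pm erefl E2);
      [by congr ((-1) ^+ _ * qi q _); arith|by arith|exact: a4|by rewrite admC admS; exact: b3].
  - by arith.
  - by arith.
rewrite pentagon_summand0; last exact: nb.
rewrite rac_out ?mulr0 //; apply: contraNT nb => nout.
apply/and3P; split.
- exact: adm1S.
- by apply: (@half_adm _ _ _ (T3)); arith.
- by apply: (@half_adm _ _ _ (T4)); arith.
Qed.

Lemma term_mm_m : s2 = t2.+1 -> s3 = t3.+1 ->
  pentagon_summand x1 x2 x3 s1 s2 s3 t2 t3 s1.-1 =
  C * 'i ^+ N0 * ((-1) ^+ T2.+1 / qi q s1.+1%:Z) *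
    (qi q (T3%:Z + 1) * qi q (T4%:Z + 1) *
     rac q K T1 (T2%:Z - 1) (T3%:Z - 1) (T4%:Z - 1) (Q1%:Z - 1) (Q2%:Z - 1) (Q3%:Z - 1)).
Proof.
move=> E2 E3.
have [/and3P[b1 b2 b3]|nb] := boolP [&& adm 1 s1 s1.-1, adm s1.-1 x2 t3 & adm s1.-1 t2 x3].
  have -> : rac q K T1 (T2%:Z - 1) (T3%:Z - 1) (T4%:Z - 1) (Q1%:Z - 1) (Q2%:Z - 1) (Q3%:Z - 1) =
      tet_rac K x1 x2 x3 s1.-1 t2 t3.
    by have E1 := adm1_pred b1; rewrite /tet_rac; congr rac; arith.
  have E1 := adm1_pred b1.
  apply: (@pentagon_termE s1.-1 (x1 + T1) (s1.-1) (T3) (T4)).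
  - exact: b1.
  - exact: b2.
  - exact: b3.
  - exact: dim_Delta_m E1.
  - rewrite (half_spin_mm E1 E3);
      [by congr ((-1) ^+ _ * qi q _); arith|by arith|by rewrite admC; exact: b2].
  - rewrite (half_spin_mm E1 E2);
      [by congr ((-1) ^+ _ * qi q _); arith|by arith|by rewrite admC admS; exact: b3].
  - by arith.
  - by arith.
rewrite pentagon_summand0; last exact: nb.
rewrite rac_out ?mulr0 //; apply: contraNT nb => nout.
have E1 : (s1 = s1.-1.+1)%N by arith.
apply/and3P; split.
- by rewrite {1}E1 admS1.
- by apply: (@half_adm _ _ _ (T3.-1)); arith.
- by apply: (@half_adm _ _ _ (T4.-1)); arith.
Qed.

Lemma rhs_pp : t2 = s2.+1 -> t3 = s3.+1 ->
  edge_tet x1 s2 s3 t2 t3 * tet x1 x2 x3 s1 s2 s3 =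
  C * 'i ^+ N0 * (-1) ^+ T2.+1 * (qi q (T2%:Z + 2) * rac q K T1 T2 T3 T4 Q1 Q2 Q3).
Proof.
move=> E2 E3; have [a7|na7] := boolP (adm x1 s2 s3).
  have -> : rac q K T1 T2 T3 T4 Q1 Q2 Q3 = tet_rac K x1 x2 x3 s1 s2 s3.
    by rewrite /tet_rac; congr rac; arith.
  have w : Delta x1 s2 s3 ^+ 2 * tet_rac K x1 t2 t3 1 s3 s2 = (-1) ^+ T2.+1 * qi q (T2%:Z + 2).
    rewrite (half_spin_mm E2 E3); [by congr ((-1) ^+ _ * qi q _); arith|by arith|exact: a7].
  by rewrite (pentagon_rhsE ltK) // w /C; ring.
rewrite pentagon_rhs0; last exact: na7.
rewrite rac_out ?mulr0 //; apply: contraNT na7 => nout.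
by apply: (@half_adm _ _ _ T2); arith.
Qed.

Lemma rhs_pm : t2 = s2.+1 -> s3 = t3.+1 ->
  edge_tet x1 s2 s3 t2 t3 * tet x1 x2 x3 s1 s2 s3 =
  C * 'i ^+ N0 * (-1) ^+ T2 * (qi q (Q2%:Z - T4%:Z) * rac q K T1 T2 T3 T4 Q1 Q2 Q3).
Proof.
move=> E2 E3; have [a7|na7] := boolP (adm x1 s2 s3).
  have -> : rac q K T1 T2 T3 T4 Q1 Q2 Q3 = tet_rac K x1 x2 x3 s1 s2 s3.
    by rewrite /tet_rac; congr rac; arith.
  have w : Delta x1 s2 s3 ^+ 2 * tet_rac K x1 t2 t3 1 s3 s2 = (-1) ^+ T2 * qi q (Q2%:Z - T4%:Z).
    rewrite (half_spin_mp E2 E3); [by congr ((-1) ^+ _ * qi q _); arith|by arith|exact: a2|exact: a7].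
  by rewrite (pentagon_rhsE ltK) // w /C; ring.
rewrite pentagon_rhs0; last exact: na7.
rewrite rac_out ?mulr0 //; apply: contraNT na7 => nout.
by apply: (@half_adm _ _ _ T2); arith.
Qed.

Lemma rhs_mm : s2 = t2.+1 -> s3 = t3.+1 ->
  edge_tet x1 s2 s3 t2 t3 * tet x1 x2 x3 s1 s2 s3 =
  C * 'i ^+ N0 * (-1) ^+ T2 * (qi q (Q3%:Z - T1%:Z) * rac q K T1 T2 T3 T4 Q1 Q2 Q3).
Proof.
move=> E2 E3; have [a7|na7] := boolP (adm x1 s2 s3).
  have -> : rac q K T1 T2 T3 T4 Q1 Q2 Q3 = tet_rac K x1 x2 x3 s1 s2 s3.
    by rewrite /tet_rac; congr rac; arith.
  have w : Delta x1 s2 s3 ^+ 2 * tet_rac K x1 t2 t3 1 s3 s2 = (-1) ^+ T2 * qi q (Q3%:Z - T1%:Z).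
    rewrite (half_spin_pp E2 E3); [by congr ((-1) ^+ _ * qi q _); arith|by arith|exact: a2].
  by rewrite (pentagon_rhsE ltK) // w /C; ring.
rewrite pentagon_rhs0; last exact: na7.
rewrite rac_out ?mulr0 //; apply: contraNT na7 => nout.
by apply: (@half_adm _ _ _ T2); arith.
Qed.

Let pentagon_for := \sum_(e : bool) pentagon_summand x1 x2 x3 s1 s2 s3 t2 t3 (shift_color e s1)
  = edge_tet x1 s2 s3 t2 t3 * tet x1 x2 x3 s1 s2 s3.

Let sumQ : Q1%:Z + Q2%:Z + Q3%:Z = T1%:Z + T2%:Z + T3%:Z + T4%:Z.
Proof. by arith. Qed.

Let d_neq0 : qi q s1.+1%:Z != 0. Proof. exact: qi_neq0. Qed.

Lemma pentagon_pp : t2 = s2.+1 -> t3 = s3.+1 -> pentagon_for.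
Proof.
move=> E2 E3; rewrite /pentagon_for big_bool /= term_pp_p // term_pp_m // rhs_pp //.
have rel : qi q (Q3%:Z + 1 - T3%:Z) * qi q (Q3%:Z + 1 - T4%:Z) *
    rac q K T1 (T2%:Z + 1) T3 T4 Q1 Q2 (Q3%:Z + 1)
  - qi q (Q1%:Z + 1 - T1%:Z) * qi q (Q2%:Z + 1 - T1%:Z) *
    rac q K T1 (T2%:Z + 1) (T3%:Z + 1) (T4%:Z + 1) (Q1%:Z + 1) (Q2%:Z + 1) (Q3%:Z + 1)
  = qi q (T2%:Z + 2) * qi q s1.+1%:Z * rac q K T1 T2 T3 T4 Q1 Q2 Q3.
  rewrite (rac_rel_pp q_neq0 qi_neq0) //; last by arith.
  by congr (_ * qi q _ * _); arith.
move: rel; set r1 := rac q K _ _ _ _ _ _ _; set r2 := rac q K _ _ _ _ _ _ _.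
set r := rac q K _ _ _ _ _ _ _ => rel; move: d_neq0 => dn.
apply: (mulIf dn); rewrite -[RHS]mulrA.
transitivity (C * 'i ^+ N0 * (-1) ^+ T2.+1 * (qi q (T2%:Z + 2) * qi q s1.+1%:Z * r));
  last by ring.
by rewrite -rel exprS; field.
Qed.

Lemma pentagon_pm : t2 = s2.+1 -> s3 = t3.+1 -> pentagon_for.
Proof.
move=> E2 E3; rewrite /pentagon_for big_bool /= term_pm_p // term_pm_m // rhs_pm //.
have rel : qi q (Q1%:Z + 1 - T1%:Z) * qi q (Q1%:Z + 1 - T2%:Z) *
    rac q K T1 T2 T3 (T4%:Z + 1) (Q1%:Z + 1) Q2 Q3
  + qi q (T3%:Z + 1) * qi q (Q3%:Z + 1 - T3%:Z) *
    rac q K T1 T2 (T3%:Z - 1) T4 Q1 (Q2%:Z - 1) Q3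
  = qi q (Q2%:Z - T4%:Z) * qi q s1.+1%:Z * rac q K T1 T2 T3 T4 Q1 Q2 Q3.
  rewrite (rac_rel_pm q_neq0 qi_neq0) //; last by arith.
  by congr (_ * qi q _ * _); arith.
move: rel; set r1 := rac q K _ _ _ _ _ _ _; set r2 := rac q K _ _ _ _ _ _ _.
set r := rac q K _ _ _ _ _ _ _ => rel; move: d_neq0 => dn.
apply: (mulIf dn); rewrite -[RHS]mulrA.
transitivity (C * 'i ^+ N0 * (-1) ^+ T2 * (qi q (Q2%:Z - T4%:Z) * qi q s1.+1%:Z * r));
  last by ring.
by rewrite -rel; field.
Qed.

Lemma pentagon_mm : s2 = t2.+1 -> s3 = t3.+1 -> pentagon_for.
Proof.
move=> E2 E3; rewrite /pentagon_for big_bool /= term_mm_p // term_mm_m // rhs_mm //.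
have rel : qi q (Q1%:Z + 1 - T2%:Z) * qi q (Q2%:Z + 1 - T2%:Z) *
    rac q K T1 (T2%:Z - 1) T3 T4 Q1 Q2 (Q3%:Z - 1)
  = qi q (T3%:Z + 1) * qi q (T4%:Z + 1) *
    rac q K T1 (T2%:Z - 1) (T3%:Z - 1) (T4%:Z - 1) (Q1%:Z - 1) (Q2%:Z - 1) (Q3%:Z - 1)
  + qi q (Q3%:Z - T1%:Z) * qi q s1.+1%:Z * rac q K T1 T2 T3 T4 Q1 Q2 Q3.
  have := @rac_rel_mm _ _ q_neq0 qi_neq0 K T1 (T2%:Z - 1) (T3%:Z - 1) (T4%:Z - 1)
    (Q1%:Z - 1) (Q2%:Z - 1) (Q3%:Z - 1).
  have -> : T3%:Z - 1 + (T4%:Z - 1) + 2 - (Q3%:Z - 1) = s1.+1 by arith.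
  have -> : Q1%:Z - 1 + 1 - (T2%:Z - 1) = Q1%:Z + 1 - T2%:Z by ring.
  have -> : Q2%:Z - 1 + 1 - (T2%:Z - 1) = Q2%:Z + 1 - T2%:Z by ring.
  have -> : T3%:Z - 1 + 2 = T3%:Z + 1 by ring.
  have -> : T4%:Z - 1 + 2 = T4%:Z + 1 by ring.
  rewrite !subrK; apply; by arith.
move: rel; set r1 := rac q K _ _ _ _ _ _ _; set r2 := rac q K _ _ _ _ _ _ _.
set r := rac q K _ _ _ _ _ _ _ => rel; move: d_neq0 => dn.
apply: (mulIf dn); rewrite mulrDl.
transitivity (C * 'i ^+ N0 * (-1) ^+ T2 * (qi q (Q1%:Z + 1 - T2%:Z) * qi q (Q2%:Z + 1 - T2%:Z) * r1 -
   qi q (T3%:Z + 1) * qi q (T4%:Z + 1) * r2)); first by rewrite exprS; field.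
by rewrite rel; ring.
Qed.

End Cases.

Lemma tet_rot a b c d e f : tet a b c d e f = tet b c a e f d.
Proof. by rewrite tet_swap12 tet_swap23. Qed.

Lemma tet_flip23 a b c d e f : tet a b c d e f = tet a e f d b c.
Proof. by rewrite tet_rot tet_flip12 -tet_rot. Qed.

Lemma edge_tetC x s s' t t' : edge_tet x s s' t t' = edge_tet x s' s t' t.
Proof. exact: tet_swap23. Qed.

Lemma edge_tetV x s s' t t' : edge_tet x s s' t t' = edge_tet x t t' s s'.
Proof. by rewrite /edge_tet tet_flip23 tet_swap23. Qed.

Lemma pentagon_summand_adm x1 x2 x3 s1 s2 s3 t2 t3 y :
  pentagon_summand x1 x2 x3 s1 s2 s3 t2 t3 y != 0 ->
  [/\ adm x1 x2 x3, adm x1 t2 t3, adm x2 s1 s3 & adm x3 s1 s2] /\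
  [/\ adm 1 s2 t2, adm 1 s3 t3 & adm 1 s1 y].
Proof.
rewrite /pentagon_summand !mulf_eq0 !negb_or.
case/andP=> /andP[/andP[_ /tet_adm[a1 a2 _ _]] /tet_adm[a3 _ a4 a5]] /tet_adm[a6 _ _ a7].
by do !split=> //; rewrite admS.
Qed.

Lemma pentagon_rhs_adm x1 x2 x3 s1 s2 s3 t2 t3 :
  edge_tet x1 s2 s3 t2 t3 * tet x1 x2 x3 s1 s2 s3 != 0 ->
  [/\ adm x1 x2 x3, adm x1 t2 t3, adm x2 s1 s3 & adm x3 s1 s2] /\
  [/\ adm 1 s2 t2 & adm 1 s3 t3].
Proof.
rewrite mulf_eq0 negb_or => /andP[/tet_adm[a1 a2 a3 a4] /tet_adm[a5 _ a6 a7]].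
split; split=> //; first by rewrite admS.
- by rewrite admC.
- by rewrite admC admS.
by rewrite admS.
Qed.

(** The Biedenharn-Elliott identity with one spin-1/2 edge. Up to the exchange
    of the columns 2 and 3 there are three cases for the signs of t2 - s2 and
    t3 - s3; unless all the triads without the summation color are admissible,
    both sides vanish. *)
Lemma pentagon x1 x2 x3 s1 s2 s3 t2 t3 :
  \sum_(e : bool) pentagon_summand x1 x2 x3 s1 s2 s3 t2 t3 (shift_color e s1)
  = edge_tet x1 s2 s3 t2 t3 * tet x1 x2 x3 s1 s2 s3.
Proof.
pose P := [/\ adm x1 x2 x3, adm x1 t2 t3, adm x2 s1 s3 & adm x3 s1 s2] /\
  [/\ adm 1 s2 t2 & adm 1 s3 t3].
have [p|np] := pselect P; last first.
  rewrite big1 => [|e _]; last first.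
    by apply/eqP; apply/negP => /negP /pentagon_summand_adm[h [a5 a6 _]]; apply: np.
  by symmetry; apply/eqP; apply/negP => /negP /pentagon_rhs_adm.
case: p => -[a1 a2 a3 a4] [a5 a6].
have [T1 [e1 _ _ _]] := adm_half a1; have [T2 [e2 _ _ _]] := adm_half a2.
have [T3 [e3 _ _ _]] := adm_half a3; have [T4 [e4 _ _ _]] := adm_half a4.
have halves : exists T2' Q1 Q2 Q3, [/\ x1 + s2 + s3 = T2' + T2', x1 + x2 + s1 + s2 = Q1 + Q1,
    x1 + x3 + s1 + s3 = Q2 + Q2 & x2 + x3 + s2 + s3 = Q3 + Q3]%N.
  exists (x1 + s2 + s3)./2, (x1 + x2 + s1 + s2)./2, (x1 + x3 + s1 + s3)./2, (x2 + x3 + s2 + s3)./2.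
  case: (adm1P a5) (adm1P a6) => h5 [] h6; clear -e1 e2 e3 e4 h5 h6; split; lia.
case: halves => T2' [Q1 [Q2 [Q3 [f1 f2 f3 f4]]]].
have e3' : (s1 + x2 + s3 = T3 + T3)%N by rewrite -e3 (addnC s1).
have e4' : (s1 + s2 + x3 = T4 + T4)%N by rewrite -e4 addnC addnA.
case: (adm1P a5) (adm1P a6) => h5 [] h6.
- exact: (pentagon_pp e1 f1 e3' e4' f2 f3 f4).
- exact: (pentagon_pm e1 f1 e3' e4' f2 f3 f4).
- have e1' : (x1 + x3 + x2 = T1 + T1)%N by rewrite addnAC.
  have f1' : (x1 + s3 + s2 = T2' + T2')%N by rewrite addnAC.
  have e3'' : (s1 + x3 + s2 = T4 + T4)%N by rewrite addnAC.
  have e4'' : (s1 + s3 + x2 = T3 + T3)%N by rewrite addnAC.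
  have f4' : (x3 + x2 + s3 + s2 = Q3 + Q3)%N by rewrite -f4 addnAC (addnC x3).
  have a1' : adm x1 x3 x2 by rewrite admS.
  have a2' : adm x1 t3 t2 by rewrite admS.
  have := pentagon_pm e1' f1' e3'' e4'' f3 f2 f4' a1' a2' a4 a3 a6 a5 h6 h5.
  rewrite edge_tetC [tet x1 x2 x3 _ _ _]tet_swap23 => <-.
  apply: eq_bigr => e _; rewrite /pentagon_summand.
  by rewrite (tet_swap23 x1 x2 x3) mulrAC.
exact: (pentagon_mm e1 f1 e3' e4' f2 f3 f4).
Qed.

Lemma sum_adm1 B s (f : nat -> R[i]) : (s.+1 < B)%N ->
  (forall y, ~~ adm 1 s y -> f y = 0) ->
  \sum_(y < B) f y = \sum_(e : bool) f (shift_color e s).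
Proof.
move=> sB f0; rewrite big_bool /= (bigD1 (Ordinal sB)) //=; congr (_ + _).
have sB' : (s.-1 < B)%N by apply: leq_ltn_trans sB; apply: leq_trans (leq_pred _) _.
have [s0|s0] := posnP s.
  rewrite big1 ?f0 ?s0 // => y ny; apply: f0; apply: contraNN ny => /adm1P[] ey.
    by apply/eqP/val_inj.
  by rewrite s0 in ey.
rewrite (bigD1 (Ordinal sB')) /=; last by rewrite -val_eqE /= neq_ltn (leq_ltn_trans (leq_pred _)).
rewrite big1 ?addr0 // => y /andP[ny ny']; apply: f0; apply: contraNN ny => /adm1P[] ey.
  by apply/eqP/val_inj.
by case/eqP: ny'; apply: val_inj; rewrite /= ey.
Qed.

Lemma pentagon_nat B x1 x2 x3 s1 s2 s3 t2 t3 : (s1.+1 < B)%N ->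
  \sum_(y < B) pentagon_summand x1 x2 x3 s1 s2 s3 t2 t3 y
  = edge_tet x1 s2 s3 t2 t3 * tet x1 x2 x3 s1 s2 s3.
Proof.
move=> sB; rewrite -pentagon (@sum_adm1 B s1) // => y ny.
by apply/eqP; apply: contraNT ny => /pentagon_summand_adm[_ []].
Qed.

(** Here and in the next two lemmas the strand turns around a corner of a
    face: a, a1 and a', a1' are the colors of the edges of the face before and
    after fusion with the strand, b that of the spoke, t and t1 the states of
    the face on either side of the strand, S0 and S1 the states of the regions
    across the two edges. *)
Lemma corner_close B a a1 b S0 S1 t a' a1' : (t.+1 < B)%N ->
  \sum_(t1 < B) dim t1 * tet a' a1' b S1 S0 t1 * edge_tet S0 a t a' t1 *
     edge_tet S1 a1 t a1' t1
  = edge_tet b a a1 a' a1' * tet a a1 b S1 S0 t.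
Proof.
move=> tB; rewrite [tet a _ _ _ _ _]tet_rot [tet a1 _ _ _ _ _]tet_rot tet_flip23.
rewrite -(pentagon_nat _ _ _ _ _ _ _ tB); apply: eq_bigr => y _.
rewrite /pentagon_summand [tet a' _ _ _ _ _]tet_rot [tet a1' _ _ _ _ _]tet_rot tet_flip23.
by rewrite (edge_tetC S0) (edge_tetC S1) mulrAC.
Qed.

Lemma corner_open B a a1 b S0 S1 t1 a' a1' : (t1.+1 < B)%N ->
  \sum_(t < B) dim t * tet a a1 b S1 S0 t * edge_tet S0 a t a' t1 *
     edge_tet S1 a1 t a1' t1
  = edge_tet b a a1 a' a1' * tet a' a1' b S1 S0 t1.
Proof.
move=> tB; rewrite edge_tetV -(corner_close _ _ _ _ _ _ _ tB).
by apply: eq_bigr => t _; rewrite (edge_tetV S0) (edge_tetV S1).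
Qed.

Lemma corner_step a a1 b S0 S1 t t1 a1' :
  \sum_(e : bool) dim (shift_color e a) * edge_tet b a a1 (shift_color e a) a1' *
     tet (shift_color e a) a1' b S1 S0 t1 * edge_tet S0 a t (shift_color e a) t1
  = edge_tet S1 a1 t a1' t1 * tet a a1 b S1 S0 t.
Proof.
rewrite tet_flip12 -pentagon; apply: eq_bigr => e _; rewrite /pentagon_summand.
by rewrite (tet_flip12 _ _ b); ring.
Qed.

(** A square root of dim, which is what the tetrahedron with an edge of color
    0 in the denominator of V(j) amounts to. *)
Definition nu (a : nat) : R[i] := rt a.+1 A / 'i ^+ a.

Lemma expi_neq0 n : ('i : R[i]) ^+ n != 0.
Proof. by rewrite expf_neq0 // neq0Ci. Qed.

Lemma nu_sqr a : nu a ^+ 2 = dim a.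
Proof.
rewrite /nu exprMn rt_sqr // -exprVn -exprM mulnC exprM exprVn sqrCi invrN1.
by rewrite mulrC.
Qed.

Lemma qfact_root_neq0 n : qfact_root rt A n != 0.
Proof.
rewrite /qfact_root prodf_seq_neq0; apply/allP => j.
by rewrite mem_index_iota => /andP[j0 _]; rewrite rt_neq0.
Qed.

Lemma Delta_neq0 a b c : Delta a b c != 0.
Proof. by rewrite /Delta /Defs.Delta !mulf_neq0 ?invr_eq0 ?qfact_root_neq0. Qed.

Lemma Delta0 a : Delta a a 0 = (rt a.+1 A)^-1.
Proof.
rewrite /Delta /Defs.Delta.
have -> : ((a + a - 0)./2 = a)%N by lia.
have -> : ((a + 0 - a)./2 = 0)%N by lia.
have -> : ((0 + a - a)./2 = 0)%N by lia.
have -> : ((a + a + 0)./2 = a)%N by lia.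
rewrite /qfact_root (@big_nat_recr _ _ _ a.+1) //= [X in _ * X * X]big_geq // mulr1 mulr1.
by rewrite invfM mulrA divff ?mul1r // qfact_root_neq0.
Qed.

Lemma tau0 a a1 b : adm a a1 b -> tau rt A a a1 b a1 a 0 = (nu a * nu a1)^-1.
Proof.
move=> /adm_splitP[u [v [w [ea ea1 eb]]]].
rewrite (@tauE (2 * (a + a1 + b)).+1); last by rewrite ltnS mulnC muln2; lia.
have -> : tet_rac (2 * (a + a1 + b)).+1 a a1 b a1 a 0 =
    (-1) ^+ (u + v + w) * fct q (u + v + w).+1 / (fct q u * fct q v * fct q w).
  rewrite /tet_rac (rac_single _ (k := (u + v + w))); try by rewrite ?inE; lia.
  rewrite /rterm ea ea1 eb.
  have -> : (u + v + w)%:Z - (u + v + (u + w) + (v + w))./2%:Z = 0%N by lia.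
  have -> : (u + v + w)%:Z - (u + v + (u + v) + 0)./2%:Z = w by lia.
  have -> : (u + v + w)%:Z - (u + w + (u + w) + 0)./2%:Z = v by lia.
  have -> : (u + v + w)%:Z - (u + w + (u + v) + (v + w))./2%:Z = 0%N by lia.
  have -> : (u + v + (u + w) + (u + w) + (u + v))./2%:Z - (u + v + w)%:Z = u by lia.
  have -> : (u + v + (v + w) + (u + w) + 0)./2%:Z - (u + v + w)%:Z = 0%N by lia.
  have -> : (u + w + (v + w) + (u + v) + 0)./2%:Z - (u + v + w)%:Z = 0%N by lia.
  rewrite /rfct fct0.
  by field; rewrite !(fct_neq0 qi_neq0).
have D2 : Delta a a1 b ^+ 2 = fct q u * fct q v * fct q w / fct q (u + v + w).+1.
  rewrite Delta_sqr ea ea1 eb.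
  have -> : ((u + v + (u + w) - (v + w))./2 = u)%N by lia.
  have -> : ((u + w + (v + w) - (u + v))./2 = w)%N by lia.
  have -> : ((v + w + (u + v) - (u + w))./2 = v)%N by lia.
  have -> : ((u + v + (u + w) + (v + w))./2 = u + v + w)%N by lia.
  by rewrite /rfct; ring.
rewrite !Delta0 (DeltaC a1 a).
rewrite (@expi_sign _ (a + a1) (u + v + w)); last by rewrite ea ea1 eb; lia.
have n2 : ((-1) ^+ (u + v + w)) ^+ 2 = 1 :> R[i] by rewrite sqrr_sign.
rewrite /nu; transitivity ('i ^+ (a + a1) * ((-1) ^+ (u + v + w)) ^+ 2 * Delta a a1 b ^+ 2 *
   (fct q (u + v + w).+1 / (fct q u * fct q v * fct q w)) * ((rt a.+1 A)^-1 * (rt a1.+1 A)^-1)).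
  by ring.
rewrite n2 D2 exprD; field.
by rewrite !(fct_neq0 qi_neq0) !rt_neq0 ?expi_neq0.
Qed.

Lemma tau_ratioE a a1 b a' a1' :
  adm a a1 b -> adm a' a1' b -> adm 1 a a' -> adm 1 a1 a1' ->
  tau_ratio rt A a a1 b a' a1' = nu a' * nu a1' * edge_tet b a a1 a' a1'.
Proof.
move=> h1 h2 h3 h4; rewrite /tau_ratio tau0 // invrK mulrC; congr (_ * _).
rewrite /edge_tet tet_rot /tet /adm4 h1 /=.
have -> : adm a a' 1 by rewrite admS admC.
have -> : adm a1' a1 1 by rewrite admC admS admC.
by have -> : adm a1' a' b by rewrite admC.
Qed.

(** The factor to be cancelled at each step from (j, k - j) to (j + 1, k - j -
    1) in the change of base region. *)
Lemma edge_tet_neq0 u v : edge_tet (u + v.+1) u v.+1 u.+1 v != 0.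
Proof.
have a1 : adm (u + v.+1) u v.+1 by rewrite /adm; lia.
have a2 : adm (u + v.+1) u.+1 v by rewrite /adm; lia.
pose K := (4 * (u + v + 5))%N.
have eK : (u + v.+1 + u + v.+1 + 2 < K)%N by rewrite /K; lia.
have := half_spin_pm (erefl u.+1) (erefl v.+1) eK a1 a2.
rewrite /edge_tet /tet /adm4 a1 (admS (u + v.+1) v) a2 !adm1S /=.
rewrite (@tauE K); last by rewrite /K; lia.
move=> e; have : Delta (u + v.+1) u.+1 v ^+ 2 * tet_rac K (u + v.+1) u v.+1 1 v u.+1 != 0.
  by rewrite e mulf_neq0 ?signr_eq0 ?qi_neq0.
rewrite mulf_eq0 negb_or => /andP[_ r0].
apply: mulf_neq0; last exact: r0.
apply: mulf_neq0; first exact: expi_neq0.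
by do 3![apply: mulf_neq0; last exact: Delta_neq0]; exact: Delta_neq0.
Qed.

(** * Independence of the base region *)

Section Sweep.
Variables (G : cmap) (poly : trivalent_polyhedron G) (c : edge_t G -> nat).
Implicit Types x y z : dart G.
Let triv := polyhedron_trivalent poly.

Definition corner_weight (s : region_t G -> nat) x : R[i] :=
  tet (c (edge_of x)) (c (edge_of (node G x))) (c (edge_of (node G (node G x))))
    (s (region_of (node G x))) (s (region_of (node G (node G x)))) (s (region_of x)).

Lemma corner_weight_node s x : corner_weight s (node G x) = corner_weight s x.
Proof. by rewrite /corner_weight (node3 triv) [RHS]tet_rot. Qed.

Lemma corner_weight_vertex s x y : vertex_of x = vertex_of y ->
  corner_weight s x = corner_weight s y.
Proof. by case/(vertex_of_eq triv) => ->; rewrite ?corner_weight_node. Qed.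

Lemma corner_weight_ext s s' x :
  (forall y, vertex_of y = vertex_of x -> s (region_of y) = s' (region_of y)) ->
  corner_weight s x = corner_weight s' x.
Proof. by move=> e; rewrite /corner_weight !e ?vertex_of_node. Qed.

Definition edge_weight (s t : region_t G -> nat) x : R[i] :=
  edge_tet (c (edge_of x)) (s (region_of x)) (s (region_of (edge G x)))
    (t (region_of x)) (t (region_of (edge G x))).

Lemma edge_weight_edge s t x : edge_weight s t (edge G x) = edge_weight s t x.
Proof. by rewrite /edge_weight edgeK edge_of_edge edge_tetC. Qed.

Lemma edge_weight_eq s t x y : edge_of x = edge_of y ->
  edge_weight s t x = edge_weight s t y.
Proof. by case/edge_of_eq => ->; rewrite ?edge_weight_edge. Qed.

Lemma edge_weightV s t x : edge_weight s t x = edge_weight t s x.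
Proof. exact: edge_tetV. Qed.

Definition edge_dart (e : edge_t G) : dart G := sval (cid (orbit_of_ex e)).

Lemma edge_dartK (e : edge_t G) : edge_of (edge_dart e) = e.
Proof. exact: (svalP (cid (orbit_of_ex e))). Qed.

Lemma vertex_dartK (v : vertex_t G) : vertex_of (vertex_dart v) = v.
Proof. by apply/eqP; exact: (xchooseP (vertex_dart_ex v)). Qed.

Lemma vertex_product (V : comPzSemiRingType) (f : dart G -> V) x :
  (forall y, vertex_of y = vertex_of x -> f y = f x) ->
  \prod_(v : vertex_t G) f (vertex_dart v) =
  f x * \prod_(v | v != vertex_of x) f (vertex_dart v).
Proof.
move=> fx; rewrite (bigD1 (vertex_of x) isT) /=.
by rewrite (fx _ (vertex_dartK (vertex_of x))).
Qed.

(** Neighboring states differ by at most K, so a bound known at some vertices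
    travels along the paths on which g decreases. It makes the state sums
    finite. *)
Lemma propagate_bound (P : pred (dart G)) (g : dart G -> nat) (K U : nat)
    (f : region_t G -> nat) :
  (forall d d', vertex_of d = vertex_of d' -> P d = P d') ->
  (forall d d', vertex_of d = vertex_of d' -> g d = g d') ->
  (forall x y, P x -> vertex_of y = vertex_of x ->
     (f (region_of x) <= f (region_of y) + K)%N) ->
  (forall x, P x ->
    (exists2 y, vertex_of y = vertex_of x & (f (region_of y) <= U)%N) \/
    (exists2 y, vertex_of y = vertex_of x & P (edge G y) && (g (edge G y) < g x)%N)) ->
  forall x, P x -> (f (region_of x) <= U + K * (g x).+1)%N.
Proof.
move=> P_vertex g_vertex adj rooted x; have [n] := ubnP (g x).
elim: n x => // n IHn x ltn Px; case: (rooted x Px) => -[y eyx].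
  move=> fU; apply: leq_trans (adj _ _ Px eyx) _.
  by rewrite leq_add // mulnS leq_addr.
case/andP=> Py lty; apply: leq_trans (adj _ _ Px eyx) _.
have vf : vertex_of (face G y) = vertex_of (edge G y) by exact: vertex_of_face.
have := IHn (face G y); rewrite (P_vertex _ _ vf) (g_vertex _ _ vf) region_of_face => /(_ _ Py).
have lt1 : (g (edge G y) < n)%N by apply: leq_trans lty _; rewrite -ltnS.
move=> /(_ lt1) h2; apply: (@leq_trans (U + K * (g (edge G y)).+1 + K)%N).
  by rewrite leq_add2r.
by rewrite -addnA leq_add2l addnC -mulnS leq_mul2l ltnS lty orbT.
Qed.

Section Base.
Variables (z0 : dart G) (b : nat).
Local Notation state := {ffun region_t G -> 'I_b.+1}.
Implicit Types (s t : state) (P : pred (dart G)) (u : region_t G -> nat).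

Local Notation base := (base_region z0).

Definition nat_state s : region_t G -> nat := fun r => s r.

(** The factor of a region for the part P of the graph on one side of the
    sweeping line. The base regions, which the line always meets, are pinned
    at u; a region without corner in P is given the state 0, so that each
    configuration is counted once. *)
Definition region_factor u P (r : region_t G) (a : nat) : R[i] :=
  if base r then (a == u r)%:R
  else if [exists x in val r, P x] then dim a else (a == 0%N)%:R.

Definition vertex_factor P s x : R[i] := if P x then corner_weight (nat_state s) x else 1.

Definition half_weight u P s : R[i] :=
  (\prod_r region_factor u P r (s r)) *
  \prod_v vertex_factor P s (vertex_dart v).

(** The edges that the sweeping line crosses; being drawn through infinity,
    the base edge is crossed exactly when its ends are on the same side. *)
Definition cut P x : bool := P x (+) P (edge G x) (+) on_base z0 x.

Definition cut_weight P s t : R[i] :=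
  \prod_(e | cut P (edge_dart e)) edge_weight (nat_state s) (nat_state t) (edge_dart e).

Definition swept_weight P us ut s t : R[i] :=
  half_weight us (predC P) s * half_weight ut P t * cut_weight P s t.

(** The state sum of the graph with a spin-1/2 strand along the sweeping line:
    s is the state before the line and t the state behind it, coupled by the
    tetrahedra of the crossed edges. *)
Definition swept_sum P us ut : R[i] := \sum_s \sum_t swept_weight P us ut s t.

Lemma cutC P x : cut (predC P) x = cut P x.
Proof. by rewrite /cut /=; case: (P x); case: (P _). Qed.

Lemma cut_edge P x : cut P (edge G x) = cut P x.
Proof. by rewrite /cut edgeK on_base_edge [P (edge G x) (+) _]addbC. Qed.

Lemma cut_eq P x y : edge_of x = edge_of y -> cut P x = cut P y.
Proof. by case/edge_of_eq => ->; rewrite ?cut_edge. Qed.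

Lemma predC_predC P : predC (predC P) = P :> pred (dart G).
Proof. by apply/funext => x; rewrite /= negbK. Qed.

(** Turning the sphere upside down exchanges sources and sinks. *)
Lemma swept_sumC P us ut : swept_sum (predC P) ut us = swept_sum P us ut.
Proof.
rewrite /swept_sum exchange_big; apply: eq_bigr => s _; apply: eq_bigr => t _.
rewrite /swept_weight [X in X * _]mulrC; congr (half_weight _ _ _ * _ * _).
  by rewrite predC_predC.
rewrite /cut_weight; apply: eq_big => e; first by rewrite cutC.
by rewrite edge_weightV.
Qed.

Section Step.
Variables (P : pred (dart G)) (x : dart G).
Let y := node G x.
Let z := node G y.
Let rho := region_of x.
Let P' : pred (dart G) := fun d => P d || (vertex_of d == vertex_of x).

Hypothesis P_vertex : forall d d', vertex_of d = vertex_of d' -> P d = P d'.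
Hypothesis x_unswept : ~~ P x.
Hypothesis rho_base : ~~ base rho.
Hypothesis rho_unswept : forall d, region_of d = rho -> ~~ P d.
Hypothesis cut_z : cut P z.

Lemma vertex_y : vertex_of y = vertex_of x. Proof. exact: vertex_of_node. Qed.
Lemma vertex_z : vertex_of z = vertex_of x. Proof. by rewrite !vertex_of_node. Qed.

Lemma region_edge_x : region_of (edge G x) = region_of z.
Proof. exact: region_of_edge triv x. Qed.
Lemma region_edge_y : region_of (edge G y) = rho.
Proof. exact: region_of_edge_node. Qed.
Lemma region_edge_z : region_of (edge G z) = region_of y.
Proof. exact: region_of_edge_node. Qed.

Lemma region_y_neq : region_of y != rho.
Proof. by rewrite -region_edge_y; exact: region_of_edge_neq. Qed.
Lemma region_z_neq : region_of z != rho.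
Proof. by rewrite -region_edge_x eq_sym; exact: region_of_edge_neq. Qed.

Lemma at_x d : vertex_of d = vertex_of x -> [\/ d = x, d = y | d = z].
Proof. exact: vertex_of_eq. Qed.

Lemma unswept_at d : vertex_of d = vertex_of x -> ~~ P d.
Proof. by move=> e; rewrite (P_vertex e). Qed.

Lemma P_face d : P (face G d) = P (edge G d).
Proof. by apply: P_vertex; exact: vertex_of_face. Qed.

Lemma edge_x_unswept : ~~ P (edge G x).
Proof. by rewrite -P_face rho_unswept // region_of_face. Qed.

Lemma edge_y_unswept : ~~ P (edge G y).
Proof. exact/rho_unswept/region_edge_y. Qed.

Lemma x_off_base : ~~ on_base z0 x.
Proof. by apply: contraNN rho_base => /on_base_region. Qed.

Lemma y_off_base : ~~ on_base z0 y.
Proof.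
by apply: contraNN rho_base; rewrite -on_base_edge => /on_base_region; rewrite region_edge_y.
Qed.

Lemma P'_off d : vertex_of d != vertex_of x -> P' d = P d.
Proof. by rewrite /P' => /negbTE ->; rewrite orbF. Qed.

Lemma P'_at d : vertex_of d = vertex_of x -> P' d.
Proof. by rewrite /P' => ->; rewrite eqxx orbT. Qed.

Lemma cut_toggle d : vertex_of d = vertex_of x -> cut P' d = ~~ cut P d.
Proof.
move=> e; rewrite /cut P'_at // (negbTE (unswept_at e)) P'_off ?addNb //.
by rewrite -e (no_loop poly).
Qed.

Lemma cut_x : ~~ cut P x.
Proof. by rewrite /cut (negbTE x_unswept) (negbTE edge_x_unswept) (negbTE x_off_base). Qed.

Lemma cut_y : ~~ cut P y.
Proof.
rewrite /cut (negbTE (unswept_at vertex_y)) (negbTE edge_y_unswept).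
by rewrite (negbTE y_off_base).
Qed.

Lemma off_star d : edge_of d \notin [:: edge_of x; edge_of y; edge_of z] ->
  vertex_of d != vertex_of x.
Proof.
apply: contraNneq => /at_x[] ->; by rewrite !inE eqxx ?orbT.
Qed.

Lemma cut_off d : edge_of d \notin [:: edge_of x; edge_of y; edge_of z] ->
  cut P' d = cut P d.
Proof.
by move=> h; rewrite /cut !P'_off // off_star // edge_of_edge.
Qed.

Lemma star_uniq : uniq [:: edge_of x; edge_of y; edge_of z].
Proof.
have := node_uniq triv x; rewrite -/y -/z /= !inE !negb_or !andbT => /andP[/andP[n1 n2] n3].
have ne (d d' : dart G) : d != d' -> vertex_of d = vertex_of d' -> edge_of d != edge_of d'.
  move=> n e; apply/eqP => /edge_of_eq[ed|ed]; first by rewrite ed eqxx in n.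
  by have := no_loop poly d'; rewrite -ed e eqxx.
by rewrite !ne // ?vertex_y ?vertex_z.
Qed.

Lemma swept_region_off d : P d -> region_of d != rho.
Proof. by apply: contraTneq => e; exact: rho_unswept. Qed.

Lemma swept_edge_region_off d : P (edge G d) -> region_of d != rho.
Proof. by rewrite -P_face => /swept_region_off; rewrite region_of_face. Qed.

Lemma cut_region_off d : cut P d -> region_of d != rho /\ region_of (edge G d) != rho.
Proof.
rewrite /cut; case: (boolP (on_base z0 d)) => [od _|_].
  split; apply: contraNneq rho_base => <-; first exact: on_base_region od.
  by apply: on_base_region; rewrite on_base_edge.
rewrite addbF; case: (boolP (P d)) => [Pd|_] /= h; split.
- exact: swept_region_off.
- by apply: swept_edge_region_off; rewrite edgeK.
- exact: swept_edge_region_off.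
exact: swept_region_off.
Qed.

Lemma unswept_region_factor us r a :
  region_factor us (predC P') r a = region_factor us (predC P) r a.
Proof.
rewrite /region_factor; case: ifP => // /negbT nb; congr (if _ then _ else _).
apply/exists_inP/exists_inP => -[d dr Pd].
  by exists d => //; move: Pd; rewrite /= /P' negb_or => /andP[].
have [dx|dx] := eqVneq (vertex_of d) (vertex_of x); last first.
  by exists d; rewrite //= P'_off.
move: dr; rewrite mem_region => /eqP; case: (at_x dx) => -> <-.
- exists (face G x); first by rewrite mem_region region_of_face.
  by rewrite /= P'_off ?P_face ?edge_x_unswept // vertex_of_face (no_loop poly).
- exists (face G y); first by rewrite mem_region region_of_face.
  by rewrite /= P'_off ?P_face ?edge_y_unswept // vertex_of_face -vertex_y (no_loop poly).
exists (edge G x); first by rewrite mem_region region_edge_x.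
by rewrite /= P'_off ?edge_x_unswept // (no_loop poly).
Qed.

(** A region next to x other than rho lies beside the edge of z, which is
    crossed before x is passed; so the line meets it already, or it is a base
    region. *)
Lemma swept_region_factor ut r a : r != rho ->
  region_factor ut P' r a = region_factor ut P r a.
Proof.
rewrite /region_factor => nr; case: ifP => // /negbT nb; congr (if _ then _ else _).
apply/exists_inP/exists_inP => -[d dr Pd]; last by exists d; rewrite // /P' Pd.
have [dx|dx] := eqVneq (vertex_of d) (vertex_of x); last first.
  by exists d; rewrite // -P'_off.
have Pez : base r = false -> region_of z = r \/ region_of y = r -> P (edge G z).
  move=> nbr hr; move: cut_z; rewrite /cut (negbTE (unswept_at vertex_z)) /=.
  case: (boolP (on_base z0 z)) => [oz|_]; last by rewrite addbF.
  have b1 := on_base_region oz; have b2 : base (region_of (edge G z)).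
    by apply: on_base_region; rewrite on_base_edge.
  by case: hr => hr; move: b1 b2; rewrite region_edge_z hr nbr.
have nb' := negbTE nb.
move: dr; rewrite mem_region => /eqP; case: (at_x dx) => -> er.
- by rewrite -er eqxx in nr.
- exists (edge G z); first by rewrite mem_region region_edge_z er.
  by apply: Pez => //; right.
exists (face G z); first by rewrite mem_region region_of_face er.
by rewrite P_face; apply: Pez => //; left.
Qed.

Lemma rho_factor ut a : region_factor ut P rho a = (a == 0%N)%:R.
Proof.
rewrite /region_factor (negbTE rho_base) ifN //; apply/exists_inP => -[d].
by rewrite mem_region => /eqP /rho_unswept /negP.
Qed.

Lemma rho_factor' ut a : region_factor ut P' rho a = dim a.
Proof.
rewrite /region_factor (negbTE rho_base) ifT //; apply/exists_inP; exists x.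
  by rewrite mem_region.
exact: P'_at.
Qed.

Lemma unswept_half us s :
  half_weight us (predC P) s = corner_weight (nat_state s) x * half_weight us (predC P') s.
Proof.
rewrite /half_weight mulrCA; congr (_ * _).
  by apply: eq_bigr => r _; rewrite unswept_region_factor.
rewrite (vertex_product (x := x)); last first.
  move=> d e; rewrite /vertex_factor /= (P_vertex e).
  by rewrite (corner_weight_vertex _ e).
rewrite (vertex_product (x := x)); last first.
  by move=> d e; rewrite /vertex_factor /= !P'_at.
rewrite {1 3}/vertex_factor /= x_unswept P'_at // mul1r; congr (_ * _).
by apply: eq_bigr => v nv; rewrite /vertex_factor /= P'_off // vertex_dartK.
Qed.

Lemma swept_half ut t k : t rho == ord0 ->
  half_weight ut P' (update t rho k) =
  dim k * corner_weight (nat_state (update t rho k)) x * half_weight ut P t.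
Proof.
move=> /eqP t0; rewrite /half_weight mulrACA; congr (_ * _).
  rewrite (bigD1 rho) //= rho_factor' update_same; congr (_ * _).
  rewrite [RHS](bigD1 rho) //= rho_factor t0 eqxx mul1r.
  by apply: eq_bigr => r nr; rewrite swept_region_factor // update_other.
rewrite (vertex_product (x := x)); last first.
  move=> d e; rewrite /vertex_factor !P'_at //.
  by rewrite (corner_weight_vertex _ e).
rewrite [X in _ = _ * X](vertex_product (x := x)); last first.
  by move=> d e; rewrite /vertex_factor (P_vertex e) (negbTE x_unswept).
rewrite {1 3}/vertex_factor P'_at // (negbTE x_unswept) mul1r; congr (_ * _).
apply: eq_bigr => v nv; rewrite /vertex_factor P'_off ?vertex_dartK //.
case: ifP => // Pv; apply: corner_weight_ext => d e.
rewrite /nat_state update_other // swept_region_off //.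
by rewrite (P_vertex e).
Qed.

Let common_weight s t : R[i] :=
  \prod_(e | cut P (edge_dart e) && (e != edge_of z))
    edge_weight (nat_state s) (nat_state t) (edge_dart e).

Lemma cut_dart (Q : pred (dart G)) d : cut Q (edge_dart (edge_of d)) = cut Q d.
Proof. by apply: cut_eq; exact: edge_dartK. Qed.

Lemma edge_weight_dart (f g : region_t G -> nat) d :
  edge_weight f g (edge_dart (edge_of d)) = edge_weight f g d.
Proof. by apply: edge_weight_eq; exact: edge_dartK. Qed.

Lemma cut_weight_before s t : cut_weight P s t =
  edge_weight (nat_state s) (nat_state t) z * common_weight s t.
Proof.
rewrite /cut_weight (bigD1 (edge_of z)) /=; last by rewrite cut_dart.
by rewrite edge_weight_dart.
Qed.

Lemma cut_weight_after s t k : cut_weight P' s (update t rho k) =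
  edge_weight (nat_state s) (nat_state (update t rho k)) x *
  edge_weight (nat_state s) (nat_state (update t rho k)) y * common_weight s t.
Proof.
have := star_uniq; rewrite /= !inE negb_or andbT => /andP[/andP[nxy nxz] nyz].
have cx' : cut P' x by rewrite cut_toggle // cut_x.
have cy' : cut P' y by rewrite cut_toggle ?cut_y //; exact: vertex_y.
have cz' : cut P' z = false by rewrite cut_toggle ?cut_z //; exact: vertex_z.
rewrite /cut_weight (bigD1 (edge_of x)) /=; last by rewrite cut_dart.
rewrite (bigD1 (edge_of y)) /=; last by rewrite cut_dart cy' eq_sym.
rewrite !edge_weight_dart -!mulrA; congr (_ * (_ * _)).
apply: eq_big => [e|e /andP[/andP[ce nx] ny]].
  have [he|he] := boolP (e \in [:: edge_of x; edge_of y; edge_of z]); last first.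
    rewrite cut_off; last by rewrite edge_dartK.
    move: he; rewrite !inE !negb_or => /and3P[h1 h2 h3].
    by rewrite h1 h2 h3 !andbT.
  move: he; rewrite !inE => /or3P[] /eqP -> {e}.
  - by rewrite !cut_dart eqxx andbF /= (negbTE cut_x).
  - by rewrite !cut_dart eqxx andbF (negbTE cut_y).
  by rewrite !cut_dart eqxx andbF cz'.
have nz : e != edge_of z by apply: contraTneq ce => ->; rewrite cut_dart cz'.
have off : edge_of (edge_dart e) \notin [:: edge_of x; edge_of y; edge_of z].
  by rewrite edge_dartK !inE !negb_or nx ny nz.
rewrite (cut_off off) in ce; have [r1 r2] := cut_region_off ce.
by rewrite /edge_weight /nat_state !update_other.
Qed.

Lemma step_pentagon s t : (s rho < b)%N ->
  \sum_(k < b.+1) dim k * corner_weight (nat_state (update t rho k)) x *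
    (edge_weight (nat_state s) (nat_state (update t rho k)) x *
     edge_weight (nat_state s) (nat_state (update t rho k)) y)
  = edge_weight (nat_state s) (nat_state t) z * corner_weight (nat_state s) x.
Proof.
move=> sb; rewrite [corner_weight _ _]tet_rot tet_rot /edge_weight region_edge_z edge_tetC.
rewrite -(pentagon_nat _ _ _ _ _ _ _ (sb : (nat_state s rho).+1 < b.+1)%N).
apply: eq_bigr => k _; rewrite /pentagon_summand.
rewrite [corner_weight _ _]tet_rot tet_rot region_edge_x region_edge_y.
rewrite [X in _ * (_ * X)]edge_tetC /nat_state !update_same.
by rewrite !update_other ?region_y_neq ?region_z_neq // mulrA.
Qed.

(** At a source x the crossed edge of z splits into the edges of x and y, and
    the region rho between them opens up. The state of rho behind the line,
    which was frozen at 0, becomes a summation variable, and the sum over it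
    is that of the pentagon identity. *)
Lemma swept_step us ut :
  (forall s, half_weight us (predC P) s != 0 -> (s rho < b)%N) ->
  (forall s, half_weight us (predC P') s != 0 -> (s rho < b)%N) ->
  swept_sum P us ut = swept_sum P' us ut.
Proof.
move=> bP bP'; rewrite /swept_sum; apply: eq_bigr => s _.
rewrite (sum_update (i := rho) ord0) // [RHS](sum_update (i := rho) ord0) //.
apply: eq_bigr => t /= t0.
have [sb|sb] := ltnP (s rho) b; last first.
  have h0 : half_weight us (predC P) s = 0.
    by apply/eqP; apply: contraTT sb => /bP; rewrite ltnNge.
  have h0' : half_weight us (predC P') s = 0.
    by apply/eqP; apply: contraTT sb => /bP'; rewrite ltnNge.
  rewrite !big1 // => k _; rewrite /swept_weight ?h0 ?h0' !mul0r //.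
rewrite (bigD1 ord0) //= [X in _ + X]big1 ?addr0 => [|k k0]; last first.
  rewrite /swept_weight /half_weight [X in _ * (X * _)](bigD1 rho) //= rho_factor update_same.
  by rewrite -val_eqE /= in k0; rewrite (negbTE k0) !(mul0r, mulr0).
rewrite -[X in update _ _ X](eqP t0) update_id.
pose W := half_weight us (predC P') s * half_weight ut P t * common_weight s t.
transitivity (W * (edge_weight (nat_state s) (nat_state t) z * corner_weight (nat_state s) x)).
  by rewrite /swept_weight unswept_half cut_weight_before /W; ring.
rewrite -(step_pentagon _ sb) mulr_sumr; apply: eq_bigr => k _.
by rewrite /swept_weight swept_half // cut_weight_after /W; ring.
Qed.

End Step.

Section Bound.
Variables (P : pred (dart G)) (g : dart G -> nat) (K U : nat) (u : region_t G -> nat).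
Hypothesis P_vertex : forall d d', vertex_of d = vertex_of d' -> P d = P d'.
Hypothesis g_vertex : forall d d', vertex_of d = vertex_of d' -> g d = g d'.
Hypothesis leK : forall e, (c e <= K)%N.
Hypothesis leU : forall r, base r -> (u r <= U)%N.
Hypothesis rooted : forall x, P x ->
  (exists2 y, vertex_of y = vertex_of x & base (region_of y)) \/
  (exists2 y, vertex_of y = vertex_of x & P (edge G y) && (g (edge G y) < g x)%N).

Lemma corner_weight_bound (f : region_t G -> nat) x y : corner_weight f x != 0 ->
  vertex_of y = vertex_of x -> (f (region_of y) <= f (region_of x) + K)%N /\
  (f (region_of x) <= f (region_of y) + K)%N.
Proof.
case/tet_adm => _ h1 h2 _ /(vertex_of_eq triv) ey.
have := leK (edge_of x); have := leK (edge_of (node G x)).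
by case: ey => ->; move: h1 h2; rewrite /adm; clear; lia.
Qed.

Lemma half_weight_bound s : half_weight u P s != 0 ->
  forall x, P x -> (s (region_of x) <= U + K * (g x).+1)%N.
Proof.
rewrite mulf_eq0 negb_or => /andP[/prodf_neq0 hr /prodf_neq0 hv].
have hw x : P x -> corner_weight (nat_state s) x != 0.
  move=> Px; have := hv (vertex_of x) isT; rewrite /vertex_factor.
  rewrite (P_vertex (vertex_dartK (vertex_of x))) Px.
  by rewrite (corner_weight_vertex _ (vertex_dartK (vertex_of x))).
apply: (propagate_bound (f := nat_state s) P_vertex g_vertex) => [x y Px exy|x Px].
  by have [_] := corner_weight_bound (hw x Px) exy.
case: (rooted Px) => -[y eyx]; [move=> by_; left|by right; exists y].
exists y => //; have := hr (region_of y) isT; rewrite /region_factor by_.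
case: (nat_of_ord (s (region_of y)) =P u (region_of y)) => [e _|_]; last by rewrite eqxx.
by rewrite /nat_state e leU.
Qed.

End Bound.

Section Order.
Variable h : dart G -> nat.
Hypothesis ord : sweep_order z0 h.
Variables (K U : nat).
Hypothesis leK : forall e, (c e <= K)%N.
Let n := #|{: vertex_t G}|.
Hypothesis leb : (U + K * n.+1 < b)%N.

Let swept k : pred (dart G) := fun x => (h x < k)%N.

Lemma h_vertex d d' : vertex_of d = vertex_of d' -> h d = h d'.
Proof. by move=> e; apply: (sweep_vertex poly ord e). Qed.

Lemma swept_vertex k d d' : vertex_of d = vertex_of d' -> swept k d = swept k d'.
Proof. by move/h_vertex; rewrite /swept => ->. Qed.

Lemma unswept_bound u k s x : (forall r, base r -> (u r <= U)%N) ->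
  half_weight u (predC (swept k)) s != 0 -> ~~ swept k x -> (s (region_of x) < b)%N.
Proof.
move=> leU hs Px; apply: leq_ltn_trans leb.
apply: leq_trans (half_weight_bound (g := fun x => (n - h x)%N) (K := K) _ _ leK leU _ hs Px) _.
- by move=> d d' e; rewrite /= (swept_vertex k e).
- by move=> d d' /h_vertex ->.
- move=> d /= Pd; have [e|ne] := eqVneq (vertex_of d) (vertex_of (edge G z0)).
    by left; exists (edge G z0); rewrite // /base_region eqxx orbT.
  right; have [y e lt] := sweep_up ord ne; exists y; rewrite // /swept -!leqNgt.
  move: Pd; rewrite /swept -leqNgt -(h_vertex e) => kd.
  rewrite (leq_trans kd (ltnW lt)) /= ltn_sub2l //.
  exact: leq_trans lt (ltnW (sweep_ltn ord _)).
by rewrite leq_add2l leq_mul2l ltnS leq_subr orbT.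
Qed.

Lemma swept_bound u k s x : (forall r, base r -> (u r <= U)%N) ->
  half_weight u (swept k) s != 0 -> swept k x -> (s (region_of x) < b)%N.
Proof.
move=> leU hs Px; apply: leq_ltn_trans leb.
apply: leq_trans (half_weight_bound (g := h) (K := K) _ _ leK leU _ hs Px) _.
- exact: swept_vertex.
- exact: h_vertex.
- move=> d /= Pd; have [e|ne] := eqVneq (vertex_of d) (vertex_of z0).
    by left; exists z0; rewrite // /base_region eqxx.
  right; have [y e lt] := sweep_down ord ne; exists y => //.
  by move: Pd; rewrite /swept -(h_vertex e) => /(ltn_trans lt) ->.
by rewrite leq_add2l leq_mul2l ltnS ltnW ?orbT // (sweep_ltn ord).
Qed.

Lemma sweep_vertexE d d' : (vertex_of d == vertex_of d') = (h d == h d').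
Proof. by apply/eqP/eqP => [/h_vertex|/(sweep_inj ord)]. Qed.

(** A source is passed upwards by swept_step, a sink is passed downwards by
    the same lemma after exchanging the two sides of the line. *)
Lemma swept_sumS k us ut : (forall r, base r -> (us r <= U)%N) ->
  (forall r, base r -> (ut r <= U)%N) ->
  swept_sum (swept k) us ut = swept_sum (swept k.+1) us ut.
Proof.
move=> leus leut; have [/existsP[x0 /eqP hx0]|none] := boolP [exists x, h x == k]; last first.
  congr swept_sum; apply/funext => x; rewrite /swept ltnS [RHS]leq_eqVlt.
  by move: none; rewrite negb_exists => /forallP/(_ x)/negbTE ->.
have [y eyx ext] := corner_ex poly ord x0.
have hy : h y = k by rewrite (h_vertex eyx).
have hz : h (node G (node G y)) = k by rewrite !(sweep_node ord).
have hf : h (face G y) != k.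
  by rewrite -hy (h_vertex (vertex_of_face y)) (sweep_edge_neq poly ord).
have SS d : swept k.+1 d = swept k d || (vertex_of d == vertex_of y).
  by rewrite /swept ltnS leq_eqVlt sweep_vertexE hy orbC.
have rf : region_of (face G y) = region_of y by exact: region_of_face.
case/orP: ext => /andP[ext uz].
  have [nb low] := source_region poly ord ext.
  have lf : (k < h (face G y))%N by rewrite ltn_neqAle eq_sym hf -hy low.
  have eS : (fun d => swept k d || (vertex_of d == vertex_of y)) = swept k.+1.
    by apply/funext => d; rewrite SS.
  rewrite (@swept_step (swept k) y (@swept_vertex k)) ?eS //.
  - by rewrite /swept hy ltnn.
  - by move=> d /low; rewrite /swept hy -leqNgt.
  - move: uz; rewrite /up /cut /swept hz ltnn /=.
    have := sweep_edge_neq poly ord (node G (node G y)); rewrite hz.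
    by case: ltngtP; case: on_base.
  - by move=> s hs; apply: unswept_bound hs _; rewrite // /swept hy ltnn.
  - by move=> s hs; rewrite -rf; apply: unswept_bound hs _; rewrite // /swept -leqNgt.
have [nb high] := sink_region poly ord ext.
have lf : (h (face G y) < k)%N by rewrite ltn_neqAle hf -hy high.
have eS : (fun d => predC (swept k.+1) d || (vertex_of d == vertex_of y)) = predC (swept k).
  apply/funext => d /=; rewrite SS negb_or.
  case: (boolP (_ == _)) => [/eqP/h_vertex|]; rewrite /swept ?orbF ?andbT // hy => ->.
  by rewrite ltnn.
rewrite -swept_sumC -[RHS]swept_sumC -eS; symmetry.
apply: (@swept_step (predC (swept k.+1)) y) => //.
- by move=> d d' e /=; rewrite (swept_vertex k.+1 e).
- by rewrite /= /swept hy ltnSn.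
- by move=> d /high; rewrite /= /swept hy ltnS negbK.
- rewrite cutC; move: uz; rewrite /up /cut /swept hz ltnSn ltnS /=.
  have := sweep_edge_neq poly ord (node G (node G y)); rewrite hz.
  by case: ltngtP; case: on_base.
- by move=> s; rewrite predC_predC => hs; apply: swept_bound hs _; rewrite // /swept hy.
by move=> s; rewrite eS predC_predC => hs; rewrite -rf; apply: swept_bound hs _.
Qed.

Definition pinned_sum u : R[i] := \sum_s half_weight u predT s.

Lemma half_weight_base u P s r : half_weight u P s != 0 -> base r -> nat_of_ord (s r) = u r.
Proof.
rewrite mulf_eq0 negb_or => /andP[/prodf_neq0 /(_ r isT) + _] br.
by rewrite /region_factor br; case: (_ =P u r) => //; rewrite eqxx.
Qed.

(** At the start the line crosses the base edge only, and the state behind it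
    is pinned or frozen everywhere. *)
Lemma swept_sum0 us ut : (forall r, base r -> (ut r <= U)%N) ->
  swept_sum (swept 0) us ut = pinned_sum us *
    edge_tet (c (edge_of z0)) (us (region_of z0)) (us (region_of (edge G z0)))
      (ut (region_of z0)) (ut (region_of (edge G z0))).
Proof.
move=> leut; have -> : swept 0 = pred0 by apply/funext => x; rewrite /swept ltn0.
have leU r : base r -> (ut r < b.+1)%N.
  move=> br; apply: leq_ltn_trans (leut r br) _.
  apply: leq_trans (leq_trans leb (leqnSn b)).
  by rewrite ltnS leq_addr.
pose t0 : state := [ffun r => if base r then inord (ut r) else ord0].
have t0E r : base r -> nat_of_ord (t0 r) = ut r by move=> br; rewrite ffunE br inordK // leU.
rewrite /swept_sum /pinned_sum mulr_suml; apply: eq_bigr => s _.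
rewrite (bigD1 t0) //= [X in _ + X]big1 ?addr0 => [|t nt]; last first.
  have [r nr] : exists r, t r != t0 r.
    by apply/existsP; apply: contraNT nt => /existsPn e; apply/eqP/ffunP => r; apply/eqP/negPn.
  rewrite /swept_weight /half_weight [X in _ * (X * _)](bigD1 r) //= /region_factor.
  have -> : [exists x in val r, pred0 x] = false by apply/exists_inP => -[].
  move: nr; rewrite -val_eqE /= ffunE; case: ifP => br; rewrite ?inordK ?leU // => /negbTE ->.
    by rewrite !(mul0r, mulr0).
  by rewrite !(mul0r, mulr0).
have hT : (predC pred0 : pred (dart G)) = predT by apply/funext.
have h0 : half_weight ut pred0 t0 = 1.
  rewrite /half_weight !big1 ?mulr1 // => r _; rewrite /region_factor.
  have -> : [exists x in val r, pred0 x] = false by apply/exists_inP => -[].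
  by case: ifP => br; rewrite ?(t0E _ br) ?ffunE ?br eqxx.
rewrite /swept_weight h0 mulr1 hT.
have -> : cut_weight pred0 s t0 = edge_weight (nat_state s) (nat_state t0) z0.
  rewrite /cut_weight (big_pred1 (edge_of z0)) => [|e]; first by rewrite edge_weight_dart.
  rewrite /cut /= /on_base; apply/orP/eqP => [[]/eqP ee|->].
  - by rewrite -(edge_dartK e) ee.
  - by rewrite -(edge_dartK e) ee edge_of_edge.
  have /edge_of_eq[->|->] : edge_of (edge_dart (edge_of z0)) = edge_of z0 by exact: edge_dartK.
    by left.
  by right.
have [->|hs] := eqVneq (half_weight us predT s) 0; first by rewrite !mul0r.
have b1 : base (region_of z0) by rewrite /base_region eqxx.
have b2 : base (region_of (edge G z0)) by rewrite /base_region eqxx orbT.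
by rewrite /edge_weight /nat_state !t0E // !(half_weight_base hs).
Qed.

(** The line crosses nothing but the base edge both at the start and at the
    end of the sweep, and the tetrahedron of this edge is the same at both
    times. *)
Lemma pinned_sum_eq us ut : (forall r, base r -> (us r <= U)%N) ->
  (forall r, base r -> (ut r <= U)%N) ->
  edge_tet (c (edge_of z0)) (us (region_of z0)) (us (region_of (edge G z0)))
      (ut (region_of z0)) (ut (region_of (edge G z0))) != 0 ->
  pinned_sum us = pinned_sum ut.
Proof.
move=> leus leut nz; apply: (mulIf nz); rewrite -swept_sum0 //.
have all k : swept_sum (swept 0) us ut = swept_sum (swept k) us ut.
  by elim: k => // k ->; exact: swept_sumS.
rewrite (all n) -swept_sumC edge_tetV -swept_sum0 //; congr swept_sum.
by apply/funext => x; rewrite /= /swept ltn0 (sweep_ltn ord).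
Qed.

Definition base_values (i j : nat) (r : region_t G) : nat :=
  if r == region_of z0 then i else j.

(** The states of the base regions pass from (0, k) to (k, 0) through the
    pairs (j, k - j), all admissible with the color k of the base edge. *)
Lemma pinned_sum_walk : (c (edge_of z0) <= U)%N ->
  pinned_sum (base_values 0 (c (edge_of z0))) = pinned_sum (base_values (c (edge_of z0)) 0).
Proof.
set k := c _ => kU; suff walk j : (j <= k)%N ->
    pinned_sum (base_values 0 k) = pinned_sum (base_values j (k - j)).
  by rewrite (walk k) // subnn.
elim: j => [|j IHj] jk; first by rewrite subn0.
have leB (i l : nat) r : (i <= U)%N -> (l <= U)%N -> (base_values i l r <= U)%N.
  by rewrite /base_values; case: ifP.
rewrite (IHj (ltnW jk)); apply: pinned_sum_eq => [r _|r _|].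
- by apply: leB; [exact: leq_trans (ltnW jk) kU|exact: leq_trans (leq_subr _ _) kU].
- by apply: leB; [exact: leq_trans jk kU|exact: leq_trans (leq_subr _ _) kU].
rewrite /base_values !eqxx [region_of (edge G z0) == _]eq_sym (negbTE (region_of_edge_neq poly z0)).
have := edge_tet_neq0 j (k - j.+1).
by rewrite subnSK // subnKC // ltnW.
Qed.

End Order.

End Base.

End Sweep.

Section Bracket.
Variables (G : cmap) (poly : trivalent_polyhedron G).
Implicit Types (x y z : dart G) (c : edge_t G -> nat).
Let triv := polyhedron_trivalent poly.

Definition state_weight c (f : region_t G -> nat) : R[i] :=
  (\prod_r dim (f r)) * \prod_v corner_weight c f (vertex_dart v).

Definition shadow c (f : region_t G -> nat) : Prop :=
  forall x, adm (f (region_of x)) (f (region_of (edge G x))) (c (edge_of x)).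

Lemma corner_adm c f x : corner_weight c f x != 0 ->
  [/\ adm (f (region_of x)) (f (region_of (edge G x))) (c (edge_of x)) &
      adm (c (edge_of x)) (c (edge_of (node G x))) (c (edge_of (node G (node G x))))].
Proof.
case/tet_adm => h1 h2 _ _; split=> //.
by rewrite (region_of_edge triv) admC admS admC.
Qed.

Lemma state_weight_corner c f x : state_weight c f != 0 -> corner_weight c f x != 0.
Proof.
rewrite mulf_eq0 negb_or => /andP[_ /prodf_neq0/(_ (vertex_of x) isT)].
by rewrite (corner_weight_vertex poly _ _ (vertex_dartK (vertex_of x))).
Qed.

Lemma state_weight_shadow c f : state_weight c f != 0 -> shadow c f /\ adm_coloring c.
Proof.
move=> nz; split=> x; by case: (corner_adm (state_weight_corner x nz)).
Qed.

Lemma corner_weightE c f x : adm_coloring c -> shadow c f ->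
  corner_weight c f x = tau rt A (c (edge_of x)) (c (edge_of (node G x)))
    (c (edge_of (node G (node G x)))) (f (region_of (node G x)))
    (f (region_of (node G (node G x)))) (f (region_of x)).
Proof.
move=> ac sh; rewrite /corner_weight /tet /adm4 (ac x) /=.
have := sh x; rewrite (region_of_edge triv) => h1.
have := sh (node G x); rewrite region_of_edge_node => h2.
have := sh (node G (node G x)); rewrite region_of_edge_node => h3.
have -> : adm (c (edge_of x)) (f (region_of (node G (node G x)))) (f (region_of x)).
  by rewrite admC admS admC.
have -> : adm (f (region_of (node G x))) (c (edge_of (node G x))) (f (region_of x)).
  by rewrite admS.
by rewrite admC h3.
Qed.

Lemma shadow_bound c K f x0 : (forall e, (c e <= K)%N) -> shadow c f ->
  f (region_of x0) = 0%N -> forall r, (f r <= K * #|{: vertex_t G}|.+1)%N.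
Proof.
move=> leK sh f0 r; have [x <-] := orbit_of_ex r.
have [h ord] := sweep_order_ex poly x0.
have hv d d' : vertex_of d = vertex_of d' -> h d = h d'.
  by move=> e; exact: (sweep_vertex poly ord e).
apply: (@leq_trans (0 + K * (h x).+1)%N); last first.
  by rewrite add0n leq_mul2l ltnS ltnW ?orbT // (sweep_ltn ord).
apply: (propagate_bound (P := predT) (f := f)) => // [d d' _|d _].
  have step d1 d2 : (d2 = edge G d1) -> (f (region_of d1) <= f (region_of d2) + K)%N.
    by move=> ->; have := sh d1; have := leK (edge_of d1); rewrite /adm; clear; lia.
  have stepV d1 d2 : (d2 = edge G d1) -> (f (region_of d2) <= f (region_of d1) + K)%N.
    by move=> e; apply: step; rewrite e edgeK.
  case/(vertex_of_eq triv) => ->; first exact: leq_addr.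
    by rewrite -[region_of d]region_of_edge_node; exact: stepV.
  by rewrite -(region_of_edge triv); exact: step.
have [e|ne] := eqVneq (vertex_of d) (vertex_of x0).
  by left; exists x0; rewrite ?f0.
by right; have [y e lt] := sweep_down ord ne; exists y; rewrite // -(hv _ _ e).
Qed.

Section Finite.
Variables (c : edge_t G -> nat) (K b : nat).
Hypotheses (leK : forall e, (c e <= K)%N) (ac : adm_coloring c).
Hypothesis leb : (K * #|{: vertex_t G}|.+1 <= b)%N.
Local Notation state := {ffun region_t G -> 'I_b.+1}.
Implicit Type s : state.

(** Shadow-states are bounded because the graph is connected, so the sum may
    be taken over a finite range of states; there all functions may be
    allowed, as those which are not shadow-states have weight 0. *)
Lemma bracketE r0 : bracket rt A r0 c =
  \sum_(s : state | s r0 == ord0) state_weight c (nat_state s).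
Proof.
pose nf s : {ffun region_t G -> nat} := [ffun r => nat_of_ord (s r)].
have nfE s : (nf s : region_t G -> nat) =1 nat_state s by move=> r; rewrite ffunE.
have nf_inj : injective nf.
  by move=> s s' /ffunP e; apply/ffunP => r; apply/val_inj; have := e r; rewrite !ffunE.
pose W (f : {ffun region_t G -> nat}) := if f r0 == 0%N then state_weight c f else 0.
rewrite /bracket (eq_fsbigr W) => [|f]; last first.
  rewrite inE => -[f0 sh]; rewrite /W f0 eqxx /state_weight; congr (_ * _).
  apply: eq_bigr => v _; rewrite corner_weightE //.
rewrite (fsbig_fwiden [seq nf s | s <- enum {: state}]) /=; first last.
- move=> f [_ nsh]; rewrite /= /W; case: eqP => // f0; apply/eqP; apply/negPn/negP.
  by move/state_weight_shadow => [sh _]; apply: nsh.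
- by rewrite map_inj_uniq ?enum_uniq.
- move=> f [f0 sh] /=; have [x0 e0] := orbit_of_ex r0.
  have bd r : (f r < b.+1)%N.
    by rewrite ltnS; apply: leq_trans leb; apply: (shadow_bound (x0 := x0)) => //; rewrite -f0 -e0.
  apply/mapP; exists [ffun r => Ordinal (bd r)]; first by rewrite mem_enum.
  by apply/ffunP => r; rewrite !ffunE.
rewrite big_map big_enum /= [RHS]big_mkcond; apply: eq_bigr => s _.
rewrite /W nfE /nat_state -val_eqE /=; case: ifP => // _; congr state_weight.
by apply/funext => r; rewrite ffunE.
Qed.

Lemma sum_pinned z0 u :
  \sum_(s : state | (nat_of_ord (s (region_of z0)) == u (region_of z0)) &&
       (nat_of_ord (s (region_of (edge G z0))) == u (region_of (edge G z0))))
     state_weight c (nat_state s) =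
  dim (u (region_of z0)) * dim (u (region_of (edge G z0))) * pinned_sum c z0 b u.
Proof.
rewrite /pinned_sum mulr_sumr big_mkcond /=; apply: eq_bigr => s _.
have ne : region_of (edge G z0) != region_of z0 by rewrite eq_sym (region_of_edge_neq poly).
have b1 : base_region z0 (region_of z0) by rewrite /base_region eqxx.
have b2 : base_region z0 (region_of (edge G z0)) by rewrite /base_region eqxx orbT.
have [h0|hs] := eqVneq (half_weight c z0 u predT s) 0; last first.
  have e1 := half_weight_base hs b1; have e2 := half_weight_base hs b2.
  rewrite e1 e2 !eqxx /= /state_weight /half_weight mulrA; congr (_ * _).
  rewrite (bigD1 (region_of z0)) //= (bigD1 (region_of (edge G z0))) //= mulrA.
  rewrite /nat_state e1 e2; congr (_ * _).
  rewrite [RHS](bigD1 (region_of z0)) //= [in RHS](bigD1 (region_of (edge G z0))) //=.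
  rewrite /region_factor b1 b2 e1 e2 !eqxx !mul1r; apply: eq_bigr => r /andP[n1 n2].
  rewrite /base_region (negbTE n1) (negbTE n2) /= ifT //.
  by have [d <-] := orbit_of_ex r; apply/exists_inP; exists d; rewrite ?orbit_of_mem.
rewrite h0 mulr0; case: ifP => // /andP[/eqP e1 /eqP e2].
move/eqP: h0; rewrite mulf_eq0 => /orP[/prodf_eq0[r _]|h0].
  rewrite /region_factor /base_region; case: ifP => [|_].
    by case/orP=> /eqP ->; rewrite ?e1 ?e2 eqxx oner_eq0.
  rewrite ifT => [/eqP z|]; last first.
    by have [d <-] := orbit_of_ex r; apply/exists_inP; exists d; rewrite ?orbit_of_mem.
  by rewrite /state_weight (bigD1 r) //= /nat_state z !mul0r.
by rewrite /state_weight; move/eqP: h0 => h0; rewrite [X in _ * X](_ : _ = 0) ?mulr0.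
Qed.

End Finite.

(** When one side of an edge of color k has state 0, the other side has state
    k by admissibility. So both brackets are pinned sums, at (0, k) and (k,
    0), with the same dimension factors. *)
Lemma bracket_adjacent c z0 : adm_coloring c ->
  bracket rt A (region_of z0) c = bracket rt A (region_of (edge G z0)) c.
Proof.
move=> ac; have [K leK] : exists K, forall e, (c e <= K)%N.
  by exists (\max_e c e)%N => e; exact: leq_bigmax.
pose b := (K + K * #|{: vertex_t G}|.+1).+1.
have leb : (K * #|{: vertex_t G}|.+1 <= b)%N by rewrite /b ltnW // ltnS leq_addl.
rewrite !(bracketE leK ac leb).
have ne : (region_of (edge G z0) == region_of z0) = false.
  by rewrite eq_sym; apply/negbTE; exact: region_of_edge_neq poly z0.
have [h ord] := sweep_order_ex poly z0.
have lt : (K + K * #|{: vertex_t G}|.+1 < b)%N by [].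
have walk := pinned_sum_walk poly ord leK lt (leK (edge_of z0)).
set k := c (edge_of z0) in walk.
have lhs := sum_pinned c b z0 (base_values z0 0 k).
have rhs := sum_pinned c b z0 (base_values z0 k 0).
rewrite /base_values !eqxx ne in lhs rhs.
have sh (s : {ffun region_t G -> 'I_b.+1}) : state_weight c (nat_state s) != 0 ->
    adm (s (region_of z0)) (s (region_of (edge G z0))) k.
  by case/state_weight_shadow => + _; exact.
transitivity (dim 0 * dim k * pinned_sum c z0 b (base_values z0 k 0)).
  rewrite -walk -lhs (bigID (fun s : {ffun region_t G -> 'I_b.+1} =>
    nat_of_ord (s (region_of (edge G z0))) == k)) /=.
  rewrite [X in _ + X]big1 ?addr0 // => s /andP[/eqP s0 nk].
  apply/eqP; apply: contraNT nk => /sh; rewrite s0 /adm /=; clear; lia.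
rewrite [dim 0 * _]mulrC -rhs [RHS](bigID (fun s : {ffun region_t G -> 'I_b.+1} =>
  nat_of_ord (s (region_of z0)) == k)) /= [X in _ = _ + X]big1 ?addr0.
  by apply: eq_bigl => s; rewrite andbC.
move=> s /andP[/eqP s0 nk].
by apply/eqP; apply: contraNT nk => /sh; rewrite s0 /adm /=; clear; lia.
Qed.

End Bracket.

(** * The recursion around a face *)

Section Transport.
Variables (a b S : nat -> nat) (u0 : bool) (B t1 : nat).
Hypothesis t1B : (t1.+1 < B)%N.
Let a' j e := shift_color e (a j).

Definition corner_term j e e' : R[i] :=
  nu (a' j e) * nu (a' j.+1 e') * edge_tet (b j) (a j) (a j.+1) (a' j e) (a' j.+1 e') *
  tet (a' j e) (a' j.+1 e') (b j) (S j.+1) (S j) t1.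

Let link j e t := edge_tet (S j) (a j) t (a' j e) t1.

(** The first corner opens a new state t of the face by corner_open, and each
    further corner passes by corner_step; the strand then ends at the edges 0
    and k + 1. *)
Lemma chain_transport k e : chain corner_term u0 k.+1 e =
  nu (a' 0 u0) * nu (a' k.+1 e) *
  \sum_(t < B) dim t * link 0 u0 t * link k.+1 e t *
     \prod_(0 <= j < k.+1) tet (a j) (a j.+1) (b j) (S j.+1) (S j) t.
Proof.
elim: k e => [|k IHk] e.
  have -> : chain corner_term u0 1 e = corner_term 0 u0 e.
    by rewrite /= big_bool; case: u0 => /=; rewrite !(mul0r, mul1r, addr0, add0r).
  rewrite /corner_term -[LHS]mulrA; congr (_ * _).
  rewrite -(corner_open _ _ _ _ _ _ _ t1B); apply: eq_bigr => t _.
  by rewrite big_nat1 /link; ring.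
have -> : chain corner_term u0 k.+2 e =
    \sum_(e' : bool) chain corner_term u0 k.+1 e' * corner_term k.+1 e' e by [].
pose X t := dim t * link 0 u0 t *
  \prod_(0 <= j < k.+1) tet (a j) (a j.+1) (b j) (S j.+1) (S j) t.
transitivity (nu (a' 0 u0) * nu (a' k.+2 e) * \sum_(t < B) X t *
  \sum_(e' : bool) dim (a' k.+1 e') *
    edge_tet (b k.+1) (a k.+1) (a k.+2) (a' k.+1 e') (a' k.+2 e) *
    tet (a' k.+1 e') (a' k.+2 e) (b k.+1) (S k.+2) (S k.+1) t1 * link k.+1 e' t).
  under [in RHS]eq_bigr do rewrite mulr_sumr.
  rewrite exchange_big mulr_sumr; apply: eq_bigr => e' _.
  rewrite IHk /corner_term -nu_sqr // !mulr_sumr mulr_suml; apply: eq_bigr => t _.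
  by rewrite /X; ring.
congr (_ * _); apply: eq_bigr => t _; rewrite /link corner_step (big_nat_recr k.+1) //= /X /link.
by ring.
Qed.

End Transport.

Lemma tet_far a b c d e f : (d + b < f)%N -> tet a b c d e f = 0.
Proof.
move=> far; apply/eqP; apply: contraTT far => /tet_adm[_ _ + _].
by rewrite /adm -leqNgt => /andP[].
Qed.

Lemma edge_tet_far x s s' t t' : (x + s < s')%N -> edge_tet x s s' t t' = 0.
Proof.
move=> far; apply/eqP; apply: contraTT far => /tet_adm[+ _ _ _].
by rewrite /adm -leqNgt => /andP[].
Qed.

Lemma shift_color_leq e n : (shift_color e n <= n.+1)%N.
Proof. by case: e => //=; apply: leq_trans (leq_pred n) _. Qed.

(** The two ends of the strand meet at the last corner, where corner_close
    sums out t1. *)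
Lemma face_transport (a b S : nat -> nat) u0 u1 m B :
  (0 < m)%N -> a m.+1 = a 0%N -> S m.+1 = S 0%N -> (S 0%N + a 0%N + 2 < B)%N ->
  let a0' := shift_color u0 (a 0%N) in let am' := shift_color u1 (a m) in
  \sum_(t1 < B) dim t1 * (chain (corner_term a b S t1) u0 m u1 *
     tet am' a0' (b m) (S 0%N) (S m) t1)
  = nu a0' * nu am' * edge_tet (b m) (a m) (a 0%N) am' a0' *
    \sum_(t < B) dim t *
      \prod_(0 <= j < m.+1) tet (a j) (a j.+1) (b j) (S j.+1) (S j) t.
Proof.
case: m => // m _ am Sm ltB a0' am'.
pose prod t := \prod_(0 <= j < m.+1) tet (a j) (a j.+1) (b j) (S j.+1) (S j) t.
pose E0 t t1 := edge_tet (S 0%N) (a 0%N) t a0' t1.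
pose Em t t1 := edge_tet (S m.+1) (a m.+1) t am' t1.
have le0 : (a0' <= (a 0%N).+1)%N by exact: shift_color_leq.
transitivity (nu a0' * nu am' * \sum_(t < B) dim t * prod t *
   \sum_(t1 < B) dim t1 * tet am' a0' (b m.+1) (S 0%N) (S m.+1) t1 * Em t t1 * E0 t t1).
  under [in RHS]eq_bigr do rewrite mulr_sumr.
  rewrite exchange_big mulr_sumr; apply: eq_bigr => t1 _.
  have [lt1|ge1] := ltnP t1.+1 B; last first.
    rewrite tet_far ?mulr0; last first.
      by clear -le0 ltB ge1; lia.
    by rewrite big1 ?mulr0 // => t _; rewrite !(mulr0, mul0r).
  rewrite (chain_transport _ _ _ _ lt1) -/a0' -/am' [X in dim t1 * X = _]mulrAC mulrA !mulr_sumr.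
  by apply: eq_bigr => t _; rewrite /prod /E0 /Em; ring.
rewrite -[RHS]mulrA; congr (_ * _); rewrite mulr_sumr; apply: eq_bigr => t _.
rewrite (big_nat_recr m.+1) //= -/(prod t) am Sm.
have [lt1|ge1] := ltnP t.+1 B; last first.
  rewrite [tet (a m.+1) _ _ _ _ _]tet_far; last by clear -ltB ge1; lia.
  rewrite big1 ?mulr0 // => t1 _; rewrite /E0 edge_tet_far ?mulr0 //.
  by clear -ltB ge1; lia.
by rewrite (corner_close _ _ _ _ _ _ _ lt1); ring.
Qed.

Section Face.
Variables (G : cmap) (poly : trivalent_polyhedron G) (x0 : dart G).
Implicit Types (x y : dart G) (c : edge_t G -> nat).
Let triv := polyhedron_trivalent poly.
Local Notation D := (region_of x0).
Local Notation p := (blength x0).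

Lemma bdart_region i : region_of (bdart x0 i) = D.
Proof. by elim: i => //= i IHi; rewrite region_of_face. Qed.

Lemma bdart_blength : bdart x0 p = x0.
Proof. exact: (iter_porbit (face G) x0). Qed.

Lemma bdart_inj i j : (i < p)%N -> (j < p)%N -> bdart x0 i = bdart x0 j -> i = j.
Proof.
move=> ip jp e; apply/eqP.
rewrite -(nth_uniq x0 _ _ (uniq_traject_porbit (face G) x0)) ?size_traject //.
by rewrite !nth_traject // -/(bdart x0 i) e.
Qed.

Lemma bdart_surj x : region_of x = D -> exists2 i, (i < p)%N & bdart x0 i = x.
Proof.
move/esym/orbit_ofP; rewrite porbit_traject => /trajectP[i ip ->].
by exists i.
Qed.

Lemma blength_gt1 : (1 < p)%N.
Proof.
have p0 : (0 < p)%N by apply/card_gt0P; exists x0; rewrite mem_region.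
rewrite ltn_neqAle p0 andbT; apply/eqP => p1; have := bdart_blength.
rewrite -p1 /= => e; have := no_loop poly x0.
by rewrite -vertex_of_face e eqxx.
Qed.

Lemma prod_face (V : comPzSemiRingType) (F : dart G -> V) :
  \prod_(x | region_of x == D) F x = \prod_(0 <= j < p) F (bdart x0 j.+1).
Proof.
transitivity (\prod_(0 <= j < p) F (bdart x0 j)).
  transitivity (\prod_(x <- traject (face G) x0 p) F x).
    rewrite big_uniq ?uniq_traject_porbit //; apply: eq_bigl => x.
    by rewrite -porbit_traject -orbit_of_mem.
  rewrite (big_nth x0) size_traject !big_nat; apply: eq_bigr => j /andP[_ jp].
  by rewrite nth_traject.
case: p bdart_blength blength_gt1 => // k ek _.
by rewrite big_nat_recl // [RHS]big_nat_recr // mulrC ek.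
Qed.

Lemma across_neq i : region_of (edge G (bdart x0 i)) != D.
Proof. by rewrite -[X in _ != X](bdart_region i) eq_sym; exact: region_of_edge_neq. Qed.

Definition on_face (e : edge_t G) : bool := [exists x in val D, edge_of x == e].

Lemma on_faceP x : on_face (edge_of x) -> region_of x = D \/ region_of (edge G x) = D.
Proof.
case/exists_inP => y; rewrite mem_region => /eqP ry /eqP /edge_of_eq[ey|ey].
  by left; rewrite -ry ey.
by right; rewrite -ry ey.
Qed.

Lemma bedge_inj i j : (i < p)%N -> (j < p)%N -> bedge x0 i = bedge x0 j -> i = j.
Proof.
move=> ip jp /(congr1 val) /= /edge_of_eq[|e]; first exact: bdart_inj.
by have := across_neq j; rewrite -e bdart_region eqxx.
Qed.

Lemma bedge_surj (e : boundary_t x0) : exists2 i, (i < p)%N & bedge x0 i = e.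
Proof.
case: e => e he; have /exists_inP[x] := he.
rewrite mem_region => /eqP /bdart_surj[i ip <-] /eqP ei.
by exists i => //; apply: val_inj.
Qed.

Lemma perturb_bedge c delta i :
  perturb c delta (edge_of (bdart x0 i)) =
  shift_color (delta (bedge x0 i)) (c (edge_of (bdart x0 i))).
Proof. by rewrite /perturb -[edge_of _]/(val (bedge x0 i)) valK. Qed.

Lemma perturb_off c (delta : {ffun boundary_t x0 -> bool}) e :
  ~~ on_face e -> perturb c delta e = c e.
Proof. by move=> ne; rewrite /perturb insubN. Qed.

Lemma node_bdart i : node G (bdart x0 i.+1) = edge G (bdart x0 i).
Proof. exact: node_face. Qed.

Lemma spoke_off i : ~~ on_face (spoke x0 i).
Proof.
apply/negP => /on_faceP[e|e].
  by have := across_neq i.+1; rewrite (region_of_edge triv) e eqxx.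
by have := across_neq i; rewrite -node_bdart -region_of_edge_node e eqxx.
Qed.

Definition face_vertex (v : vertex_t G) : bool :=
  [exists x, (region_of x == D) && (vertex_of x == v)].

(** A face passes at most once through each vertex, since no edge has the same
    region on both sides. *)
Lemma face_vertex_inj x y : region_of x = D -> region_of y = D ->
  vertex_of x = vertex_of y -> x = y.
Proof.
move=> rx ry /(vertex_of_eq triv)[//|e|e].
  by have := region_of_edge_neq poly x; rewrite e region_of_edge_node -e rx ry eqxx.
by have := region_of_edge_neq poly y; rewrite (region_of_edge triv) -e rx ry eqxx.
Qed.

Lemma prod_face_vertex (V : comPzSemiRingType) (F : dart G -> V) :
  (forall x y, vertex_of x = vertex_of y -> F x = F y) ->
  \prod_(v | face_vertex v) F (vertex_dart v) = \prod_(0 <= j < p) F (bdart x0 j.+1).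
Proof.
move=> Fv; rewrite -prod_face.
rewrite [RHS](partition_big (@vertex_of G) face_vertex) /=; last first.
  by move=> x rx; apply/existsP; exists x; rewrite rx eqxx.
apply: eq_bigr => v /existsP[x /andP[/eqP rx /eqP vx]].
rewrite (big_pred1 x) => [|y].
  by apply: Fv; rewrite vertex_dartK.
apply/andP/eqP => [[/eqP ry /eqP vy]|->]; last by rewrite rx vx !eqxx.
by apply: face_vertex_inj => //; rewrite vx.
Qed.

Lemma off_face_region v x : ~~ face_vertex v -> vertex_of x = v -> region_of x != D.
Proof. by move=> nv vx; apply: contraNN nv => rx; apply/existsP; exists x; rewrite rx vx eqxx. Qed.

Lemma off_face_edge v x : ~~ face_vertex v -> vertex_of x = v -> ~~ on_face (edge_of x).
Proof.
move=> nv vx; apply/negP => /on_faceP[e|e].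
  by have := off_face_region nv vx; rewrite e eqxx.
have : vertex_of (face G (edge G x)) = v by rewrite vertex_of_face edgeK.
by move/(off_face_region nv); rewrite region_of_face e eqxx.
Qed.

Section State.
Variable (b : nat).
Local Notation state := {ffun region_t G -> 'I_b.+1}.
Implicit Type s : state.

Definition across s (i : nat) : nat := s (region_of (edge G (bdart x0 i))).

Definition off_face_weight c s : R[i] :=
  (\prod_(r | r != D) dim (s r)) *
  \prod_(v | ~~ face_vertex v) corner_weight c (nat_state s) (vertex_dart v).

Lemma face_state_weight c c' s (t : 'I_b.+1) : (forall e, ~~ on_face e -> c' e = c e) ->
  state_weight c' (nat_state (update s D t)) = off_face_weight c s * (dim t *
    \prod_(0 <= j < p) tet (c' (edge_of (bdart x0 j))) (c' (edge_of (bdart x0 j.+1)))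
       (c (spoke x0 j)) (across s j.+1) (across s j) t).
Proof.
move=> agree; rewrite /state_weight (bigD1 D) //= [X in _ * X](bigID face_vertex) /=.
rewrite /off_face_weight; set P := \prod_(r | r != D) dim (s r).
set Q := \prod_(v | ~~ face_vertex v) _; set F := \prod_(0 <= j < p) _.
transitivity ((dim t * P) * (F * Q)); last by ring.
congr (_ * _ * (_ * _)); rewrite /P /Q /F.
- by rewrite /nat_state update_same.
- by apply: eq_bigr => r nr; rewrite /nat_state update_other.
- rewrite prod_face_vertex => [|x y e]; last exact: (corner_weight_vertex poly c' _ e).
  apply: eq_bigr => j _; rewrite [RHS]tet_swap12 /corner_weight.
  rewrite -[edge_of (node G (node G _))]/(spoke x0 j) (agree _ (spoke_off j)).
  rewrite -(region_of_edge triv) node_bdart edge_of_edge /nat_state.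
  by rewrite bdart_region update_same !update_other ?across_neq.
apply: eq_bigr => v nv; have vK := vertex_dartK v.
rewrite /corner_weight /nat_state !update_other ?(off_face_region nv) ?vertex_of_node //.
by rewrite !agree // (off_face_edge nv) ?vertex_of_node.
Qed.

End State.

Lemma shift_adm e n : adm 1 n (shift_color e n) = shift_ok e n.
Proof. by case: e; rewrite /shift_ok /= ?adm1S //; case: n => //= n; rewrite admS1. Qed.

Section Recursion.
Variable c : edge_t G -> nat.
Hypothesis ac : adm_coloring c.
Implicit Type delta : {ffun boundary_t x0 -> bool}.
Let m := p.-1.
Let a i := c (edge_of (bdart x0 i)).
Let bb i := c (spoke x0 i).

Lemma pE : p = m.+1.
Proof. by rewrite /m (ltn_predK blength_gt1). Qed.

Lemma m_gt0 : (0 < m)%N.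
Proof. by rewrite -ltnS -pE blength_gt1. Qed.

Lemma corner_adm_at c' i : adm_coloring c' ->
  adm (c' (edge_of (bdart x0 i))) (c' (edge_of (bdart x0 i.+1))) (c' (spoke x0 i)).
Proof.
move/(_ (bdart x0 i.+1)).
by rewrite -[edge_of (node G (node G _))]/(spoke x0 i) node_bdart edge_of_edge admC.
Qed.

Definition link_coef delta : R[i] := \prod_(0 <= j < m)
  (nu (perturb c delta (edge_of (bdart x0 j))) *
   nu (perturb c delta (edge_of (bdart x0 j.+1))) *
   edge_tet (bb j) (a j) (a j.+1) (perturb c delta (edge_of (bdart x0 j)))
     (perturb c delta (edge_of (bdart x0 j.+1)))).

Lemma kcoefE delta : adm_perturbation c delta -> kcoef rt A c delta = link_coef delta.
Proof.
case=> ok apc; apply: eq_bigr => j _; apply: tau_ratioE.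
- exact: corner_adm_at.
- by have := corner_adm_at j apc; rewrite [perturb _ _ (spoke _ _)]perturb_off // spoke_off.
- by rewrite perturb_bedge shift_adm; exact: (ok (bedge x0 j)).
by rewrite perturb_bedge shift_adm; exact: (ok (bedge x0 j.+1)).
Qed.

(** Each edge of D ends at one of the corners 0, ..., p - 2, and the
    tetrahedron of the strand at this corner vanishes if the shift of the edge
    is illegal; a nonzero state weight gives the admissibility of the
    perturbed coloring. *)
Lemma link_coef_adm delta f : link_coef delta != 0 ->
  state_weight (perturb c delta) f != 0 -> adm_perturbation c delta.
Proof.
move=> lk /(state_weight_shadow poly)[_ apc]; split=> // e.
have [i ip <-] := bedge_surj e; rewrite /=.
have lkj j : (j < m)%N -> [/\ shift_ok (delta (bedge x0 j)) (a j) &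
    shift_ok (delta (bedge x0 j.+1)) (a j.+1)].
  move=> jm; have : j \in index_iota 0 m by rewrite mem_index_iota.
  move: lk; rewrite /link_coef prodf_seq_neq0 => /allP/(_ j) /[apply] /=.
  rewrite mulf_eq0 negb_or => /andP[_ /tet_adm[_ _]].
  rewrite -[face G _]/(bdart x0 j.+1) !perturb_bedge => h1 h2.
  by rewrite -!shift_adm; split=> //; rewrite admS.
have [im|mi] := ltnP i m; first by case: (lkj i im).
have -> : i = m.-1.+1.
  rewrite prednK ?m_gt0 //; apply/eqP; rewrite eqn_leq mi andbT.
  by rewrite -ltnS -pE.
by case: (lkj m.-1); rewrite // prednK ?m_gt0.
Qed.

Lemma ZcoefE u0 u1 : shift_ok u0 (a 0) -> shift_ok u1 (a m) ->
  adm (shift_color u0 (a 0%N)) (shift_color u1 (a m)) (bb m) ->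
  Zcoef rt A x0 c u0 u1 =
  nu (shift_color u0 (a 0%N)) * nu (shift_color u1 (a m)) *
  edge_tet (bb m) (a m) (a 0%N) (shift_color u1 (a m)) (shift_color u0 (a 0%N)).
Proof.
move=> ok0 ok1 h; rewrite /Zcoef tau_ratioE ?shift_adm //.
- by congr (_ * _); rewrite mulrC.
- by have := corner_adm_at m ac; rewrite -pE bdart_blength.
by rewrite admC.
Qed.

(** As D is not the base region, its state is summed over on both sides, and
    face_transport applies with the states of the other regions fixed. *)
Lemma recursion_off u0 u1 r0 : r0 != D ->
  shift_ok u0 (a 0) -> shift_ok u1 (a m) ->
  adm (shift_color u0 (a 0%N)) (shift_color u1 (a m)) (bb m) ->
  \sum_(delta : {ffun boundary_t x0 -> bool} |
      [&& `[< adm_perturbation c delta >], delta (bedge x0 0) == u0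
        & delta (bedge x0 m) == u1])
    kcoef rt A c delta * bracket rt A r0 (perturb c delta)
  = Zcoef rt A x0 c u0 u1 * bracket rt A r0 c.
Proof.
move=> nr0 ok0 ok1 hadm; rewrite ZcoefE //.
have [K leK] : exists K, forall e, (c e <= K)%N.
  by exists (\max_e c e)%N => e; exact: leq_bigmax.
have leKS e : (c e <= K.+1)%N by exact: leqW.
have leKp delta e : (perturb c delta e <= K.+1)%N.
  rewrite /perturb; case: insub => // e'.
  by apply: leq_trans (shift_color_leq _ _) _; rewrite ltnS.
(* Beyond B0 the state across e_0 makes all weights vanish; the other terms of b
   leave room for the states of D next to it. *)
pose B0 := (K.+1 * #|{: vertex_t G}|.+1)%N; pose b := (B0 + K + 2)%N.
have leb : (K.+1 * #|{: vertex_t G}|.+1 <= b)%N by rewrite /b -addnA leq_addr.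
pose state := {ffun region_t G -> 'I_b.+1}.
pose ends delta := (delta (bedge x0 0) == u0) && (delta (bedge x0 m) == u1).
transitivity (\sum_(delta | ends delta) \sum_(s : state | s r0 == ord0)
    link_coef delta * state_weight (perturb c delta) (nat_state s)).
  rewrite (eq_bigl (fun delta => ends delta && `[< adm_perturbation c delta >])); last first.
    by move=> delta; rewrite andbC.
  rewrite big_mkcondr; apply: eq_bigr => delta _; rewrite -mulr_sumr.
  case: ifPn => [/asboolP ap|/asboolPn nap].
    by rewrite kcoefE // (bracketE poly (leKp delta) _ leb) //; case: ap.
  symmetry; rewrite mulr_sumr big1 // => s _; apply/eqP.
  apply/negPn/negP; rewrite mulf_eq0 negb_or => /andP[h1 h2].
  by apply: nap; exact: link_coef_adm h1 h2.
rewrite (bracketE poly leKS ac leb) exchange_big mulr_sumr.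
have upd (s : state) (y : 'I_b.+1) : (update s D y r0 == ord0) = (s r0 == ord0).
  by rewrite update_other.
rewrite (sum_update (i := D) ord0) // [RHS](sum_update (i := D) ord0) //.
apply: eq_bigr => s /andP[/eqP s0 _].
have [small|big] := leqP (across s 0) B0; last first.
  have SW0 c' t : (forall e, (c' e <= K.+1)%N) ->
      state_weight c' (nat_state (update s D t)) = 0.
    move=> leK'; apply/eqP; apply: contraTT big => nz; rewrite -leqNgt.
    have [sh _] := state_weight_shadow poly nz; have [y0 e0] := orbit_of_ex r0.
    have := shadow_bound poly (x0 := y0) leK' sh; rewrite -[region_of y0]/(orbit_of _ y0) e0.
    rewrite /nat_state update_other // s0 => /(_ erefl (region_of (edge G x0))).
    by rewrite update_other ?(across_neq 0).
  rewrite [LHS]big1 => [|t _].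
    by symmetry; apply: big1 => t _; rewrite SW0 ?mulr0.
  by apply: big1 => delta _; rewrite SW0 ?mulr0.
have am : a m.+1 = a 0%N by rewrite /a -pE bdart_blength.
have Sm : across s m.+1 = across s 0 by rewrite /across -pE bdart_blength.
have ltB : (across s 0 + a 0%N + 2 < b.+1)%N.
  rewrite /b ltnS leq_add2r leq_add //; exact: leK.
have FT := face_transport bb u0 u1 m_gt0 am Sm ltB.
pose a0' := shift_color u0 (a 0%N); pose am' := shift_color u1 (a m).
transitivity (off_face_weight c s * \sum_(t < b.+1) dim t *
  (chain (corner_term a bb (across s) t) u0 m u1 *
     tet am' a0' (bb m) (across s 0) (across s m) t)).
  rewrite mulr_sumr; apply: eq_bigr => t _.
  have binj i j : (i <= m)%N -> (j <= m)%N -> bedge x0 i = bedge x0 j -> i = j.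
    by move=> im jm; apply: bedge_inj; rewrite pE ltnS.
  have bsurj k : exists2 i, (i <= m)%N & bedge x0 i = k.
    by have [i im <-] := bedge_surj k; exists i; rewrite // -ltnS -pE.
  rewrite -(chain_sum (corner_term a bb (across s) t) binj bsurj) mulr_suml !mulr_sumr.
  apply: eq_bigr => delta /andP[/eqP d0 /eqP dm].
  rewrite (face_state_weight _ (c := c)); last by move=> e; exact: perturb_off.
  have e0 : perturb c delta (edge_of (bdart x0 m.+1)) = a0'.
    by rewrite -pE bdart_blength -[x0 in edge_of x0]/(bdart x0 0) perturb_bedge d0.
  have em : perturb c delta (edge_of (bdart x0 m)) = am' by rewrite perturb_bedge dm.
  rewrite [in LHS]pE big_nat_recr // e0 em Sm.
  set T := tet am' _ _ _ _ _.
  have -> : \prod_(0 <= j < m) corner_term a bb (across s) t j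
        (delta (bedge x0 j)) (delta (bedge x0 j.+1)) =
      link_coef delta * \prod_(0 <= j < m) tet (perturb c delta (edge_of (bdart x0 j)))
        (perturb c delta (edge_of (bdart x0 j.+1))) (bb j) (across s j.+1) (across s j) t.
    rewrite /link_coef -big_split; apply: eq_bigr => j _.
    by rewrite /corner_term /= -[face G _]/(bdart x0 j.+1) !perturb_bedge.
  by rewrite /=; ring.
rewrite FT !mulr_sumr; apply: eq_bigr => t _.
by rewrite (face_state_weight _ (c := c)) // pE -/a0' -/am' /a /bb; ring.
Qed.

End Recursion.
End Face.

End Invariant.

Theorem proposition4p3 (R : realType) (A : R[i]) (rt : nat -> R[i] -> R[i])
    (G : cmap) (r0 : region_t G) (c : edge_t G -> nat) (x0 : dart G)
    (u0 u1 : bool) :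
  A != 0 -> `|A| < 1 ->
  (forall k : nat, (0 < k)%N -> qint_root k (rt k)) ->
  trivalent_polyhedron G ->
  adm_coloring c ->
  let p1 := (blength x0).-1 in
  let a0 := c (edge_of x0) in
  let ap := c (edge_of (bdart x0 p1)) in
  shift_ok u0 a0 -> shift_ok u1 ap ->
  adm (shift_color u0 a0) (shift_color u1 ap) (c (spoke x0 p1)) ->
  \sum_(delta : {ffun boundary_t x0 -> bool} |
      [&& `[< adm_perturbation c delta >], delta (bedge x0 0) == u0
        & delta (bedge x0 p1) == u1])
    kcoef rt A c delta * bracket rt A r0 (perturb c delta)
  = Zcoef rt A x0 c u0 u1 * bracket rt A r0 c.
Proof.
move=> A_neq0 A_lt1 rtP poly ac p1 a0 ap ok0 ok1 adm01.
have [r0D|r0D] := eqVneq r0 (region_of x0); last first.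
  exact: (recursion_off A_neq0 A_lt1 rtP poly ac r0D ok0 ok1 adm01).
have across c' : adm_coloring c' ->
    bracket rt A r0 c' = bracket rt A (region_of (edge G x0)) c'.
  by rewrite r0D; exact: bracket_adjacent.
rewrite (across c ac).
transitivity (\sum_(delta : {ffun boundary_t x0 -> bool} |
      [&& `[< adm_perturbation c delta >], delta (bedge x0 0) == u0
        & delta (bedge x0 p1) == u1])
    kcoef rt A c delta * bracket rt A (region_of (edge G x0)) (perturb c delta)).
  by apply: eq_bigr => delta /and3P[/asboolP[_ /across ->]].
apply: (recursion_off A_neq0 A_lt1 rtP poly ac _ ok0 ok1 adm01).
by rewrite eq_sym region_of_edge_neq.
Qed.
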